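(* Let $k$ be an algebraically closed field of characteristic $p>0$. Let $R\subseteq k[[x]]$ be a complete $k$-subalgebra such that $k[[x]]$ is a finite $R$-module and $k[[x]]$ is the normalization of $R$, and let $X:=\operatorname{Spec} R$. Then for all sufficiently large positive integers $e$, $$\mathrm{Nash}_{p^e-1}(X)\cong X.$$
   Context: Nash blowup of a coherent sheaf: let $Y$ be a reduced Noetherian scheme and $\mathcal{M}$ a coherent $\mathcal{O}_Y$-module that is locally free of constant rank $r$ on an open dense subscheme $U\subseteq Y$. Let $\mathrm{Grass}_r(\mathcal{M})$ be the Grassmannian $Y$-scheme of rank $r$ locally free quotients of $\mathcal{M}$; then $\mathrm{Grass}_r(\mathcal{M})\times_Y U\cong U$. The Nash blowup $\mathrm{Nash}(Y,\mathcal{M})$ is the closure of $\mathrm{Grass}_r(\mathcal{M})\times_Y U$ in $\mathrm{Grass}_r(\mathcal{M})$. Higher Nash blowup in the complete case: let $R = k[[x_1,\dots,x_r]]/\mathfrak{b}$ and $X=\operatorname{Spec} R$, reduced of pure dimension $d$. Let $\hat I_R\subseteq R\hat\otimes_k R$ be the ideal generated by the elements $x_i\otimes 1-1\otimes x_i$, and put $\hat P^n_R := R\hat\otimes_k R/\hat I_R^{\,n+1}$, regarded as an $R$-module via $a\mapsto a\otimes 1$ (it is finitely generated). Let $\hat{\mathcal{P}}^n_X$ be the associated coherent $\mathcal{O}_X$-module. If $\hat{\mathcal{P}}^n_X$ is locally free of constant rank $\binom{n+d}{d}$ on an open dense subset (which holds for the $X$ in the claim, with $d=1$), then $\mathrm{Nash}_n(X):=\mathrm{Nash}(X,\hat{\mathcal{P}}^n_X)$.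 *)

(* Defs.v *)
From HB Require Import structures.
From mathcomp Require Import all_boot all_order all_algebra.
From mathcomp Require Import ring.
From mathcomp Require Import boolp classical_sets.

Set Implicit Arguments.
Unset Strict Implicit.
Unset Printing Implicit Defensive.

Import GRing.Theory.
Local Open Scope classical_set_scope.
Local Open Scope ring_scope.
Local Open Scope quotient_scope.

Definition powser (K : Type) : Type := nat -> K.

HB.instance Definition _ (K : Type) := gen_eqMixin (powser K).
HB.instance Definition _ (K : Type) := gen_choiceMixin (powser K).

Section PowerSeries.
Variable K : comNzRingType.
Implicit Types f g h : powser K.

Let zero : powser K := fun=> 0.
Let opp f : powser K := fun n => - f n.
Let add f g : powser K := fun n => f n + g n.

Fact powser_addA : associative add.
Proof. by move=> f g h; apply/funext => n; rewrite /add addrA. Qed.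
Fact powser_addC : commutative add.
Proof. by move=> f g; apply/funext => n; rewrite /add addrC. Qed.
Fact powser_add0 : left_id zero add.
Proof. by move=> f; apply/funext => n; rewrite /add add0r. Qed.
Fact powser_addN : left_inverse zero opp add.
Proof. by move=> f; apply/funext => n; rewrite /add /opp addNr. Qed.

HB.instance Definition _ := GRing.isZmodule.Build (powser K)
  powser_addA powser_addC powser_add0 powser_addN.

Definition powser_one : powser K := fun n => (n == 0)%:R.
Definition powser_mul f g : powser K :=
  fun n => \sum_(i < n.+1) f i * g (n - i)%N.

Definition powser_trunc N f : {poly K} := \poly_(i < N) f i.

Lemma powser_mul_trunc N f g n : (n < N)%N ->
  powser_mul f g n = (powser_trunc N f * powser_trunc N g)`_n.
Proof.
move=> nN; rewrite coefM; apply: eq_bigr => i _; rewrite !coef_poly.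
by rewrite !ifT ?(leq_ltn_trans _ nN) ?leq_subr // -ltnS.
Qed.

Lemma powser_truncM N f g n : (n < N)%N ->
  (powser_trunc N (powser_mul f g))`_n
    = (powser_trunc N f * powser_trunc N g)`_n.
Proof. by move=> nN; rewrite coef_poly nN (powser_mul_trunc _ _ nN). Qed.

Fact powser_mulA : associative powser_mul.
Proof.
move=> f g h; apply/funext => n.
rewrite !(powser_mul_trunc _ _ (ltnSn n)).
transitivity (powser_trunc n.+1 f * (powser_trunc n.+1 g * powser_trunc n.+1 h))`_n.
  rewrite !coefM; apply: eq_bigr => i _; rewrite powser_truncM //.
  by rewrite ltnS leq_subr.
rewrite mulrA coefM [in RHS]coefM; apply: eq_bigr => i _.
by rewrite powser_truncM.
Qed.
Fact powser_mulC : commutative powser_mul.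
Proof.
by move=> f g; apply/funext => n; rewrite !(powser_mul_trunc _ _ (ltnSn n)) mulrC.
Qed.
Fact powser_mul1 : left_id powser_one powser_mul.
Proof.
move=> f; apply/funext => n; rewrite /powser_mul big_ord_recl /powser_one eqxx.
rewrite mul1r subn0 big1 ?addr0 // => i _.
by rewrite /= /bump /= mul0r.
Qed.
Fact powser_mulDl : left_distributive powser_mul +%R.
Proof.
move=> f g h; apply/funext => n; rewrite /powser_mul -[RHS]big_split /=.
by apply: eq_bigr => i _; rewrite -mulrDl.
Qed.
Fact powser_one_neq0 : powser_one != 0.
Proof.
apply/eqP => /(congr1 (fun f => f 0%N)) /eqP.
by rewrite /powser_one /= oner_eq0.
Qed.

HB.instance Definition _ := GRing.Zmodule_isComNzRing.Build (powser K)
  powser_mulA powser_mulC powser_mul1 powser_mulDl powser_one_neq0.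

Definition powser_scale (a : K) f : powser K := fun n => a * f n.

Fact powser_scaleA a b f :
  powser_scale a (powser_scale b f) = powser_scale (a * b) f.
Proof. by apply/funext => n; rewrite /powser_scale mulrA. Qed.
Fact powser_scale1 : left_id 1 powser_scale.
Proof. by move=> f; apply/funext => n; rewrite /powser_scale mul1r. Qed.
Fact powser_scaleDr : right_distributive powser_scale +%R.
Proof. by move=> a f g; apply/funext => n; apply: mulrDr. Qed.
Fact powser_scaleDl f : {morph powser_scale^~ f : a b / a + b}.
Proof. by move=> a b; apply/funext => n; apply: mulrDl. Qed.

HB.instance Definition _ := GRing.Zmodule_isLmodule.Build K (powser K)
  powser_scaleA powser_scale1 powser_scaleDr powser_scaleDl.

Fact powser_scaleAl (a : K) f g : a *: (f * g) = (a *: f) * g.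
Proof.
apply/funext => n; rewrite [LHS]mulr_sumr.
by apply: eq_bigr => i _; rewrite mulrA.
Qed.

HB.instance Definition _ :=
  GRing.Lmodule_isLalgebra.Build K (powser K) powser_scaleAl.
HB.instance Definition _ := GRing.Lalgebra_isComAlgebra.Build K (powser K).

End PowerSeries.

Record submodule (R : pzRingType) (V : lmodType R) := Submodule {
  submod_set :> V -> Prop;
  submod0 : submod_set 0;
  submodD : forall u v, submod_set u -> submod_set v -> submod_set (u + v);
  submodZ : forall a v, submod_set v -> submod_set (a *: v)
}.

Section Submodules.
Variables (R : pzRingType) (V : lmodType R).
Implicit Types N : submodule V.

Lemma submodule_eqP N N' : (forall v, N v <-> N' v) -> N = N'.
Proof.
case: N => N N0 ND NZ; case: N' => N' N0' ND' NZ' /= NN'.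
have e : N = N' by apply/funext => v; apply/propext.
by case: N' / e N0' ND' NZ' {NN'} => *; congr Submodule; apply: Prop_irrelevance.
Qed.

Lemma submodN N v : N v -> N (- v).
Proof. by rewrite -scaleN1r; apply: submodZ. Qed.

Lemma submodB N u v : N u -> N v -> N (u - v).
Proof. by move=> Nu /submodN; apply: submodD. Qed.

Lemma submod_sum N (I : Type) (s : seq I) (P : pred I) (F : I -> V) :
  (forall i, P i -> N (F i)) -> N (\sum_(i <- s | P i) F i).
Proof.
move=> NF; elim/big_ind: _ => //; first exact: submod0.
exact: submodD.
Qed.

Definition span (S : set V) : submodule V.
Proof.
exists (fun v => forall N, (forall s, S s -> N s) -> N v) => [N _|u v Su Sv N SN|a v Sv N SN].
- exact: submod0.
- by apply: submodD; [apply: Su|apply: Sv].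
- by apply: submodZ; apply: Sv.
Defined.

Arguments span : simpl never.

Lemma span_gen (S : set V) v : S v -> span S v.
Proof. by move=> Sv N; apply. Qed.

Lemma span_min (S : set V) N : (forall s, S s -> N s) ->
  forall v, span S v -> N v.
Proof. by move=> SN v; apply. Qed.

Definition modeq N : rel V := fun u v => `[< N (u - v) >].

Fact modeq_equiv N : equiv_class_of (modeq N).
Proof.
split=> [u|u v|v u w].
- by apply/asboolP; rewrite subrr; apply: submod0.
- by apply/asboolP/asboolP => /submodN; rewrite opprB.
- move=> /asboolP uv /asboolP vw; apply/asboolP.
  by rewrite -(subrKA v); apply: submodD.
Qed.

Canonical modeq_equivRel N := EquivRelPack (modeq_equiv N).

Definition qmod N := {eq_quot (modeq N)}.

End Submodules.

HB.instance Definition _ (R : pzRingType) (V : lmodType R) (N : submodule V) :=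
  Choice.on (qmod N).
HB.instance Definition _ (R : pzRingType) (V : lmodType R) (N : submodule V) :=
  Quotient.on (qmod N).

Section QuotientModule.
Variables (R : pzRingType) (V : lmodType R) (N : submodule V).
Implicit Types u v : V.

Definition qpi (v : V) : qmod N := \pi v.

Lemma qpi_eq u v : qpi u = qpi v <-> N (u - v).
Proof.
by split=> [/eqmodP/asboolP//|Nuv]; apply/eqmodP/asboolP.
Qed.

Lemma qpi_surj (x : qmod N) : qpi (repr x) = x.
Proof. exact: reprK. Qed.

Definition qmod_opp (x : qmod N) := qpi (- repr x).
Definition qmod_add (x y : qmod N) := qpi (repr x + repr y).
Definition qmod_scale a (x : qmod N) := qpi (a *: repr x).

Lemma qpi_repr v : N (repr (qpi v) - v).
Proof. by apply/qpi_eq; rewrite qpi_surj. Qed.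

Lemma qmod_oppE v : qmod_opp (qpi v) = qpi (- v).
Proof.
by apply/qpi_eq; rewrite -opprD; apply/submodN/qpi_repr.
Qed.
Lemma qmod_addE u v : qmod_add (qpi u) (qpi v) = qpi (u + v).
Proof.
by apply/qpi_eq; rewrite opprD addrACA; apply: submodD; apply: qpi_repr.
Qed.
Lemma qmod_scaleE a v : qmod_scale a (qpi v) = qpi (a *: v).
Proof. by apply/qpi_eq; rewrite -scalerBr; apply/submodZ/qpi_repr. Qed.

Fact qmod_addA : associative qmod_add.
Proof.
move=> x y z; rewrite -(qpi_surj x) -(qpi_surj y) -(qpi_surj z).
by rewrite !qmod_addE addrA.
Qed.
Fact qmod_addC : commutative qmod_add.
Proof.
by move=> x y; rewrite -(qpi_surj x) -(qpi_surj y) !qmod_addE addrC.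
Qed.
Fact qmod_add0 : left_id (qpi 0) qmod_add.
Proof. by move=> x; rewrite -(qpi_surj x) !qmod_addE add0r. Qed.
Fact qmod_addN : left_inverse (qpi 0) qmod_opp qmod_add.
Proof. by move=> x; rewrite -(qpi_surj x) qmod_oppE qmod_addE addNr. Qed.

HB.instance Definition _ := GRing.isZmodule.Build (qmod N)
  qmod_addA qmod_addC qmod_add0 qmod_addN.

Fact qmod_scaleA a b x : qmod_scale a (qmod_scale b x) = qmod_scale (a * b) x.
Proof. by rewrite -(qpi_surj x) !qmod_scaleE scalerA. Qed.
Fact qmod_scale1 : left_id 1 qmod_scale.
Proof. by move=> x; rewrite -(qpi_surj x) !qmod_scaleE scale1r. Qed.
Fact qmod_scaleDr : right_distributive qmod_scale +%R.
Proof.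
move=> a x y; rewrite -(qpi_surj x) -(qpi_surj y).
by rewrite [_ + _]qmod_addE !qmod_scaleE [RHS]qmod_addE scalerDr.
Qed.
Fact qmod_scaleDl x : {morph qmod_scale^~ x : a b / a + b}.
Proof.
move=> a b; rewrite -(qpi_surj x) !qmod_scaleE [RHS]qmod_addE.
by rewrite scalerDl.
Qed.

HB.instance Definition _ := GRing.Zmodule_isLmodule.Build R (qmod N)
  qmod_scaleA qmod_scale1 qmod_scaleDr qmod_scaleDl.

Fact qpi_is_linear : linear qpi.
Proof.
by move=> a u v; rewrite -qmod_addE -qmod_scaleE.
Qed.
HB.instance Definition _ := GRing.isLinear.Build R V (qmod N) _ qpi qpi_is_linear.

End QuotientModule.

Definition ideal (A : comPzRingType) := submodule A^o.

Fixpoint ideal_pow (A : comPzRingType) (I : ideal A) (n : nat) : ideal A :=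
  if n is m.+1 then
    span [set c : A^o | exists a b : A, [/\ I a, ideal_pow I m b & c = a * b]]
  else span [set: A^o].

(* In a local ring this is the maximal ideal. *)
Definition max_ideal (A : comPzRingType) : ideal A :=
  span [set a : A^o | ~ exists b : A, (a : A) * b = 1].

Definition adically_complete (A : comPzRingType) (I : ideal A) :=
  (forall a : A, (forall n, ideal_pow I n a) -> a = 0) /\
  (forall u : nat -> A, (forall n, ideal_pow I n (u n.+1 - u n)) ->
     exists l : A, forall n, ideal_pow I n (l - u n)).

Record spectrum (A : comNzRingType) := PrimeIdeal {
  spectrum_ideal :> submodule A^o;
  spectrum_proper : ~ spectrum_ideal (1 : A);
  spectrumM : forall a b : A,
    spectrum_ideal (a * b) -> spectrum_ideal a \/ spectrum_ideal b
}.

Section Comap.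
Variables (A B : comNzRingType) (f : {rmorphism A -> B}) (q : spectrum B).

Definition comap_ideal : ideal A.
Proof.
exists (fun a : A => q (f a)) => [|a b qa qb|a b qb].
- by rewrite rmorph0; apply: submod0.
- by rewrite rmorphD; apply: submodD.
- by rewrite rmorphM; apply: (@submodZ _ _ q).
Defined.

Definition comap : spectrum A.
Proof.
exists comap_ideal => [|a b] /=; first by rewrite rmorph1; apply: spectrum_proper.
by rewrite rmorphM; apply: spectrumM.
Defined.

End Comap.

Definition spec_open (A : comNzRingType) (U : set (spectrum A)) :=
  forall P, U P -> exists f : A, ~ P f /\ forall Q : spectrum A, ~ Q f -> U Q.

Definition spec_dense (A : comNzRingType) (U : set (spectrum A)) :=
  forall V, spec_open V -> V !=set0 -> V `&` U !=set0.

(* The localization M_f is free of rank r over A_f.  A basis of M_f can be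
   scaled by powers of f so as to consist of fractions (v i)/1; the two clauses
   say that these generate M_f and are linearly independent over A_f. *)
Definition free_at (A : comNzRingType) (f : A) (M : lmodType A) (r : nat) :=
  exists v : 'I_r -> M,
    (forall m : M, exists (N : nat) (a : 'I_r -> A),
       f ^+ N *: m = \sum_(i < r) a i *: v i) /\
    (forall a : 'I_r -> A, \sum_(i < r) a i *: v i = 0 ->
       exists N : nat, forall i, f ^+ N * a i = 0).

Definition locally_free_on (A : comNzRingType) (U : set (spectrum A))
    (M : lmodType A) (r : nat) :=
  forall P, U P -> exists f : A, ~ P f /\ free_at f M r.

Section TensorRelation.
Variables (R : comNzRingType) (A : comAlgType R) (M : lmodType R).

(* Formal sums of pure tensors, modulo the relations defining A (x)_R M *)
Inductive tens_eq : seq (A * M) -> seq (A * M) -> Prop :=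
| tens_refl s : tens_eq s s
| tens_sym s t : tens_eq s t -> tens_eq t s
| tens_trans s t u : tens_eq s t -> tens_eq t u -> tens_eq s u
| tens_cat s s' t t' :
    tens_eq s s' -> tens_eq t t' -> tens_eq (s ++ t) (s' ++ t')
| tens_comm s t : tens_eq (s ++ t) (t ++ s)
| tens_zero m : tens_eq [:: (0, m)] [::]
| tens_addl a b m : tens_eq [:: (a + b, m)] [:: (a, m); (b, m)]
| tens_addr a m n : tens_eq [:: (a, m + n)] [:: (a, m); (a, n)]
| tens_bal c a m : tens_eq [:: (c *: a, m)] [:: (a, c *: m)].

Definition tens_rel : rel (seq (A * M)) := fun s t => `[< tens_eq s t >].

Fact tens_rel_equiv : equiv_class_of tens_rel.
Proof.
split=> [s|s t|t s u].
- by apply/asboolP; apply: tens_refl.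
- by apply/asboolP/asboolP; apply: tens_sym.
- by move=> /asboolP st /asboolP tu; apply/asboolP; apply: tens_trans tu.
Qed.
Canonical tens_equivRel := EquivRelPack tens_rel_equiv.

Definition tens := {eq_quot tens_rel}.

End TensorRelation.

HB.instance Definition _ (R : comNzRingType) (A : comAlgType R)
  (M : lmodType R) := Choice.on (tens A M).
HB.instance Definition _ (R : comNzRingType) (A : comAlgType R)
  (M : lmodType R) := Quotient.on (tens A M).

Section Tensor.
Variables (R : comNzRingType) (A : comAlgType R) (M : lmodType R).
Implicit Types (s t : seq (A * M)) (x y z : tens A M).

Definition tens_class s : tens A M := \pi s.

Lemma tens_classP s t : tens_class s = tens_class t <-> tens_eq s t.
Proof. by split=> [/eqmodP/asboolP//|st]; apply/eqmodP/asboolP. Qed.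

Lemma tens_class_repr x : tens_class (repr x) = x.
Proof. exact: reprK. Qed.

Lemma tens_eq_repr s : tens_eq (repr (tens_class s)) s.
Proof. by apply/tens_classP; rewrite tens_class_repr. Qed.

Definition tens_neg_seq s := [seq (- p.1, p.2) | p <- s].
Definition tens_add x y := tens_class (repr x ++ repr y).
Definition tens_opp x := tens_class (tens_neg_seq (repr x)).

Lemma tens_addE s t :
  tens_add (tens_class s) (tens_class t) = tens_class (s ++ t).
Proof. by apply/tens_classP; apply: tens_cat; apply: tens_eq_repr. Qed.

Fact tens_addA : associative tens_add.
Proof.
move=> x y z; rewrite -(tens_class_repr x) -(tens_class_repr y).
by rewrite -(tens_class_repr z) !tens_addE catA.
Qed.
Fact tens_addC : commutative tens_add.
Proof.
move=> x y; rewrite -(tens_class_repr x) -(tens_class_repr y) !tens_addE.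
by apply/tens_classP; apply: tens_comm.
Qed.
Fact tens_add0 : left_id (tens_class [::]) tens_add.
Proof. by move=> x; rewrite -(tens_class_repr x) tens_addE. Qed.
Fact tens_addN : left_inverse (tens_class [::]) tens_opp tens_add.
Proof.
move=> x; rewrite -{2}(tens_class_repr x) /tens_opp tens_addE.
apply/tens_classP; elim: (repr x) => [|[a m] s IHs] /=; first exact: tens_refl.
apply: tens_trans IHs; rewrite -/(tens_neg_seq s).
apply: (@tens_trans _ _ _ _ ([:: (- a, m)] ++ ((a, m) :: s) ++ tens_neg_seq s)).
  apply: (@tens_cat _ _ _ [:: _] [:: _]); first exact: tens_refl.
  exact: tens_comm.
apply: (@tens_cat _ _ _ [:: _; _] [::]); last exact: tens_comm.
apply: (@tens_trans _ _ _ _ [:: (- a + a, m)]); first exact/tens_sym/tens_addl.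
by rewrite addNr; apply: tens_zero.
Qed.

HB.instance Definition _ := GRing.isZmodule.Build (tens A M)
  tens_addA tens_addC tens_add0 tens_addN.

Definition pure (a : A) (m : M) : tens A M := tens_class [:: (a, m)].

Lemma pureDl m : {morph pure^~ m : a b / a + b}.
Proof.
move=> a b; rewrite [RHS]tens_addE.
by apply/tens_classP; apply: tens_addl.
Qed.
Lemma pureDr a : {morph pure a : m n / m + n}.
Proof.
move=> m n; rewrite [RHS]tens_addE.
by apply/tens_classP; apply: tens_addr.
Qed.
Lemma pure_bal c a m : pure (c *: a) m = pure a (c *: m).
Proof. by apply/tens_classP; apply: tens_bal. Qed.

Lemma tens_classE s : tens_class s = \sum_(p <- s) pure p.1 p.2.
Proof.
elim: s => [|[a m] s IHs]; first by rewrite big_nil.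
by rewrite big_cons -IHs [RHS]tens_addE.
Qed.

Lemma tens_sumE x : x = \sum_(p <- repr x) pure p.1 p.2.
Proof. by rewrite -tens_classE tens_class_repr. Qed.

Lemma tens_ind (P : tens A M -> Prop) :
  P 0 -> (forall x y, P x -> P y -> P (x + y)) ->
  (forall a m, P (pure a m)) -> forall x, P x.
Proof.
by move=> P0 PD Pp x; rewrite (tens_sumE x); elim/big_ind: _ => // p _.
Qed.

Section Lift.
Variables (V : zmodType) (beta : A -> M -> V).

Definition balanced :=
  [/\ forall m, {morph beta^~ m : a b / a + b},
      forall a, {morph beta a : m n / m + n} &
      forall c a m, beta (c *: a) m = beta a (c *: m)].

Definition tens_lift x : V := \sum_(p <- repr x) beta p.1 p.2.

Hypothesis bal : balanced.

Lemma balanced0 m : beta 0 m = 0.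
Proof. by case: bal => D _ _; apply: (addrI (beta 0 m)); rewrite -D !addr0. Qed.

Lemma tens_lift_eq s t : tens_eq s t ->
  \sum_(p <- s) beta p.1 p.2 = \sum_(p <- t) beta p.1 p.2.
Proof.
case: (bal) => Dl Dr E.
elim=> {s t} [//|s t _ -> //|s t u _ -> _ -> //|s s' t t' _ es _ et|s t|m|a b m|a m n|c a m].
- by rewrite !big_cat es et.
- by rewrite !big_cat; apply: addrC.
- by rewrite big_seq1 big_nil balanced0.
- by rewrite !big_cons !big_nil /= !addr0 Dl.
- by rewrite !big_cons !big_nil /= !addr0 Dr.
- by rewrite !big_seq1 E.
Qed.

Lemma tens_lift_class s :
  tens_lift (tens_class s) = \sum_(p <- s) beta p.1 p.2.
Proof. by apply: tens_lift_eq; apply: tens_eq_repr. Qed.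

Lemma tens_lift_pure a m : tens_lift (pure a m) = beta a m.
Proof. by rewrite tens_lift_class big_seq1. Qed.

Lemma tens_lift0 : tens_lift 0 = 0.
Proof. by rewrite [LHS]tens_lift_class big_nil. Qed.

Lemma tens_liftD : {morph tens_lift : x y / x + y}.
Proof.
move=> x y; rewrite -(tens_class_repr x) -(tens_class_repr y).
by rewrite [_ + _]tens_addE !tens_lift_class big_cat.
Qed.

End Lift.

Definition tens_scale (b : A) : tens A M -> tens A M :=
  tens_lift (fun a m => pure (b * a) m).

Fact tens_scale_bal b : balanced (fun a m => pure (b * a) m).
Proof.
split=> [m a a'|a m n|c a m]; first by rewrite mulrDr pureDl.
- by rewrite pureDr.
- by rewrite -pure_bal scalerAr.
Qed.

Lemma tens_scale_pure b a m : tens_scale b (pure a m) = pure (b * a) m.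
Proof. exact/tens_lift_pure/tens_scale_bal. Qed.

Fact tens_scaleDr : right_distributive tens_scale +%R.
Proof. by move=> b x y; apply/tens_liftD/tens_scale_bal. Qed.

Fact tens_scale0 b : tens_scale b 0 = 0.
Proof. exact/tens_lift0/tens_scale_bal. Qed.

Fact tens_scaleA a b x : tens_scale a (tens_scale b x) = tens_scale (a * b) x.
Proof.
elim/tens_ind: x => [|x y ex ey|c m]; first by rewrite !tens_scale0.
- by rewrite !tens_scaleDr ex ey.
- by rewrite !tens_scale_pure mulrA.
Qed.
Fact tens_scale1 : left_id 1 tens_scale.
Proof.
elim/tens_ind => [|x y ex ey|c m]; first by rewrite !tens_scale0.
- by rewrite !tens_scaleDr ex ey.
- by rewrite !tens_scale_pure mul1r.
Qed.
Fact tens_scaleDl x : {morph tens_scale^~ x : a b / a + b}.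
Proof.
move=> a b; elim/tens_ind: x => [|x y ex ey|c m].
- by rewrite !tens_scale0 addr0.
- by rewrite !tens_scaleDr ex ey addrACA.
- by rewrite !tens_scale_pure mulrDl pureDl.
Qed.

HB.instance Definition _ := GRing.Zmodule_isLmodule.Build A (tens A M)
  tens_scaleA tens_scale1 tens_scaleDr tens_scaleDl.

Lemma scale_pure (b a : A) m : b *: pure a m = pure (b * a) m.
Proof. exact: tens_scale_pure. Qed.

Lemma pureE (a : A) m : pure a m = a *: pure 1 m.
Proof. by rewrite scale_pure mulr1. Qed.

End Tensor.

Section BaseChange.
Variables (R : comNzRingType) (M : lmodType R) (A B : comAlgType R).
Variable f : {lrmorphism A -> B}.

Definition tens_map : tens A M -> tens B M :=
  tens_lift (fun a m => pure (f a) m).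

Fact tens_map_bal : balanced (fun a (m : M) => pure (f a) m).
Proof.
split=> [m a a'|a m n|c a m]; first by rewrite rmorphD pureDl.
- by rewrite pureDr.
- by rewrite -pure_bal linearZ.
Qed.

Lemma tens_map_pure a m : tens_map (pure a m) = pure (f a) m.
Proof. exact/tens_lift_pure/tens_map_bal. Qed.

Lemma tens_map0 : tens_map 0 = 0.
Proof. exact/tens_lift0/tens_map_bal. Qed.

Lemma tens_mapD : {morph tens_map : x y / x + y}.
Proof. exact/tens_liftD/tens_map_bal. Qed.

Lemma tens_mapZ a x : tens_map (a *: x) = f a *: tens_map x.
Proof.
elim/tens_ind: x => [|x y ex ey|c m]; first by rewrite scaler0 tens_map0 scaler0.
- by rewrite scalerDr !tens_mapD ex ey scalerDr.
- by rewrite scale_pure !tens_map_pure scale_pure rmorphM.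
Qed.

Lemma tens_map_sum (I : Type) (s : seq I) (F : I -> tens A M) :
  tens_map (\sum_(i <- s) F i) = \sum_(i <- s) tens_map (F i).
Proof. by apply: big_morph; [apply: tens_mapD | apply: tens_map0]. Qed.

(* The quotient of A (x)_R M by N, tensored with B over A, is the quotient of
   B (x)_R M by the submodule generated by the image of N. *)
Definition base_change (N : submodule (tens A M)) : submodule (tens B M) :=
  span [set tens_map x | x in [set x | N x]].

End BaseChange.

Section LocalizedPolynomials.
Variables (B : comNzRingType) (h : B).

(* The ideal (h X - 1) of B[X]; the quotient is B_h. *)
Definition loc_ideal : ideal {poly B}.
Proof.
exists (fun u : {poly B}^o => exists g : {poly B}, (u : {poly B}) = g * (h%:P * 'X - 1)).
- by exists 0; rewrite mul0r.
- by move=> _ _ [g ->] [g' ->]; exists (g + g'); rewrite mulrDl.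
- by move=> a _ [g ->]; exists (a * g); rewrite [a *: _]mulrA.
Defined.

Lemma loc_idealC b : loc_ideal b%:P -> exists N : nat, h ^+ N * b = 0.
Proof.
case=> g eg.
have g0 : g`_0 = - b.
  have := congr1 (fun u : {poly B} => u`_0) eg.
  rewrite /= mulrBr mulr1 mulrA coefB coefC eqxx coefMX eqxx sub0r.
  by move=> ->; rewrite opprK.
have gS n : g`_n = h ^+ n * g`_0.
  elim: n => [|n IHn]; first by rewrite expr0 mul1r.
  have := congr1 (fun u : {poly B} => u`_n.+1) eg.
  rewrite /= mulrBr mulr1 mulrA coefB coefC coefMX /= coefMC.
  move/esym/eqP; rewrite subr_eq0 => /eqP <-.
  by rewrite IHn exprS; ring.
exists (size g).
have := gS (size g); rewrite nth_default // g0 mulrN => /esym/eqP.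
by rewrite oppr_eq0 => /eqP.
Qed.

Definition loc_frac (n : nat) (b : B) : qmod loc_ideal :=
  qpi loc_ideal (b%:P * 'X^n).

Lemma loc_fracD n b c : loc_frac n (b + c) = loc_frac n b + loc_frac n c.
Proof. by rewrite /loc_frac polyCD mulrDl linearD. Qed.

Lemma loc_frac0 n : loc_frac n 0 = 0.
Proof. by rewrite /loc_frac mul0r linear0. Qed.

Lemma loc_fracZ n b c : b%:P *: loc_frac n c = loc_frac n (b * c).
Proof. by rewrite /loc_frac -linearZ /= polyCM -mulrA. Qed.

Lemma loc_fracM n k b : loc_frac (n + k) (h ^+ k * b) = loc_frac n b.
Proof.
elim: k => [|k IHk]; first by rewrite addn0 expr0 mul1r.
rewrite -[RHS]IHk; apply/qpi_eq; exists ((h ^+ k * b)%:P * 'X^(n + k)).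
by rewrite addnS !exprS !polyCM; ring.
Qed.

End LocalizedPolynomials.

Section BaseChangeFree.
Variables (R : comNzRingType) (M : lmodType R) (A B : comAlgType R).
Variables (f : {lrmorphism A -> B}) (N : submodule (tens A M)).
Variables (h : A) (r : nat) (v : 'I_r -> qmod N).
Hypothesis vgen : forall x : qmod N, exists (n : nat) (a : 'I_r -> A),
  h ^+ n *: x = \sum_(i < r) a i *: v i.
Hypothesis vfree : forall a : 'I_r -> A, \sum_(i < r) a i *: v i = 0 ->
  exists n : nat, forall i, h ^+ n * a i = 0.

Let rep (x : tens A M) (n : nat) (a : 'I_r -> A) :=
  h ^+ n *: qpi N x = \sum_(i < r) a i *: v i.
Let frac := loc_frac (f h).

Fact bc_fracM n k a : frac (n + k) (f (h ^+ k * a)) = frac n (f a).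
Proof. by rewrite rmorphM rmorphXn; apply: loc_fracM. Qed.

Fact bc_rep_uniq x n a n' a' : rep x n a -> rep x n' a' ->
  forall i, frac n (f (a i)) = frac n' (f (a' i)).
Proof.
move=> xa xa'.
have /vfree [K hK] : \sum_(i < r) (h ^+ n' * a i - h ^+ n * a' i) *: v i = 0.
  transitivity (h ^+ n' *: (\sum_(i < r) a i *: v i)
                  - h ^+ n *: (\sum_(i < r) a' i *: v i)).
    rewrite !scaler_sumr -sumrB; apply: eq_bigr => i _.
    by rewrite scalerBl !scalerA.
  by rewrite -xa -xa' !scalerA mulrC subrr.
move=> i; rewrite -(bc_fracM n (K + n')) -(bc_fracM n' (K + n)).
have -> : (n + (K + n') = n' + (K + n))%N by ring.
congr (frac _ (f _)); apply/eqP; rewrite -subr_eq0.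
by rewrite !exprD -!mulrA -mulrBr hK.
Qed.

Fact bc_repD x n a y n' a' : rep x n a -> rep y n' a' ->
  rep (x + y) (n + n') (fun i => h ^+ n' * a i + h ^+ n * a' i).
Proof.
move=> xa ya; rewrite /rep linearD scalerDr {1}addnC !exprD.
rewrite (mulrC (h ^+ n) (h ^+ n')) -scalerA xa mulrC -scalerA ya.
rewrite !scaler_sumr -big_split /=.
by apply: eq_bigr => i _; rewrite scalerDl !scalerA.
Qed.

Fact bc_repZ c x n a : rep x n a -> rep (c *: x) n (fun i => c * a i).
Proof.
move=> xa; rewrite /rep linearZ scalerA mulrC -scalerA xa scaler_sumr.
by apply: eq_bigr => i _; rewrite scalerA.
Qed.

Fact bc_rep_ex (m : M) : exists na : nat * ('I_r -> A), rep (pure 1 m) na.1 na.2.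
Proof. by have [n [a e]] := vgen (qpi N (pure 1 m)); exists (n, a). Qed.

Let nn m := (projT1 (cid (bc_rep_ex m))).1.
Let aa m := (projT1 (cid (bc_rep_ex m))).2.
Let aaP m : rep (pure 1 m) (nn m) (aa m).
Proof. exact: (projT2 (cid (bc_rep_ex m))). Qed.

Let beta i (b : B) (m : M) := b%:P *: frac (nn m) (f (aa m i)).

Fact bc_fracD n n' a a' :
  frac (n + n') (f (h ^+ n' * a + h ^+ n * a'))
    = frac n (f a) + frac n' (f a').
Proof.
rewrite rmorphD [LHS]loc_fracD; congr (_ + _); first exact: bc_fracM.
by rewrite addnC; apply: bc_fracM.
Qed.

Fact bc_bal i : balanced (beta i).
Proof.
split=> [m b c|b m m'|c b m]; rewrite /beta.
- by rewrite polyCD scalerDl.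
- rewrite -scalerDr; congr (_ *: _).
  rewrite -bc_fracD.
  apply: (bc_rep_uniq (aaP (m + m'))
    (a' := fun i => h ^+ nn m' * aa m i + h ^+ nn m * aa m' i)).
  by rewrite pureDr; apply: bc_repD; apply: aaP.
- have -> : frac (nn (c *: m)) (f (aa (c *: m) i)) =
            frac (nn m) (f (c%:A * aa m i)).
    apply: (bc_rep_uniq (aaP (c *: m)) (a' := fun i => c%:A * aa m i)).
    by rewrite -pure_bal pureE; apply: bc_repZ; apply: aaP.
  have fc : f (c%:A * aa m i) = c%:A * f (aa m i).
    by rewrite rmorphM /=; congr (_ * _); rewrite linearZ /= rmorph1.
  rewrite fc /frac !loc_fracZ; congr (loc_frac _ _).
  by rewrite mulrA; congr (_ * _); rewrite -scalerAr mulr1.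
Qed.

Let lam i : tens B M -> qmod (loc_ideal (f h)) := tens_lift (beta i).

Fact bc_lam0 i : lam i 0 = 0.
Proof. exact/tens_lift0/bc_bal. Qed.
Fact bc_lamD i : {morph lam i : x y / x + y}.
Proof. exact/tens_liftD/bc_bal. Qed.
Fact bc_lam_pure i b m : lam i (pure b m) = beta i b m.
Proof. exact/tens_lift_pure/bc_bal. Qed.

Fact bc_lamZ i b x : lam i (b *: x) = b%:P *: lam i x.
Proof.
elim/tens_ind: x => [|x y ex ey|c m].
- by rewrite scaler0 bc_lam0 scaler0.
- by rewrite scalerDr !bc_lamD ex ey scalerDr.
- by rewrite scale_pure !bc_lam_pure /beta polyCM scalerA.
Qed.

Fact bc_lam_rep x n a i : rep x n a -> lam i (tens_map f x) = frac n (f (a i)).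
Proof.
suff [n' [a' [xa' e]]] : exists n' a', rep x n' a' /\
    lam i (tens_map f x) = frac n' (f (a' i)).
  by move=> xa; rewrite e; apply: bc_rep_uniq xa' xa i.
elim/tens_ind: x => [|x y [n1 [a1 [xa ex]]] [n2 [a2 [ya ey]]]|c m].
- exists 0%N, (fun=> 0); split.
    by rewrite /rep (linear0 (qpi N)) scaler0 big1 // => j _; rewrite scale0r.
  by rewrite tens_map0 bc_lam0 rmorph0 /frac loc_frac0.
- exists (n1 + n2)%N, (fun i => h ^+ n2 * a1 i + h ^+ n1 * a2 i); split.
    exact: bc_repD.
  by rewrite tens_mapD bc_lamD ex ey bc_fracD.
- exists (nn m), (fun i => c * aa m i); split.
    by rewrite pureE; apply: bc_repZ; apply: aaP.
  by rewrite tens_map_pure bc_lam_pure /beta rmorphM /frac loc_fracZ.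
Qed.

Fact bc_lam_base_change i t : base_change f N t -> lam i t = 0.
Proof.
have s0 : lam i 0 = 0 by exact: bc_lam0.
have sD x y : lam i x = 0 -> lam i y = 0 -> lam i (x + y) = 0.
  by move=> ex ey; rewrite bc_lamD ex ey addr0.
have sZ b x : lam i x = 0 -> lam i (b *: x) = 0.
  by move=> ex; rewrite bc_lamZ ex scaler0.
apply: (span_min (N := Submodule s0 sD sZ)) => _ [x Nx <-].
rewrite /= (@bc_lam_rep x 0 (fun=> 0)) ?rmorph0 /frac ?loc_frac0 //.
rewrite /rep big1 => [|j _]; last by rewrite scale0r.
rewrite (_ : qpi N x = 0) ?scaler0 //.
by rewrite -[RHS](linear0 (qpi N)); apply/qpi_eq; rewrite subr0.
Qed.

Let w i : tens A M := repr (v i).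
Let wP i : qpi N (w i) = v i.
Proof. exact: qpi_surj. Qed.

Lemma tens_map_base_change x : N x -> base_change f N (tens_map f x).
Proof. by move=> Nx; apply: span_gen; exists x. Qed.

Fact bc_gen (y : qmod (base_change f N)) : exists (n : nat) (b : 'I_r -> B),
  f h ^+ n *: y = \sum_(i < r) b i *: qpi (base_change f N) (tens_map f (w i)).
Proof.
rewrite -(qpi_surj y); move: (repr y) => {y}.
elim/tens_ind => [|x y [n1 [a1 ex]] [n2 [a2 ey]]|c m].
- exists 0%N, (fun=> 0).
  by rewrite (linear0 (qpi _)) scaler0 big1 // => j _; rewrite scale0r.
- exists (n1 + n2)%N, (fun i => f h ^+ n2 * a1 i + f h ^+ n1 * a2 i).
  rewrite linearD scalerDr {1}addnC !exprD.
  rewrite (mulrC (f h ^+ n1)) -scalerA ex mulrC -scalerA ey.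
  rewrite !scaler_sumr -big_split /=.
  by apply: eq_bigr => i _; rewrite scalerDl !scalerA.
- have e : qpi (base_change f N) (tens_map f (h ^+ (nn m) *: pure 1 m)) =
    qpi (base_change f N) (tens_map f (\sum_(i < r) aa m i *: w i)).
    apply/qpi_eq; rewrite -scaleN1r -(rmorphN1 f) -tens_mapZ -tens_mapD scaleN1r.
    apply: tens_map_base_change; apply/qpi_eq; rewrite linearZ /= aaP linear_sum.
    by apply: eq_bigr => i _; rewrite linearZ /= wP.
  exists (nn m), (fun i => c * f (aa m i)).
  transitivity (c *: qpi (base_change f N) (tens_map f (h ^+ nn m *: pure 1 m))).
    rewrite tens_mapZ tens_map_pure rmorph1 rmorphXn (pureE c) !linearZ /=.
    by rewrite !scalerA mulrC.
  rewrite e tens_map_sum linear_sum /=.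
  rewrite scaler_sumr; apply: eq_bigr => i _.
  by rewrite tens_mapZ linearZ /= scalerA.
Qed.

Fact bc_free (b : 'I_r -> B) :
  \sum_(i < r) b i *: qpi (base_change f N) (tens_map f (w i)) = 0 ->
  exists n : nat, forall i, f h ^+ n * b i = 0.
Proof.
move=> b0.
have Nb : base_change f N (\sum_(i < r) b i *: tens_map f (w i)).
  rewrite -[X in submod_set _ X]subr0; apply/qpi_eq.
  rewrite linear_sum (linear0 (qpi _)) -[RHS]b0.
  by apply: eq_bigr => i _; rewrite linearZ.
have bi i : exists n : nat, f h ^+ n * b i = 0.
  apply: loc_idealC; rewrite -[X in submod_set _ X]subr0; apply/qpi_eq.
  rewrite (linear0 (qpi _)) -[RHS](bc_lam_base_change i Nb).
  rewrite (big_morph _ (bc_lamD i) (bc_lam0 i)).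
  have repw j : rep (w j) 0 (fun k => (k == j)%:R).
    rewrite /rep expr0 scale1r wP (bigD1 j) //= eqxx scale1r big1 ?addr0 // => k.
    by move=> /negPf ->; rewrite scale0r.
  rewrite (bigD1 i) //= big1 => [|j]; last first.
    rewrite eq_sym => /negPf ij; rewrite bc_lamZ (bc_lam_rep _ (repw j)) ij.
    by rewrite rmorph0 /frac loc_frac0 scaler0.
  rewrite addr0 bc_lamZ (bc_lam_rep _ (repw i)) eqxx rmorph1 /frac loc_fracZ.
  by rewrite mulr1 /loc_frac expr0 mulr1.
pose n i := projT1 (cid (bi i)).
have nP i : f h ^+ n i * b i = 0 := projT2 (cid (bi i)).
exists (\sum_(j < r) n j)%N => i.
by rewrite (bigD1 i) //= addnC exprD -mulrA nP mulr0.
Qed.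

End BaseChangeFree.

Lemma free_at_base_change (R : comNzRingType) (M : lmodType R)
    (A B : comAlgType R) (f : {lrmorphism A -> B}) (N : submodule (tens A M))
    (h : A) (r : nat) :
  free_at h (qmod N) r -> free_at (f h) (qmod (base_change f N)) r.
Proof.
case=> v [vgen vfree].
exists (fun i => qpi (base_change f N) (tens_map f (repr (v i)))); split.
  exact: bc_gen.
exact: bc_free.
Qed.

Lemma locally_free_base_change (R : comNzRingType) (M : lmodType R)
    (A B : comAlgType R) (f : {lrmorphism A -> B}) (N : submodule (tens A M))
    (r : nat) :
  locally_free_on [set: spectrum A] (qmod N) r ->
  locally_free_on [set: spectrum B] (qmod (base_change f N)) r.
Proof.
move=> Nr q _; have [h [qh hr]] := Nr (comap f q) I.
by exists (f h); split=> //; apply: free_at_base_change.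
Qed.

Lemma base_change_id (R : comNzRingType) (M : lmodType R) (A : comAlgType R)
    (N : submodule (tens A M)) :
  base_change (idfun : {lrmorphism A -> A}) N = N.
Proof.
have idE (x : tens A M) : tens_map (idfun : {lrmorphism A -> A}) x = x.
  elim/tens_ind: x => [|x y ex ey|a m]; first exact: tens_map0.
  - by rewrite tens_mapD ex ey.
  - by rewrite tens_map_pure.
apply: submodule_eqP => v; split.
  by apply: span_min => _ [x Nx <-]; rewrite idE.
by move=> Nv; rewrite -(idE v); apply: tens_map_base_change.
Qed.

Lemma base_change_comp (R : comNzRingType) (M : lmodType R)
    (A B C : comAlgType R) (f : {lrmorphism A -> B}) (g : {lrmorphism B -> C})
    (N : submodule (tens A M)) :
  base_change (g \o f : {lrmorphism A -> C}) N = base_change g (base_change f N).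
Proof.
have compE (x : tens A M) :
    tens_map (g \o f : {lrmorphism A -> C}) x = tens_map g (tens_map f x).
  elim/tens_ind: x => [|x y ex ey|a m]; first by rewrite !tens_map0.
  - by rewrite !tens_mapD ex ey.
  - by rewrite !tens_map_pure.
apply: submodule_eqP => v; split; apply: span_min => _ [x Nx <-].
  by rewrite compE; do 2!apply: tens_map_base_change.
have s0 : base_change (g \o f : {lrmorphism A -> C}) N (tens_map g 0).
  by rewrite tens_map0; apply: submod0.
have sD y z : base_change (g \o f : {lrmorphism A -> C}) N (tens_map g y) ->
    base_change (g \o f : {lrmorphism A -> C}) N (tens_map g z) ->
    base_change (g \o f : {lrmorphism A -> C}) N (tens_map g (y + z)).
  by move=> Ny Nz; rewrite tens_mapD; apply: submodD.
have sZ b y : base_change (g \o f : {lrmorphism A -> C}) N (tens_map g y) ->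
    base_change (g \o f : {lrmorphism A -> C}) N (tens_map g (b *: y)).
  by move=> Ny; rewrite tens_mapZ; apply: submodZ.
apply: (span_min (N := Submodule s0 sD sZ) _ Nx) => _ [y Ny <-].
rewrite -[submod_set _ _]/(submod_set _ (tens_map g (tens_map f y))) -compE.
exact: tens_map_base_change.
Qed.

(* A scheme over Spec R is given by its functor of points on affine schemes over
   Spec R; morphisms of schemes over Spec R are the natural transformations.
   An object of comAlgType R is a nonzero ring, which loses nothing: Spec 0 is
   empty. *)
Record Rfunctor (R : comNzRingType) := RFunctor {
  points :> comAlgType R -> Type;
  pullback : forall A B : comAlgType R, {lrmorphism A -> B} -> points A -> points B;
  pullback_id : forall (A : comAlgType R) (x : points A),
    pullback (idfun : {lrmorphism A -> A}) x = x;
  pullback_comp : forall (A B C : comAlgType R)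
    (f : {lrmorphism A -> B}) (g : {lrmorphism B -> C}) (x : points A),
    pullback (g \o f : {lrmorphism A -> C}) x = pullback g (pullback f x)
}.

Definition Rfunctor_iso (R : comNzRingType) (F G : Rfunctor R) :=
  exists u : forall A : comAlgType R, F A -> G A,
    (forall (A B : comAlgType R) (f : {lrmorphism A -> B}) (x : F A),
       u B (pullback f x) = pullback f (u A x)) /\
    (forall A : comAlgType R, bijective (u A)).

Lemma lrmorphism_eqP (R : comNzRingType) (A B : comAlgType R)
    (f g : {lrmorphism A -> B}) : f =1 g -> f = g.
Proof.
move=> fg; have {fg} : f = g :> (A -> B) by apply/funext.
case: f => f [[f0] [f1] [f2]]; case: g => g [[g0] [g1] [g2]] /= e.
case: g / e g0 g1 g2 => g0 g1 g2.
by rewrite (Prop_irrelevance f0 g0) (Prop_irrelevance f1 g1) (Prop_irrelevance f2 g2).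
Qed.

Definition Spec (R : comNzRingType) : Rfunctor R.
Proof.
exists (fun A : comAlgType R => {lrmorphism R^o -> A})
  (fun (A B : comAlgType R) (f : {lrmorphism A -> B})
       (x : {lrmorphism R^o -> A}) => (f \o x : {lrmorphism R^o -> B})) => *;
  exact: lrmorphism_eqP.
Defined.

(* The closed subfunctors of a scheme are the functors of points of its closed
   subschemes: every base change to an affine scheme is cut out by an ideal. *)
Definition closed_subfunctor (R : comNzRingType) (F : Rfunctor R)
    (C : forall A, set (F A)) :=
  forall (A : comAlgType R) (x : F A), exists I : ideal A,
    forall (B : comAlgType R) (f : {lrmorphism A -> B}),
      C B (pullback f x) <-> forall a : A, I a -> f a = 0.

Section Closure.
Variables (R : comNzRingType) (F : Rfunctor R) (S : forall A, set (F A)).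

(* The smallest closed subscheme of F through which S factors.  If S is reduced,
   as it is for Nash blowups of reduced schemes, this is the topological closure
   of S with its reduced structure. *)
Definition in_closure (A : comAlgType R) (x : F A) : Prop :=
  forall C : forall A, set (F A), closed_subfunctor C ->
    (forall A x, @S A x -> C A x) -> C A x.

Fact in_closure_pullback (A B : comAlgType R) (f : {lrmorphism A -> B}) x :
  in_closure x -> in_closure (pullback f x).
Proof.
move=> Sx C Ccl SC; have [I CI] := Ccl A x.
apply/CI => a Ia; have /CI/(_ a Ia)/= -> : C A (pullback idfun x).
  by rewrite pullback_id; apply: Sx.
exact: rmorph0.
Qed.

Definition closure_points (A : comAlgType R) := {x : F A | in_closure x}.

Definition closure_pullback (A B : comAlgType R) (f : {lrmorphism A -> B})
    (x : closure_points A) : closure_points B :=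
  exist _ _ (in_closure_pullback f (proj2_sig x)).

Fact closure_points_eq (A : comAlgType R) (x y : closure_points A) :
  sval x = sval y -> x = y.
Proof.
case: x y => [x Sx] [y Sy] /= e; case: y / e Sy => Sy.
by congr (exist _ _ _); apply: Prop_irrelevance.
Qed.

Definition closure : Rfunctor R.
Proof.
exists closure_points closure_pullback => *; apply: closure_points_eq.
- exact: pullback_id.
- exact: pullback_comp.
Defined.

End Closure.

Section Grassmannian.
Variables (R : comNzRingType) (M : lmodType R) (r : nat).

(* A rank r locally free quotient of A (x)_R M, given by its kernel *)
Record grass_points (A : comAlgType R) := GrassPoint {
  grass_ker : submodule (tens A M);
  grass_locally_free : locally_free_on [set: spectrum A] (qmod grass_ker) r
}.

Definition grass_pullback (A B : comAlgType R) (f : {lrmorphism A -> B})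
    (x : grass_points A) : grass_points B :=
  GrassPoint (locally_free_base_change f (@grass_locally_free A x)).

Fact grass_points_eq (A : comAlgType R) (x y : grass_points A) :
  grass_ker x = grass_ker y -> x = y.
Proof.
case: x y => [N Nr] [N' Nr'] /= e; case: N' / e Nr' => Nr'.
by congr GrassPoint; apply: Prop_irrelevance.
Qed.

Definition Grass : Rfunctor R.
Proof.
exists grass_points grass_pullback => *; apply: grass_points_eq.
- exact: base_change_id.
- exact: base_change_comp.
Defined.

(* The points of Grass x_Y U, Y = Spec R: the morphism Spec A -> Y factors
   through the open subscheme U when every prime of A contracts into U. *)
Definition Grass_over (U : set (spectrum R)) (A : comAlgType R) : set (Grass A) :=
  [set x | forall q : spectrum A, U (comap (GRing.in_alg A) q)].

Definition Nash (U : set (spectrum R)) : Rfunctor R := closure (Grass_over U).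

Definition Nash_open (U : set (spectrum R)) :=
  [/\ spec_open U, spec_dense U & locally_free_on U M r].

End Grassmannian.

Section TensorAlgebra.
Variables (R : comNzRingType) (A B : comAlgType R).

Definition tens_alg : Type := tens A B.
HB.instance Definition _ := GRing.Zmodule.on tens_alg.
Implicit Types x y z : tens_alg.

Let mulr_pure (y : tens_alg) (a : A) (b : B) : tens_alg :=
  tens_lift (fun a' b' => pure (a * a') (b * b')) y.

Fact mulr_pure_bal (a : A) (b : B) :
  balanced (fun (a' : A) (b' : B) => pure (a * a') (b * b')).
Proof.
split=> [b' a' a''|a' b' b''|c a' b'].
- by rewrite mulrDr pureDl.
- by rewrite mulrDr pureDr.
- by rewrite -!scalerAr pure_bal.
Qed.

Fact mulr_pureD a b : {morph (fun y => mulr_pure y a b) : y z / y + z}.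
Proof. exact/tens_liftD/mulr_pure_bal. Qed.
Fact mulr_pure0 a b : mulr_pure 0 a b = 0.
Proof. exact/tens_lift0/mulr_pure_bal. Qed.
Fact mulr_pureE (a a' : A) (b b' : B) :
  mulr_pure (pure a' b') a b = pure (a * a') (b * b').
Proof. exact/tens_lift_pure/mulr_pure_bal. Qed.

Definition tens_mul x y : tens_alg := tens_lift (mulr_pure y) x.

Fact tens_mul_bal y : balanced (mulr_pure y).
Proof.
split=> [b a a'|a b b'|c a b]; elim/tens_ind: y => [|y z ey ez|a'' b''].
all: rewrite ?mulr_pure0 ?mulr_pureD ?mulr_pureE ?addr0 //.
- by rewrite ey ez addrACA.
- by rewrite mulrDl pureDl.
- by rewrite ey ez addrACA.
- by rewrite mulrDl pureDr.
- by rewrite ey ez.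
- by rewrite -!scalerAl pure_bal.
Qed.

Fact tens_mulDl : left_distributive tens_mul +%R.
Proof. by move=> x y z; apply/tens_liftD/tens_mul_bal. Qed.
Fact tens_mul0l y : tens_mul 0 y = 0.
Proof. exact/tens_lift0/tens_mul_bal. Qed.
Fact tens_mul_pure (a a' : A) (b b' : B) :
  tens_mul (pure a b) (pure a' b') = pure (a * a') (b * b').
Proof. by rewrite [LHS](tens_lift_pure (tens_mul_bal _)) mulr_pureE. Qed.

Fact tens_mulDr : right_distributive tens_mul +%R.
Proof.
move=> x y z; elim/tens_ind: x => [|x x' ex ex'|a b].
- by rewrite !tens_mul0l addr0.
- by rewrite !tens_mulDl ex ex' addrACA.
- by rewrite ![tens_mul _ _](tens_lift_pure (tens_mul_bal _)) mulr_pureD.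
Qed.
Fact tens_mul0r x : tens_mul x 0 = 0.
Proof. by apply: (addrI (tens_mul x 0)); rewrite -tens_mulDr !addr0. Qed.

Fact tens_mulC : commutative tens_mul.
Proof.
move=> x y; elim/tens_ind: x => [|x x' ex ex'|a b].
- by rewrite tens_mul0l tens_mul0r.
- by rewrite tens_mulDl tens_mulDr ex ex'.
elim/tens_ind: y => [|y y' ey ey'|a' b'].
- by rewrite tens_mul0l tens_mul0r.
- by rewrite tens_mulDl tens_mulDr ey ey'.
- by rewrite !tens_mul_pure (mulrC a) (mulrC b).
Qed.

Fact tens_mulA : associative tens_mul.
Proof.
move=> x y z; elim/tens_ind: x => [|x x' ex ex'|a b].
- by rewrite !tens_mul0l.
- by rewrite !tens_mulDl ex ex'.
elim/tens_ind: y => [|y y' ey ey'|a' b'].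
- by rewrite tens_mul0l !tens_mul0r tens_mul0l.
- by rewrite !(tens_mulDl, tens_mulDr) ey ey'.
elim/tens_ind: z => [|z z' ez ez'|a'' b''].
- by rewrite !tens_mul0r.
- by rewrite !tens_mulDr ez ez'.
- by rewrite !tens_mul_pure !mulrA.
Qed.

Fact tens_mul1 : left_id (pure 1 1) tens_mul.
Proof.
elim/tens_ind => [|y y' ey ey'|a b].
- exact: tens_mul0r.
- by rewrite tens_mulDr ey ey'.
- by rewrite tens_mul_pure !mul1r.
Qed.

HB.instance Definition _ := GRing.Zmodule_isComPzRing.Build tens_alg
  tens_mulA tens_mulC tens_mul1 tens_mulDl.

Definition tens_pure (a : A) (b : B) : tens_alg := pure a b.

End TensorAlgebra.

Section Completion.
Variables (T : comPzRingType) (J : nat -> ideal T).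

(* For a decreasing sequence of ideals J, the inverse limit of the T / J i: a
   compatible family of cosets is represented by a choice of representatives. *)
Record compatible_seq := CompatibleSeq {
  cseq :> nat -> T;
  cseqP : forall i, J i (cseq i.+1 - cseq i)
}.

HB.instance Definition _ := gen_eqMixin compatible_seq.
HB.instance Definition _ := gen_choiceMixin compatible_seq.

Definition compatible_eq : rel compatible_seq :=
  fun u v => `[< forall i, J i (u i - v i) >].

Fact compatible_eq_equiv : equiv_class_of compatible_eq.
Proof.
split=> [u|u v|v u w].
- by apply/asboolP => i; rewrite subrr; apply: submod0.
- by apply/asboolP/asboolP => uv i; rewrite -opprB; apply: submodN.
- move=> /asboolP uv /asboolP vw; apply/asboolP => i.
  by rewrite -(subrKA (v i)); apply: submodD.
Qed.
Canonical compatible_equivRel := EquivRelPack compatible_eq_equiv.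

Definition completion := {eq_quot compatible_eq}.
HB.instance Definition _ := Choice.on completion.
HB.instance Definition _ := Quotient.on completion.

Implicit Types (u v w : compatible_seq) (x y z : completion).

Definition compl_class (u : compatible_seq) : completion := \pi u.

Lemma compl_classP u v :
  compl_class u = compl_class v <-> forall i, J i (u i - v i).
Proof. by split=> [/eqmodP/asboolP//|uv]; apply/eqmodP/asboolP. Qed.

Lemma compl_class_repr x : compl_class (repr x) = x.
Proof. exact: reprK. Qed.

Lemma compl_repr u i : J i (repr (compl_class u) i - u i).
Proof. by move: i; apply/compl_classP; rewrite compl_class_repr. Qed.

Fact ideal_mulB (I : ideal T) (a b c d : T) :
  I (a - b) -> I (c - d) -> I (a * c - b * d).
Proof.
move=> ab cd; have -> : a * c - b * d = c * (a - b) + b * (c - d) by ring.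
by apply: submodD; apply: submodZ.
Qed.

Fact cseq_constP (a : T) i : J i (a - a).
Proof. by rewrite subrr; apply: submod0. Qed.
Definition cseq_const a : compatible_seq := CompatibleSeq (cseq_constP a).

Fact cseq_oppP (u : compatible_seq) i : J i (- u i.+1 - - u i).
Proof. by rewrite -opprD; apply/submodN/cseqP. Qed.
Definition cseq_opp u : compatible_seq := CompatibleSeq (cseq_oppP u).

Fact cseq_addP (u v : compatible_seq) i :
  J i ((u i.+1 + v i.+1) - (u i + v i)).
Proof. by rewrite opprD addrACA; apply: submodD; apply: cseqP. Qed.
Definition cseq_add u v : compatible_seq := CompatibleSeq (cseq_addP u v).

Fact cseq_mulP (u v : compatible_seq) i : J i (u i.+1 * v i.+1 - u i * v i).
Proof. by apply: ideal_mulB; apply: cseqP. Qed.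
Definition cseq_mul u v : compatible_seq := CompatibleSeq (cseq_mulP u v).

Definition compl_opp x := compl_class (cseq_opp (repr x)).
Definition compl_add x y := compl_class (cseq_add (repr x) (repr y)).
Definition compl_mul x y := compl_class (cseq_mul (repr x) (repr y)).
Definition compl_const a := compl_class (cseq_const a).

Lemma compl_oppE u : compl_opp (compl_class u) = compl_class (cseq_opp u).
Proof.
by apply/compl_classP => i /=; rewrite -opprD; apply/submodN/compl_repr.
Qed.
Lemma compl_addE u v :
  compl_add (compl_class u) (compl_class v) = compl_class (cseq_add u v).
Proof.
apply/compl_classP => i /=.
by rewrite opprD addrACA; apply: submodD; apply: compl_repr.
Qed.
Lemma compl_mulE u v :
  compl_mul (compl_class u) (compl_class v) = compl_class (cseq_mul u v).
Proof. by apply/compl_classP => i /=; apply: ideal_mulB; apply: compl_repr. Qed.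

Fact compl_class_eq (u v : compatible_seq) :
  (forall i, u i = v i) -> compl_class u = compl_class v.
Proof.
by move=> uv; apply/compl_classP => i; rewrite uv subrr; apply: submod0.
Qed.

Fact compl_addA : associative compl_add.
Proof.
move=> x y z; rewrite -(compl_class_repr x) -(compl_class_repr y).
rewrite -(compl_class_repr z) !compl_addE.
by apply: compl_class_eq => i /=; rewrite addrA.
Qed.
Fact compl_addC : commutative compl_add.
Proof. by move=> x y; apply: compl_class_eq => i /=; rewrite addrC. Qed.
Fact compl_add0 : left_id (compl_const 0) compl_add.
Proof.
move=> x; rewrite -(compl_class_repr x) compl_addE.
by apply: compl_class_eq => i /=; rewrite add0r.
Qed.
Fact compl_addN : left_inverse (compl_const 0) compl_opp compl_add.
Proof.
move=> x; rewrite -(compl_class_repr x) compl_oppE compl_addE.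
by apply: compl_class_eq => i /=; rewrite addNr.
Qed.
HB.instance Definition _ := GRing.isZmodule.Build completion
  compl_addA compl_addC compl_add0 compl_addN.

Fact compl_mulA : associative compl_mul.
Proof.
move=> x y z; rewrite -(compl_class_repr x) -(compl_class_repr y).
rewrite -(compl_class_repr z) !compl_mulE.
by apply: compl_class_eq => i /=; rewrite mulrA.
Qed.
Fact compl_mulC : commutative compl_mul.
Proof. by move=> x y; apply: compl_class_eq => i /=; rewrite mulrC. Qed.
Fact compl_mul1 : left_id (compl_const 1) compl_mul.
Proof.
move=> x; rewrite -(compl_class_repr x) compl_mulE.
by apply: compl_class_eq => i /=; rewrite mul1r.
Qed.
Fact compl_mulDl : left_distributive compl_mul +%R.
Proof.
move=> x y z; rewrite -(compl_class_repr x) -(compl_class_repr y).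
rewrite -(compl_class_repr z) [_ + _]compl_addE !compl_mulE [RHS]compl_addE.
by apply: compl_class_eq => i /=; rewrite mulrDl.
Qed.
HB.instance Definition _ := GRing.Zmodule_isComPzRing.Build completion
  compl_mulA compl_mulC compl_mul1 compl_mulDl.

Lemma compl_constD : {morph compl_const : a b / a + b}.
Proof. by move=> a b; rewrite [RHS]compl_addE; apply: compl_class_eq. Qed.
Lemma compl_constM : {morph compl_const : a b / a * b}.
Proof. by move=> a b; rewrite [RHS]compl_mulE; apply: compl_class_eq. Qed.

End Completion.

Section PrincipalParts.
Variables (k : comNzRingType) (R : comAlgType k).

Definition ctens_ideal (i : nat) : ideal (tens_alg R R) :=
  span [set t : (tens_alg R R)^o | exists2 a : R, ideal_pow (max_ideal R) i a &
                  t = tens_pure a 1 \/ t = tens_pure 1 a].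

(* The completed tensor product of a local k-algebra R with itself: the inverse
   limit of R/m^i (x)_k R/m^i, m being the maximal ideal. *)
Definition ctens : Type := completion ctens_ideal.
HB.instance Definition _ := GRing.ComPzRing.on ctens.

Definition ctens_pure (a b : R) : ctens :=
  compl_const ctens_ideal (tens_pure a b).

Definition ctens_scale (a : R) (t : ctens) : ctens := ctens_pure a 1 * t.

Fact ctens_scaleA a b t : ctens_scale a (ctens_scale b t) = ctens_scale (a * b) t.
Proof.
rewrite /ctens_scale mulrA; congr (_ * _).
rewrite -[LHS]compl_constM; congr (compl_const _ _).
by rewrite -[LHS]/(tens_mul _ _) tens_mul_pure mulr1.
Qed.
Fact ctens_scale1 : left_id 1 ctens_scale.
Proof. by move=> t; rewrite -[RHS]mul1r. Qed.
Fact ctens_scaleDr : right_distributive ctens_scale +%R.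
Proof. by move=> a t u; apply: mulrDr. Qed.
Fact ctens_scaleDl t : {morph ctens_scale^~ t : a b / a + b}.
Proof.
move=> a b; rewrite /ctens_scale -mulrDl; congr (_ * _).
rewrite -[RHS]compl_constD; congr (compl_const _ _).
exact: pureDl.
Qed.
HB.instance Definition _ := GRing.Zmodule_isLmodule.Build R ctens
  ctens_scaleA ctens_scale1 ctens_scaleDr ctens_scaleDl.

Variables (s : nat) (x : 'I_s -> R).

(* x exhibits R as a quotient of k[[X_1, ..., X_s]], the variable X_i being sent
   to x i: power series in x converge since the x i lie in the maximal ideal of
   the complete ring R, and every element of R is the sum of such a series. *)
Definition power_series_generators :=
  (forall i, max_ideal R (x i)) /\
  (forall a : R, exists c : ('I_s -> nat) -> k, forall n : nat,
     ideal_pow (max_ideal R) n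
       (a - \sum_(alpha : {ffun 'I_s -> 'I_n})
              c (fun i => alpha i) *: \prod_(i < s) x i ^+ alpha i)).

Definition diag_ideal : ideal ctens :=
  span [set t : ctens^o | exists i, t = ctens_pure (x i) 1 - ctens_pure 1 (x i)].

Definition diag_pow_submodule (n : nat) : submodule ctens.
Proof.
exists (fun t : ctens => ideal_pow diag_ideal n t) => [|t u|a t].
- exact: submod0.
- exact: submodD.
- exact: (@submodZ _ _ (ideal_pow diag_ideal n) (ctens_pure a 1)).
Defined.

Definition principal_parts (n : nat) : Type := qmod (diag_pow_submodule n.+1).
HB.instance Definition _ n := GRing.Lmodule.on (principal_parts n).

End PrincipalParts.

(* The n-th Nash blowup of Spec R of pure dimension d, with respect to an open
   dense U on which the principal parts are locally free of rank 'C(n + d, d) *)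
Definition higher_Nash_open (k : comNzRingType) (R : comAlgType k) (d s : nat)
    (x : 'I_s -> R) (n : nat) (U : set (spectrum R)) :=
  Nash_open (principal_parts x n) 'C(n + d, d) U.

Definition higher_Nash (k : comNzRingType) (R : comAlgType k) (d s : nat)
    (x : 'I_s -> R) (n : nat) (U : set (spectrum R)) : Rfunctor R :=
  Nash (principal_parts x n) 'C(n + d, d) U.

Definition module_finite (R S : comNzRingType) (f : {rmorphism R -> S}) :=
  exists (m : nat) (g : 'I_m -> S), forall b : S,
    exists a : 'I_m -> R, b = \sum_(i < m) f (a i) * g i.

Definition is_normalization (R S : comNzRingType) (f : {rmorphism R -> S}) :=
  exists (K : fieldType) (g : {rmorphism S -> K}),
    [/\ injective f, injective g,
        forall u : K, exists a b : R, b != 0 /\ u = g (f a) / g (f b) &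
        forall u : K, integralOver (g \o f) u <-> exists b : S, u = g b].

(* Main.v *)
Require Import Defs.
From HB Require Import structures.
From mathcomp Require Import all_boot all_order all_algebra.
From mathcomp Require Import ring.
From mathcomp Require Import boolp classical_sets.

(** Put S = k[[t]] and q = p ^ e, and let P be the module of principal parts of
    order q - 1: the completed tensor square of R modulo the q-th power of the
    ideal I of the diagonal.

    The Nash blowup of P is Spec R as soon as P modulo torsion is free of rank q.
    The torsion is then the kernel of a locally free quotient of rank q, which is
    a section of the Grassmannian over Spec R.  That a given element dies in a
    quotient is a closed condition ([closed_vanishing]), torsion dies over U, and
    q generators of a locally free module of rank q satisfy no relation
    ([generators_loc_free]); so every point of the closure is the pullback of
    that section.  The section itself lies in the closure because R embeds into
    a field whose spectrum maps into U ([Nash_iso_Spec]).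

    Freeness is the effect of Frobenius.  A power of t lies in the conductor of R
    in S ([conductor]); when q is at least its exponent, R contains t^q S, hence
    the ring S^q of all q-th powers.  As k is perfect, S^q consists of the series
    in t^q, and S is free over S^q with basis 1, t, .., t^(q-1).  A k-linear change
    of this basis adapts it to the space of jets of order < q of elements of R;
    multiplying by t^q the basis vectors that are not jets of R gives a basis w
    of R over S^q ([branch_frobenius_basis]).  The elements 1 (x) w_j form a basis
    of P modulo torsion:

    - they generate ([ppart_gen]), because h^q (x) 1 - 1 (x) h^q is the q-th power
      of h (x) 1 - 1 (x) h, an element of I^q for h in R: after multiplication by
      a power of t, a coefficient in S^q is the q-th power of an element of R and
      moves across the tensor sign;

    - they are independent ([ppart_free]), because a (x) b becomes a(t) b(u) in
      k[[t]][[u]], where I goes to multiples of u - t, so I^q to multiples of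
      u^q - t^q, modulo which 1, u, .., u^(q-1) are independent over k[[t]].

    The completed tensor product adds questions of convergence.  A successive
    approximation shows that each of its elements is congruent to some r (x) 1
    modulo I ([ctens_step]), hence to a finite sum of pure tensors modulo any
    power of I ([ctens_gen]).  In the other direction, the image in k[[t]][[u]]
    is only computed on the terms of an approximating sequence, modulo the ideal
    (t^n, u^n) for each n ([diag_pow_cong]), and this is enough to conclude
    ([small_diag_pow]). *)

Set Implicit Arguments.
Unset Strict Implicit.
Unset Printing Implicit Defensive.

Import GRing.Theory.
Local Open Scope classical_set_scope.
Local Open Scope ring_scope.

Local Notation span := Defs.span.
(* Unfolding membership in a span would expose a quantification over all
   submodules. *)
Local Arguments submod_set : simpl never.

(** * Submodules and powers of ideals *)

Lemma span_ind (R : pzRingType) (V : lmodType R) (S : set V) (P : V -> Prop) :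
  P 0 -> (forall u v, P u -> P v -> P (u + v)) ->
  (forall a v, P v -> P (a *: v)) -> (forall s, S s -> P s) ->
  forall v, span S v -> P v.
Proof.
move=> P0 PD PZ SP v Sv.
exact: (span_min (N := Submodule P0 PD PZ) SP Sv).
Qed.

Section IdealPowers.
Variables (A : comPzRingType) (I : ideal A).

Lemma ideal_mull (J : ideal A) (a b : A) : J b -> J (a * b).
Proof. exact: (@submodZ _ _ J). Qed.
Lemma ideal_mulr (J : ideal A) (a b : A) : J a -> J (a * b).
Proof. by rewrite mulrC; apply: ideal_mull. Qed.

Lemma ideal_pow0 a : ideal_pow I 0 a.
Proof. exact: span_gen. Qed.

Lemma ideal_powSM n (a b : A) : I a -> ideal_pow I n b -> ideal_pow I n.+1 (a * b).
Proof. by move=> Ia Ib; apply: span_gen; exists a, b. Qed.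

Lemma ideal_pow1 (a : A) : I a -> ideal_pow I 1 a.
Proof. by move=> Ia; rewrite -[a]mulr1; apply/ideal_powSM/ideal_pow0. Qed.

Lemma ideal_powS_min n (J : ideal A) :
  (forall a b : A, I a -> ideal_pow I n b -> J (a * b)) ->
  forall a, ideal_pow I n.+1 a -> J a.
Proof. by move=> IJ; apply: span_min => _ [a [b [Ia Ib ->]]]; apply: IJ. Qed.

Lemma ideal_pow_le n m a : (n <= m)%N -> ideal_pow I m a -> ideal_pow I n a.
Proof.
move/subnK <-; elim: (m - n)%N => // d IHd Ia; apply: IHd.
by move: a Ia; apply: ideal_powS_min => a b _; apply: ideal_mull.
Qed.

Lemma ideal_powD n m (a b : A) :
  ideal_pow I n a -> ideal_pow I m b -> ideal_pow I (n + m) (a * b).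
Proof.
elim: n a => [|n IHn] a Ia Ib; first exact: ideal_mull.
have S0 : ideal_pow I (n.+1 + m) (0 * b) by rewrite mul0r; apply: submod0.
have SD (u v : A^o) : ideal_pow I (n.+1 + m) (u * b) ->
    ideal_pow I (n.+1 + m) (v * b) -> ideal_pow I (n.+1 + m) ((u + v : A) * b).
  by move=> *; rewrite mulrDl; apply: submodD.
have SZ (c : A) (u : A^o) : ideal_pow I (n.+1 + m) (u * b) ->
    ideal_pow I (n.+1 + m) ((c *: u : A) * b).
  by move=> *; rewrite -[c *: u]/(c * u) -mulrA; apply: ideal_mull.
apply: (span_ind (P := fun u : A^o => ideal_pow I (n.+1 + m) ((u : A) * b))) Ia => //.
by move=> _ [c [d [Ic Id ->]]]; rewrite -mulrA; apply: ideal_powSM => //; apply: IHn.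
Qed.

Lemma ideal_pow_exp n (a : A) : I a -> ideal_pow I n (a ^+ n).
Proof.
move=> Ia; elim: n => [|n IHn]; first exact: ideal_pow0.
by rewrite exprS; apply: ideal_powSM.
Qed.

End IdealPowers.

(** * Primes and local conditions *)

Section Primes.
Variable A : comNzRingType.

(** Zorn's lemma gives a maximal ideal containing I. *)
Lemma prime_over (I : ideal A) : ~ I 1 ->
  exists P : spectrum A, forall a, I a -> P a.
Proof.
move=> I1.
pose adj (X : set A) := [set a | I a \/ X a].
pose good (X : set A) := exists J : ideal A,
  [/\ forall a, J a <-> adj X a & ~ J 1].
(* The empty chain is why membership in I is kept apart from membership in the
   sets that are compared. *)
have good_chain (F : set (set A)) : F `<=` good -> total_on F subset ->
    good (\bigcup_(X in F) X).
  move=> Fgood Ftot.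
  pose U := [set a | I a \/ exists2 X, F X & X a].
  have UE X a : F X -> adj X a -> U a by move=> FX [Ia|Xa]; [left|right; exists X].
  have U0 : U 0 by left; apply: submod0.
  have UD a b : U a -> U b -> U (a + b).
    move=> [Ia|[X FX Xa]] [Ib|[Y FY Yb]].
    - by left; apply: submodD.
    - have [J [JY _]] := Fgood Y FY; apply: (UE Y) => //; apply/JY.
      by apply: submodD; apply/JY; [left|right].
    - have [J [JX _]] := Fgood X FX; apply: (UE X) => //; apply/JX.
      by apply: submodD; apply/JX; [right|left].
    - have [Z [FZ Za Zb]] : exists Z, [/\ F Z, Z a & Z b].
        by have [XY|YX] := Ftot X Y FX FY; [exists Y|exists X]; split=> //; auto.
      have [J [JZ _]] := Fgood Z FZ; apply: (UE Z) => //; apply/JZ.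
      by apply: submodD; apply/JZ; right.
  have UZ c (a : A^o) : U a -> U (c *: a).
    move=> [Ia|[X FX Xa]]; first by left; apply: submodZ.
    have [J [JX _]] := Fgood X FX; apply: (UE X) => //; apply/JX.
    by apply: submodZ; apply/JX; right.
  exists (Submodule U0 UD UZ); split=> [a|[//|[X FX X1]]].
    by split=> [[Ia|[X FX Xa]]|[Ia|[X FX Xa]]]; [left|right; exists X|left|right; exists X].
  by have [J [JX]] := Fgood X FX; apply; apply/JX; right.
have [X [[J [JX J1]] Xmax]] := Zorn_bigcup good_chain.
have IJ a : I a -> J a by move=> Ia; apply/JX; left.
have Jmax (J' : ideal A) : (forall a, J a -> J' a) -> ~ J' 1 ->
    forall a, J' a -> J a.
  move=> JJ' J'1 a J'a; apply: contrapT => nJa.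
  apply: (Xmax [set b | J' b]).
    split=> [b Xb|sub]; first by apply/JJ'/JX; right.
    by apply: nJa; apply/JX; right; apply: sub.
  exists J'; split=> // b; split=> [|[/IJ/JJ'|]] //; first by right.
have Jprime (a b : A) : J (a * b) -> J a \/ J b.
  move=> Jab; apply: contrapT => /not_orP[nJa nJb].
  have S0 : exists j c : A, J j /\ (0 : A) = j + c * a.
    by exists 0, 0; rewrite mul0r addr0; split=> //; apply: submod0.
  have SD (u v : A) : (exists j c : A, J j /\ u = j + c * a) ->
      (exists j c : A, J j /\ v = j + c * a) ->
      exists j c : A, J j /\ u + v = j + c * a.
    move=> [j [c [Jj ->]]] [j' [c' [Jj' ->]]]; exists (j + j'), (c + c').
    by split; [apply: submodD|ring].
  have SZ (d : A) (u : A^o) : (exists j c : A, J j /\ u = j + c * a) ->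
      exists j c : A, J j /\ d *: u = j + c * a.
    move=> [j [c [Jj ->]]]; exists (d * j), (d * c).
    by split; [apply: (submodZ (V := A^o))|rewrite /GRing.scale /=; ring].
  apply: nJa; apply: (Jmax (Submodule (V := A^o) S0 SD SZ)) => /=.
  - by move=> j Jj; exists j, 0; rewrite mul0r addr0.
  - move=> [j [c [Jj e]]]; apply: nJb.
    rewrite -[b]mul1r e mulrDl -mulrA; apply: submodD.
      by rewrite mulrC; apply: (submodZ (V := A^o)).
    exact: (submodZ (V := A^o)).
  - by exists 0, 1; rewrite mul1r add0r; split=> //; apply: submod0.
by exists (PrimeIdeal J1 Jprime).
Qed.

Lemma ideal_unit (I : ideal A) :
  (forall P : spectrum A, exists h : A, ~ P h /\ I h) -> I 1.
Proof.
move=> nP; apply: contrapT => /prime_over[P IP].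
by have [h [nPh /IP]] := nP P.
Qed.

Lemma prime_pow (P : spectrum A) (h : A) n : ~ P h -> ~ P (h ^+ n).
Proof.
move=> nPh; elim: n => [|n IHn]; first exact: spectrum_proper.
by rewrite exprS => /spectrumM[].
Qed.

(** The elements a of A with a z in N form an ideal that is contained in no
    prime. *)
Lemma submod_of_local (V : lmodType A) (N : submodule V) (z : V) :
  (forall P : spectrum A, exists (h : A) (n : nat), ~ P h /\ N (h ^+ n *: z)) ->
  N z.
Proof.
move=> loc.
have S0 : N ((0 : A) *: z) by rewrite scale0r; apply: submod0.
have SD (a b : A^o) : N (a *: z) -> N (b *: z) -> N ((a + b) *: z).
  by move=> Na Nb; rewrite scalerDl; apply: submodD.
have SZ (a : A) (b : A^o) : N (b *: z) -> N ((a *: b) *: z).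
  by move=> Nb; rewrite -scalerA; apply: submodZ.
rewrite -[z]scale1r.
apply: (@ideal_unit (Submodule (V := A^o) S0 SD SZ)) => P /=.
have [h [n [Ph Nh]]] := loc P.
by exists (h ^+ n); split=> //; apply: prime_pow.
Qed.

Lemma eq0_of_local (V : lmodType A) (z : V) :
  (forall P : spectrum A, exists (h : A) (n : nat), ~ P h /\ h ^+ n *: z = 0) ->
  z = 0.
Proof.
have D0 (u v : V) : u = 0 -> v = 0 -> u + v = 0 by move=> -> ->; rewrite addr0.
have Z0 (a : A) (v : V) : v = 0 -> a *: v = 0 by move=> ->; rewrite scaler0.
exact: (@submod_of_local V (Submodule (submod_set := eq^~ 0) erefl D0 Z0)).
Qed.

(** The finite sums of elements of the cover form an ideal; it contains 1, and
    the finitely many elements of an expression of 1 still cover.  Each element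
    carries a datum t, to be used when the cover consists of charts. *)
Lemma spectrum_quasi_compact (T : Type) (S : A -> T -> Prop) :
  (forall P : spectrum A, exists (h : A) (t : T), ~ P h /\ S h t) ->
  exists s : seq (A * T), (forall ht, List.In ht s -> S ht.1 ht.2) /\
    forall P : spectrum A, exists2 ht, List.In ht s & ~ P ht.1.
Proof.
move=> cov.
pose I := [set a : A | exists s : seq (A * T),
  (forall ht, List.In ht s -> S ht.1 ht.2) /\
  forall P : ideal A, (forall ht, List.In ht s -> P ht.1) -> P a].
have S0 : I 0 by exists [::]; split=> // P _; apply: submod0.
have SD (a b : A^o) : I a -> I b -> I (a + b).
  move=> [s [sS sa]] [t [tS tb]]; exists (s ++ t); split=> [ht|P Pst].
    by case/(@List.in_app_or _ _ _ _); auto.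
  by apply: submodD; [apply: sa|apply: tb] => ht i; apply: Pst;
    apply: List.in_or_app; [left|right].
have SZ (c : A) (a : A^o) : I a -> I (c *: a).
  by move=> [s [sS sa]]; exists s; split=> // P Ps; apply/submodZ/sa.
have [|s [sS s1]] := @ideal_unit (Submodule (V := A^o) S0 SD SZ).
  move=> P /=; have [h [t [Ph Sh]]] := cov P; exists h; split=> //.
  by exists [:: (h, t)]; split=> [ht [<-|[]]|Q Qs] //; apply: (Qs (h, t)); left.
exists s; split=> // P; apply: contrapT => nP.
apply: (@spectrum_proper _ P); apply: s1 => ht hts; apply: contrapT => nPh.
by apply: nP; exists ht.
Qed.

End Primes.

(** * Locally free modules *)

Section LocallyFreeQuotients.
Variables (A : comNzRingType) (V : lmodType A).

(** The images of the v i form a basis of the localization at h. *)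
Definition local_basis (h : A) (r : nat) (v : 'I_r -> V) :=
  (forall m : V, exists (N : nat) (a : 'I_r -> A),
     h ^+ N *: m = \sum_(i < r) a i *: v i) /\
  (forall a : 'I_r -> A, \sum_(i < r) a i *: v i = 0 ->
     exists N : nat, forall i, h ^+ N * a i = 0).

Lemma common_exponent (I : finType) (F : I -> nat -> Prop) :
  (forall i n m, F i n -> F i (m + n)%N) ->
  (forall i, exists n, F i n) -> exists n, forall i, F i n.
Proof.
move=> Fmono Fex.
have nP i := projT2 (cid (Fex i)).
exists (\sum_i projT1 (cid (Fex i)))%N => i.
by rewrite (bigD1 i) //= addnC; apply: Fmono.
Qed.

Lemma common_exponent_seq (T : Type) (s : seq T) (F : T -> nat -> Prop) :
  (forall t n m, F t n -> F t (m + n)%N) ->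
  (forall t, List.In t s -> exists n, F t n) ->
  exists n, forall t, List.In t s -> F t n.
Proof.
move=> Fmono; elim: s => [|t s IHs] Fex; first by exists 0%N.
have [n nP] := IHs (fun u us => Fex u (or_intror us)).
have [m mP] := Fex t (or_introl erefl).
by exists (n + m)%N => u [<-|/nP]; rewrite 1?addnC; auto; rewrite addnC; auto.
Qed.

Lemma loc_coords (h : A) r (v : 'I_r -> V) (s : nat) (u : 'I_s -> V) :
  local_basis h v -> exists (N : nat) (D : 'M[A]_(s, r)),
    forall j, h ^+ N *: u j = \sum_(i < r) D j i *: v i.
Proof.
case=> gen _.
have [|N NP] := @common_exponent _ (fun j n => exists a : 'I_r -> A,
    h ^+ n *: u j = \sum_(i < r) a i *: v i) _ (fun j => gen (u j)).
  move=> j n m [a e]; exists (fun i => h ^+ m * a i).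
  rewrite exprD -scalerA e scaler_sumr.
  by apply: eq_bigr => i _; rewrite scalerA.
exists N, (\matrix_(j, i) projT1 (cid (NP j)) i) => j.
by rewrite (projT2 (cid (NP j))); apply: eq_bigr => i _; rewrite mxE.
Qed.

Lemma loc_free_mx (h : A) r (v : 'I_r -> V) (s : nat) (D : 'M[A]_(s, r)) :
  local_basis h v -> (forall j, \sum_(i < r) D j i *: v i = 0) ->
  exists N, h ^+ N *: D = 0.
Proof.
case=> _ free D0.
have [|N NP] := @common_exponent _ (fun j n => forall i, h ^+ n * D j i = 0) _
    (fun j => free (D j) (D0 j)).
  by move=> j n m e i; rewrite exprD -mulrA e mulr0.
by exists N; apply/matrixP => j i; rewrite !mxE.
Qed.

Lemma sum_mulmx_scale (s r t : nat) (C : 'M[A]_(s, r)) (D : 'M[A]_(r, t))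
    (v : 'I_t -> V) j :
  \sum_(l < t) (C *m D) j l *: v l
    = \sum_(i < r) C j i *: \sum_(l < t) D i l *: v l.
Proof.
under [RHS]eq_bigr => i _ do rewrite scaler_sumr.
rewrite exchange_big; apply: eq_bigr => l _.
rewrite mxE scaler_suml; apply: eq_bigr => i _; by rewrite scalerA.
Qed.

(** Determinant trick.  Up to powers of h, the matrices C and D that express v by
    u and u by v satisfy C D = 1, so det D is invertible, and a relation a D = 0
    forces a = 0. *)
Lemma generators_loc_free (h : A) r (v u : 'I_r -> V) (n : nat) (C : 'M[A]_r)
    (a : 'I_r -> A) :
  local_basis h v -> (forall j, h ^+ n *: v j = \sum_(i < r) C j i *: u i) ->
  \sum_(i < r) a i *: u i = 0 -> exists N, forall i, h ^+ N * a i = 0.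
Proof.
move=> hv Cu au.
have [m [D Dv]] := loc_coords u hv.
have [K KP] : exists K, h ^+ K *: (C *m D - (h ^+ (m + n))%:M) = 0.
  apply: (loc_free_mx hv) => j.
  under eq_bigr => i _ do rewrite !mxE scalerBl.
  rewrite sumrB.
  have -> : \sum_(i < r) (h ^+ (m + n) *+ (j == i)) *: v i = h ^+ (m + n) *: v j.
    rewrite (bigD1 j) //= eqxx big1 ?addr0 // => i.
    by rewrite eq_sym => /negPf ->; rewrite scale0r.
  apply/eqP; rewrite subr_eq0; apply/eqP.
  transitivity (\sum_(l < r) (C *m D) j l *: v l).
    by apply: eq_bigr => l _; rewrite !mxE.
  rewrite sum_mulmx_scale.
  under eq_bigr => i _ do rewrite -Dv scalerA mulrC -scalerA.
  by rewrite -scaler_sumr -Cu scalerA exprD.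
have [L LP] : exists L, h ^+ L *: ((\row_i a i) *m D) = 0.
  apply: (loc_free_mx hv) => j; rewrite sum_mulmx_scale.
  under eq_bigr => i _ do rewrite -Dv scalerA mulrC -scalerA mxE.
  by rewrite -scaler_sumr au scaler0.
have CD : h ^+ K *: C *m D = (h ^+ (K + (m + n)))%:M.
  move/eqP: KP; rewrite scalerBr subr_eq0 scale_scalar_mx => /eqP e.
  by rewrite -scalemxAl e -exprD.
have dCD : \det (h ^+ K *: C) * \det D = h ^+ ((K + (m + n)) * r).
  by rewrite -det_mulmx CD det_scalar exprM.
have aD : h ^+ L *: (\det D *: (\row_i a i)) = 0.
  by rewrite -[X in _ *: X]mul_mx_scalar -mul_mx_adj mulmxA scalemxAl LP mul0mx.
exists ((K + (m + n)) * r + L)%N => i.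
rewrite exprD -dCD.
have := congr1 (fun M : 'rV_r => \det (h ^+ K *: C) * M 0 i) aD.
rewrite !mxE mulr0 => e0; rewrite -[RHS]e0; ring.
Qed.

End LocallyFreeQuotients.

(** * Vanishing of an element is closed on the Grassmannian *)

Section VanishingLocus.
Variables (A : comNzRingType) (V : lmodType A) (r : nat) (z : V).

(** A chart of V on the open set where h is invertible, with the coordinates a of
    the fixed vector z in it, up to a power of h. *)
Definition local_coords (h : A) (a : 'I_r -> A) :=
  exists (v : 'I_r -> V) (n : nat),
    local_basis h v /\ h ^+ n *: z = \sum_(i < r) a i *: v i.

(** On the intersection of two charts, the coordinates in one of them are linear
    combinations of those in the other. *)
Lemma local_coords_compare h a h' a' : local_coords h a -> local_coords h' a' ->
  exists K, forall i, exists K' (c : 'I_r -> A),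
    h' ^+ K' * (h ^+ K * a i) = \sum_(j < r) c j * a' j.
Proof.
move=> [v [n [hv zv]]] [v' [n' [hv' zv']]].
have [m [D Dv]] := loc_coords v' hv.
have [_ free] := hv.
have [L LP] : exists L, forall i, h ^+ L *
    (h' ^+ n' * h ^+ m * a i - h ^+ n * \sum_j a' j * D j i) = 0.
  apply: free; rewrite (eq_bigr _ (fun i _ => scalerBl _ _ _)) sumrB.
  under eq_bigr => i _ do rewrite -scalerA.
  rewrite -scaler_sumr -zv.
  rewrite [X in _ - X](_ : _ = h ^+ n *: (h ^+ m *: (h' ^+ n' *: z))).
    rewrite !scalerA -scalerBl (_ : _ - _ = 0) ?scale0r //; ring.
  rewrite zv'; under eq_bigr => i _ do rewrite -scalerA scaler_suml.
  rewrite -scaler_sumr; congr (_ *: _); rewrite exchange_big scaler_sumr /=.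
  apply: eq_bigr => j _; rewrite scalerA [_ * a' j]mulrC -scalerA Dv.
  rewrite scaler_sumr; apply: eq_bigr => i _.
  by rewrite scalerA.
exists (L + m)%N => i; exists n', (fun j => h ^+ L * h ^+ n * D j i).
have /eqP := LP i; rewrite mulrBr subr_eq0 => /eqP e.
transitivity (h ^+ L * (h' ^+ n' * h ^+ m * a i)); first by rewrite exprD; ring.
rewrite e !mulr_sumr; apply: eq_bigr => j _; ring.
Qed.

End VanishingLocus.

Section Grassmannian.
Variables (R : comNzRingType) (M : lmodType R) (r : nat).

(** The image of pure 1 m in the quotient by N dies, locally, exactly where its
    coordinates in a chart die. *)
Lemma tens_map_base_changeP (A B : comAlgType R) (f : {lrmorphism A -> B})
    (N : submodule (tens A M)) (h : A) (a : 'I_r -> A) (m : M) :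
  local_coords (qpi N (pure 1 m)) h a ->
  (base_change f N (pure 1 m) -> exists K, forall i, f h ^+ K * f (a i) = 0) /\
  (forall K, (forall i, f h ^+ K * f (a i) = 0) ->
     exists L, base_change f N (f h ^+ L *: pure 1 m)).
Proof.
move=> [v [n [[vgen vfree] zv]]].
pose w i := qpi (base_change f N) (tens_map f (repr (v i))).
have e : f h ^+ n *: qpi (base_change f N) (pure 1 m) = \sum_(i < r) f (a i) *: w i.
  have Ne : N (h ^+ n *: pure 1 m - \sum_(i < r) a i *: repr (v i)).
    apply/qpi_eq; rewrite linearZ /= zv linear_sum; apply: eq_bigr => i _ /=.
    by rewrite linearZ /= qpi_surj.
  have := tens_map_base_change (f := f) Ne; rewrite tens_mapD -scaleN1r !tens_mapZ.
  rewrite rmorphN1 scaleN1r tens_map_pure rmorph1 rmorphXn => /qpi_eq.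
  rewrite linearZ /= => ->; rewrite tens_map_sum linear_sum; apply: eq_bigr => i _ /=.
  by rewrite tens_mapZ linearZ.
split=> [m0|K K0].
  apply: (bc_free vgen vfree); rewrite -e.
  have -> : qpi (base_change f N) (pure 1 m) = 0.
    by rewrite -[RHS](linear0 (qpi _)); apply/qpi_eq; rewrite subr0.
  by rewrite scaler0.
exists (K + n)%N; rewrite -[X in submod_set _ X]subr0; apply/qpi_eq.
rewrite linearZ (linear0 (qpi _)) /= exprD -scalerA e scaler_sumr big1 // => i _.
by rewrite scalerA K0 scale0r.
Qed.

(** The ideal of the locus where the image of m vanishes is locally generated by
    the coordinates of this image in a chart.  The elements of A that satisfy this
    in each chart of a finite cover form the required ideal: finiteness gives, for
    each coordinate in a chart h, one power of h that carries it into the ideals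
    of all the other charts. *)
Lemma closed_vanishing (m : M) :
  closed_subfunctor (F := Grass M r)
    (fun A => [set x : grass_points M r A | grass_ker x (pure 1 m)]).
Proof.
move=> A [N Nr] /=.
have [s [sN scov]] : exists s : seq (A * ('I_r -> A)),
    (forall ha, List.In ha s -> local_coords (qpi N (pure 1 m)) ha.1 ha.2) /\
    forall P : spectrum A, exists2 ha, List.In ha s & ~ P ha.1.
  apply: spectrum_quasi_compact => P; have [h [Ph [v hv]]] := Nr P I.
  have [n [a e]] := hv.1 (qpi N (pure 1 m)).
  by exists h, a; split=> //; exists v, n.
pose I0 := [set b : A^o | forall ha, List.In ha s -> exists K (c : 'I_r -> A),
  ha.1 ^+ K * b = \sum_(j < r) c j * ha.2 j].
have S0 : I0 0.
  move=> ha _; exists 0%N, (fun=> 0); rewrite mulr0 big1 // => i _.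
  by rewrite mul0r.
have SD u v : I0 u -> I0 v -> I0 (u + v).
  move=> Iu Iv [h a] has; have [K [c e]] := Iu _ has; have [K' [c' e']] := Iv _ has.
  exists (K + K')%N, (fun j => h ^+ K' * c j + h ^+ K * c' j) => /=.
  rewrite /= in e e'.
  transitivity (h ^+ K' * (h ^+ K * u) + h ^+ K * (h ^+ K' * v)).
    by rewrite exprD; ring.
  rewrite e e' !mulr_sumr -big_split; apply: eq_bigr => j _ /=; ring.
have SZ b u : I0 u -> I0 (b *: u).
  move=> Iu ha has; have [K [c e]] := Iu _ has.
  exists K, (fun j => b * c j).
  rewrite [b *: u]/(b * u) mulrCA e mulr_sumr; apply: eq_bigr => j _; ring.
exists (Submodule S0 SD SZ) => B f.
change (base_change f N (pure 1 m) <-> forall b, I0 b -> f b = 0).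
split=> [m0 b Ib|I0f].
  apply: (@eq0_of_local B B^o) => P; have [[h a] has Ph] := scov (comap f P).
  have [K [c /= e]] := Ib _ has.
  have [/(_ m0)[L LP] _] := tens_map_base_changeP f (sN _ has).
  exists (f h), (L + K)%N; split=> //.
  rewrite exprD -[_ *: _]mulrA -(rmorphXn f K h) -rmorphM e.
  rewrite rmorph_sum mulr_sumr big1 // => j _.
  by rewrite rmorphM mulrCA LP mulr0.
apply: submod_of_local => P; have [[h a] has Ph] := scov (comap f P).
have [_ vanish] := tens_map_base_changeP f (sN _ has).
suff [K KP] : exists K, forall i, f h ^+ K * f (a i) = 0.
  by have [L LP] := vanish K KP; exists (f h), L.
suff [K KP] : exists K, forall i, I0 (h ^+ K * a i).
  by exists K => i; rewrite -rmorphXn -rmorphM; apply: I0f.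
have [|K KP] := @common_exponent_seq _ s (fun ha K => forall i,
    exists K' (c : 'I_r -> A),
      ha.1 ^+ K' * (h ^+ K * a i) = \sum_(j < r) c j * ha.2 j) _
    (fun ha has' => local_coords_compare (sN _ has) (sN _ has')).
  move=> ha n K nP i; have [K' [c e]] := nP i.
  exists K', (fun j => h ^+ K * c j).
  transitivity (h ^+ K * (ha.1 ^+ K' * (h ^+ n * a i))); first by rewrite exprD; ring.
  by rewrite e mulr_sumr; apply: eq_bigr => j _; rewrite mulrA.
by exists K => i ha has'; apply: KP.
Qed.
End Grassmannian.

(** * Nash blowups of modules with free torsion-free quotient *)

(** An alias of S, so that the R-algebra structure defined by g does not compete
    with another one. *)
Definition alg_via (R S : comNzRingType) (g : {rmorphism R -> S}) : Type := S.

Section RestrictionOfScalars.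
Variables (R S : comNzRingType) (g : {rmorphism R -> S}).

HB.instance Definition _ := GRing.ComNzRing.on (alg_via g).

Definition alg_via_scale (a : R) (x : alg_via g) : alg_via g := (g a : alg_via g) * x.

Fact alg_via_scaleA a b x :
  alg_via_scale a (alg_via_scale b x) = alg_via_scale (a * b) x.
Proof. by rewrite /alg_via_scale rmorphM mulrA. Qed.
Fact alg_via_scale1 : left_id 1 alg_via_scale.
Proof. by move=> x; rewrite /alg_via_scale rmorph1 mul1r. Qed.
Fact alg_via_scaleDr : right_distributive alg_via_scale +%R.
Proof. by move=> a x y; apply: mulrDr. Qed.
Fact alg_via_scaleDl x : {morph alg_via_scale^~ x : a b / a + b}.
Proof. by move=> a b; rewrite /alg_via_scale rmorphD mulrDl. Qed.
HB.instance Definition _ := GRing.Zmodule_isLmodule.Build R (alg_via g)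
  alg_via_scaleA alg_via_scale1 alg_via_scaleDr alg_via_scaleDl.
Fact alg_via_scaleAl (a : R) (x y : alg_via g) : a *: (x * y) = (a *: x) * y.
Proof. exact: mulrA. Qed.
HB.instance Definition _ :=
  GRing.Lmodule_isLalgebra.Build R (alg_via g) alg_via_scaleAl.
HB.instance Definition _ := GRing.Lalgebra_isComAlgebra.Build R (alg_via g).

Lemma alg_via_in_alg a : GRing.in_alg (alg_via g) a = g a.
Proof. by rewrite /GRing.in_alg /GRing.scale /= /alg_via_scale mulr1. Qed.

End RestrictionOfScalars.

Section StructureMap.
Variables (R : comNzRingType) (A : comAlgType R).

Definition structure_map (a : R^o) : A := a%:A.
Fact structure_map_additive : zmod_morphism structure_map.
Proof. by move=> a b; rewrite /structure_map scalerBl. Qed.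
Fact structure_map_monoid : monoid_morphism structure_map.
Proof.
split; first exact: scale1r.
by move=> a b; rewrite /structure_map -scalerAl mul1r scalerA.
Qed.
Fact structure_map_scalable : scalable structure_map.
Proof. by move=> a b; rewrite /structure_map scalerA. Qed.
HB.instance Definition _ := GRing.isZmodMorphism.Build R^o A structure_map
  structure_map_additive.
HB.instance Definition _ := GRing.isMonoidMorphism.Build R^o A structure_map
  structure_map_monoid.
HB.instance Definition _ := GRing.isScalable.Build R R^o A *:%R structure_map
  structure_map_scalable.

(** The functor of points of Spec R thus has exactly one point over each R-algebra. *)
Lemma structure_map_uniq (f : {lrmorphism R^o -> A}) :
  f = (structure_map : {lrmorphism R^o -> A}).
Proof.
apply: lrmorphism_eqP => a; rewrite -[a in LHS]mulr1 -[a * 1]/(a *: (1 : R^o)).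
by rewrite linearZ rmorph1.
Qed.

End StructureMap.

Section PureSums.
Variables (R : comNzRingType) (A : comAlgType R) (M : lmodType R).

Lemma pure0r (a : A) : pure a (0 : M) = 0.
Proof. by apply: (addrI (pure a 0)); rewrite -pureDr !addr0. Qed.

Lemma pureNr (a : A) (m : M) : pure a (- m) = - pure a m.
Proof. by apply: (addrI (pure a m)); rewrite -pureDr !subrr pure0r. Qed.

Lemma pure_sumr (a : A) (I : Type) (s : seq I) (P : pred I) (F : I -> M) :
  pure a (\sum_(i <- s | P i) F i) = \sum_(i <- s | P i) pure a (F i).
Proof. by apply: big_morph; [apply: pureDr | apply: pure0r]. Qed.

Lemma pureZr (a : A) (c : R) (m : M) : pure a (c *: m) = c%:A *: pure a m.
Proof. by rewrite -pure_bal scale_pure -scalerAl mul1r. Qed.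

End PureSums.

Section FreeTorsionFreeQuotient.
Variables (R : comNzRingType) (M : lmodType R) (r : nat).
Variables (K : fieldType) (g : {rmorphism R -> K}) (g_inj : injective g).
Variables (T : submodule M) (v : 'I_r -> M).
Hypothesis T_torsion : forall m, T m -> exists2 f : R, f != 0 & f *: m = 0.
Hypothesis v_gen : forall m, exists a : 'I_r -> R, T (m - \sum_(i < r) a i *: v i).
Hypothesis v_free : forall a : 'I_r -> R, T (\sum_(i < r) a i *: v i) ->
  forall i, a i = 0.

Let domain (a b : R) : a * b = 0 -> a != 0 -> b = 0.
Proof.
move=> ab0 a0; apply: g_inj; rewrite rmorph0; apply/eqP.
move/(congr1 g)/eqP: ab0; rewrite rmorphM rmorph0 mulf_eq0 => /orP[|//].
by rewrite -[X in _ == X](rmorph0 g) (inj_eq g_inj) (negPf a0).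
Qed.

(** The kernel of the base change to A of the quotient map from M to M / T. *)
Definition torsion_ker (A : comAlgType R) : submodule (tens A M) :=
  @Defs.span A (tens A M) [set pure 1 m | m in [set m | T m]]%classic.

(* The coordinates of the class of m in the basis v of M / T; the functions lam
   below are their extensions to A (x) M. *)
Let coord (m : M) : 'I_r -> R := projT1 (cid (v_gen m)).
Let coordP m : T (m - \sum_(i < r) coord m i *: v i) := projT2 (cid (v_gen m)).

Let coord_uniq m a : T (m - \sum_(i < r) a i *: v i) -> coord m =1 a.
Proof.
move=> Ta i; apply/eqP; rewrite -subr_eq0; apply/eqP; move: i; apply: v_free.
under eq_bigr => i _ do rewrite scalerBl.
by rewrite sumrB; have := submodB Ta (coordP m); rewrite opprB addrC addrA subrK.
Qed.

Let coord_bal (A : comAlgType R) i : balanced (fun (a : A) m => coord m i *: a).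
Proof.
have lin c m n j : coord (c *: m + n) j = c * coord m j + coord n j.
  apply: (coord_uniq (a := fun j => c * coord m j + coord n j)).
  under eq_bigr => l _ do rewrite scalerDl -scalerA.
  rewrite big_split -scaler_sumr opprD addrACA -scalerBr /=.
  by apply: submodD; [apply: submodZ|]; apply: coordP.
split=> [m a b|a m n|c a m].
- exact: scalerDr.
- by rewrite -[m + n](congr1 (+%R^~ n) (scale1r m)) lin mul1r scalerDl.
- have := lin c m 0 i; rewrite addr0 (coord_uniq (m := 0) (a := fun=> 0)).
    by rewrite addr0 => ->; rewrite mulrC scalerA.
  by rewrite sub0r big1 ?oppr0 => [|j _]; rewrite ?scale0r //; apply: submod0.
Qed.

Let lam (A : comAlgType R) i : tens A M -> A :=
  tens_lift (fun (a : A) m => coord m i *: a).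
Let lam0 (A : comAlgType R) i : lam i (0 : tens A M) = 0.
Proof. exact/tens_lift0/coord_bal. Qed.
Let lamD (A : comAlgType R) i : {morph @lam A i : x y / x + y}.
Proof. exact/tens_liftD/coord_bal. Qed.
Let lam_pure (A : comAlgType R) i (a : A) m : lam i (pure a m) = coord m i *: a.
Proof. exact/(tens_lift_pure (coord_bal A i)). Qed.

Lemma torsion_quot_gen (A : comAlgType R) (z : tens A M) :
  exists a : 'I_r -> A, torsion_ker A (z - \sum_(i < r) a i *: pure 1 (v i)).
Proof.
elim/tens_ind: z => [|x y [a ea] [b eb]|a m].
- exists (fun=> 0); rewrite big1 ?subrr => [|i _]; rewrite ?scale0r //.
  exact: submod0.
- exists (fun i => a i + b i).
  have -> : \sum_(i < r) (a i + b i) *: pure 1 (v i) =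
      \sum_(i < r) a i *: pure 1 (v i) + \sum_(i < r) b i *: pure 1 (v i).
    by rewrite -big_split; apply: eq_bigr => i _; rewrite scalerDl.
  by rewrite opprD addrACA; apply: submodD.
- exists (fun i => coord m i *: a).
  have := @submodZ _ _ _ a _ (span_gen (imageP (pure (1 : A)) (coordP m))).
  rewrite pureDr pureNr pure_sumr scalerDr -pureE scalerN scaler_sumr.
  congr (submod_set _ (_ - _)); apply: eq_bigr => i _.
  by rewrite pureZr scalerA -scalerAr mulr1.
Qed.

Lemma torsion_quot_free (A : comAlgType R) (a : 'I_r -> A) :
  torsion_ker A (\sum_(i < r) a i *: pure 1 (v i)) -> forall i, a i = 0.
Proof.
have lamZ i (c : A) z : lam i (c *: z) = c * lam i z.
  elim/tens_ind: z => [|x y ex ey|b m].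
  - by rewrite scaler0 lam0 mulr0.
  - by rewrite scalerDr !lamD ex ey mulrDr.
  - by rewrite scale_pure !lam_pure scalerAr.
move=> Ta i.
have lamT0 : lam i (\sum_(i < r) a i *: pure 1 (v i)) = 0.
  have S0 : lam i (0 : tens A M) = 0 := lam0 A i.
  have SD (x y : tens A M) : lam i x = 0 -> lam i y = 0 -> lam i (x + y) = 0.
    by rewrite lamD => -> ->; rewrite addr0.
  have SZ (c : A) (x : tens A M) : lam i x = 0 -> lam i (c *: x) = 0.
    by rewrite lamZ => ->; rewrite mulr0.
  apply: (span_ind (P := fun z => lam i z = 0)) Ta => // _ [m Tm <-].
  rewrite lam_pure (coord_uniq (m := m) (a := fun=> 0)) ?scale0r //.
  by rewrite big1 ?subr0 // => j _; rewrite scale0r.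
rewrite -{}lamT0 (big_morph _ (@lamD A i) (lam0 A i)).
have coord_v j : coord (v j) i = (i == j)%:R.
  apply: (coord_uniq (a := fun i => (i == j)%:R)); rewrite (bigD1 j) //= eqxx scale1r big1.
    by rewrite addr0 subrr; apply: submod0.
  by move=> l /negPf ->; rewrite scale0r.
rewrite (bigD1 i) //= big1 => [|j]; last first.
  rewrite eq_sym => /negPf ij; rewrite lamZ lam_pure coord_v ij.
  by rewrite scale0r mulr0.
by rewrite lamZ lam_pure coord_v eqxx scale1r mulr1 addr0.
Qed.

Lemma torsion_quot_locally_free (A : comAlgType R) :
  locally_free_on [set: spectrum A] (qmod (torsion_ker A)) r.
Proof.
move=> P _; exists 1; split; first exact: spectrum_proper.
have qsum a : \sum_(i < r) a i *: qpi (torsion_ker A) (pure 1 (v i)) =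
    qpi (torsion_ker A) (\sum_(i < r) a i *: pure 1 (v i)).
  by rewrite linear_sum; apply: eq_bigr => i _; rewrite linearZ.
exists (fun i => qpi (torsion_ker A) (pure 1 (v i))); split=> [z|a].
  rewrite -(qpi_surj z); have [a ea] := torsion_quot_gen (repr z).
  by exists 0%N, a; rewrite scale1r qsum; apply/qpi_eq.
rewrite qsum => a0; exists 0%N => i; rewrite mul1r; apply: torsion_quot_free.
rewrite -[X in submod_set _ X]subr0; apply/qpi_eq.
by rewrite a0 (linear0 (qpi _)).
Qed.

Definition torsion_point (A : comAlgType R) : Grass M r A :=
  GrassPoint (@torsion_quot_locally_free A).

Lemma torsion_point_pullback (A B : comAlgType R) (f : {lrmorphism A -> B}) :
  pullback f (torsion_point A) = torsion_point B.
Proof.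
apply: grass_points_eq; apply: submodule_eqP => z.
change (base_change f (torsion_ker A) z <-> torsion_ker B z); split.
  apply: span_min => _ [u Tu <-].
  have S0 : torsion_ker B (tens_map f (0 : tens A M)).
    by rewrite tens_map0; apply: submod0.
  have SD (x y : tens A M) : torsion_ker B (tens_map f x) ->
      torsion_ker B (tens_map f y) -> torsion_ker B (tens_map f (x + y)).
    by move=> *; rewrite tens_mapD; apply: submodD.
  have SZ (c : A) (x : tens A M) : torsion_ker B (tens_map f x) ->
      torsion_ker B (tens_map f (c *: x)).
    by move=> *; rewrite tens_mapZ; apply: submodZ.
  apply: (span_ind (P := fun z => torsion_ker B (tens_map f z))) Tu => //.
  move=> _ [m Tm <-].
  by rewrite tens_map_pure rmorph1; apply: span_gen; exists m.
apply: span_min => _ [m Tm <-]; rewrite -(rmorph1 f) -tens_map_pure.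
by apply: tens_map_base_change; apply: span_gen; exists m.
Qed.

Variable U : set (spectrum R).
Hypothesis U_Nash : Nash_open M r U.

(* A dense open set is not empty, so it contains a basic open set D(f); here f is
   not 0, as it avoids a prime. *)
Let U_basic : exists2 f : R, f != 0 & forall P : spectrum R, ~ P f -> U P.
Proof.
have [Uopen Udense _] := U_Nash.
have [S01 S0D S0Z] : [/\ (0 : R^o) = 0, forall u w : R^o, u = 0 -> w = 0 -> u + w = 0
    & forall a (u : R^o), u = 0 -> a *: u = 0].
  by split=> // [u w -> ->|a u ->]; rewrite ?addr0 ?scaler0.
have [|P _] := @prime_over R (Submodule (submod_set := eq^~ 0) S01 S0D S0Z).
  by apply/eqP; rewrite /= oner_eq0.
have [||Q [_ UQ]] := Udense [set: spectrum R].
- by move=> Q _; exists 1; split=> //; apply: spectrum_proper.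
- by exists P.
have [f [Qf fU]] := Uopen Q UQ; exists f => //.
by apply: contra_notN Qf => /eqP ->; apply: submod0.
Qed.

(** A closed condition on the section over Spec R is an ideal I of R.  The generic
    point maps into U, hence I dies in the field K, and R embeds into K. *)
Lemma torsion_point_in_closure (A : comAlgType R) :
  in_closure (@Grass_over R M r U) (torsion_point A).
Proof.
move=> C Ccl UC.
have [I CI] := Ccl _ (torsion_point R^o).
rewrite -(torsion_point_pullback (structure_map A : {lrmorphism R^o -> A})).
apply/CI => a Ia.
have [f f0 fU] := U_basic.
have /CI/(_ a Ia) : C (alg_via g) (pullback
    (structure_map (alg_via g) : {lrmorphism R^o -> alg_via g}) (torsion_point R^o)).
  rewrite torsion_point_pullback; apply: UC => q; apply: fU => qf.
  have gf : GRing.in_alg (alg_via g) f = g f by exact: alg_via_in_alg.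
  apply: (@spectrum_proper _ q).
  have -> : (1 : alg_via g) = ((g f)^-1 : alg_via g) * (g f : alg_via g).
    rewrite [RHS](@mulVf K) // -(rmorph0 g) (inj_eq g_inj) //.
  by rewrite -gf; apply: (@submodZ _ _ q).
move=> a0; have ga0 : g a = g 0 by rewrite rmorph0 -[RHS]a0 -alg_via_in_alg.
by rewrite (g_inj ga0) rmorph0.
Qed.

(** Torsion vanishes over U, where M is locally free, so it vanishes in every
    quotient in the closure.  Such a quotient is generated by the r elements v i,
    and it is locally free of rank r, so v satisfies no relation in it. *)
Lemma torsion_point_uniq (A : comAlgType R) (x : Grass M r A) :
  in_closure (@Grass_over R M r U) x -> x = torsion_point A.
Proof.
move=> xU; case: (U_Nash) => _ _ Ufree.
have Tx m : T m -> grass_ker x (pure 1 m).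
  move=> Tm; apply: (xU _ (@closed_vanishing R M r m)) => B y yU /=.
  rewrite (_ : pure 1 m = 0); first exact: submod0.
  apply: eq0_of_local => q; have [h [qh [w [wgen wfree]]]] := Ufree _ (yU q).
  have [n [a e]] := wgen m; have [f f0 fm] := T_torsion Tm.
  exists (GRing.in_alg B h), n; split=> //.
  rewrite -(rmorphXn (GRing.in_alg B)) -pureZr e big1 ?pure0r // => i _.
  suff -> : a i = 0 by rewrite scale0r.
  have [|N NP] := wfree (fun i => f * a i).
    under eq_bigr => j _ do rewrite -scalerA.
    by rewrite -scaler_sumr -e scalerA mulrC -scalerA fm scaler0.
  have h0 : h != 0.
    by apply: contra_notN qh => /eqP ->; apply: submod0.
  have hN0 : h ^+ N != 0.
    elim: (N) => [|l IHl]; first by rewrite expr0 oner_eq0.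
    apply/eqP; rewrite exprS => /domain/(_ h0) e0.
    by rewrite e0 eqxx in IHl.
  exact: (domain (domain (NP i) hN0)).
have sub z : torsion_ker A z -> grass_ker x z.
  by apply: span_min => _ [m Tm <-]; apply: Tx.
apply: grass_points_eq; apply: submodule_eqP => z; split; last exact: sub.
case: x {xU Tx} sub => N Nfree /= sub Nz.
have [a az] := torsion_quot_gen z.
suff a0 : forall i, a i = 0.
  by move: az; rewrite big1 ?subr0 // => i _; rewrite a0 scale0r.
have u0 : \sum_(i < r) a i *: qpi N (pure 1 (v i)) = 0.
  transitivity (qpi N (\sum_(i < r) a i *: pure 1 (v i))).
    by rewrite linear_sum; apply: eq_bigr => i _; rewrite linearZ.
  rewrite -[RHS](linear0 (qpi N)); apply/qpi_eq; rewrite subr0.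
  by rewrite -[X in N X](subKr z); apply: submodB => //; apply: sub.
move=> i; apply: (@eq0_of_local A A^o) => P.
have [h [Ph [w hw]]] := Nfree P Logic.I.
have gen j : exists c : 'I_r -> A,
    w j = \sum_(i < r) c i *: qpi N (pure 1 (v i)).
  have [c cP] := torsion_quot_gen (repr (w j)); exists c.
  rewrite -(qpi_surj (w j)).
  transitivity (qpi N (\sum_(i < r) c i *: pure 1 (v i))).
    by apply/qpi_eq; apply: sub.
  by rewrite linear_sum; apply: eq_bigr => l _; rewrite linearZ.
have [|n nP] := @generators_loc_free A _ h r w _ 0
  (\matrix_(j, i) projT1 (cid (gen j)) i) a hw _ u0.
  move=> j; rewrite scale1r [LHS](projT2 (cid (gen j))).
  by apply: eq_bigr => l _; rewrite mxE.
by exists h, n; split=> //; apply: nP.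
Qed.

Theorem Nash_iso_Spec : Rfunctor_iso (Nash M r U) (Spec R).
Proof.
exists (fun (A : comAlgType R) _ => structure_map A : {lrmorphism R^o -> A}).
split=> [A B f x|A].
  exact/esym/structure_map_uniq.
exists (fun _ => exist _ _ (torsion_point_in_closure A)) => [[x xU]|f].
  by apply: closure_points_eq; apply/esym/torsion_point_uniq.
exact/esym/structure_map_uniq.
Qed.

End FreeTorsionFreeQuotient.

(** * Power series *)

Section PowerSeriesTheory.
Variable K : comNzRingType.
Implicit Types f g h : powser K.

Lemma powserP f g : (forall n, f n = g n) -> f = g.
Proof. by move=> e; apply/funext. Qed.

Lemma powser0E n : (0 : powser K) n = 0. Proof. by []. Qed.
Lemma powser1E n : (1 : powser K) n = (n == 0)%:R. Proof. by []. Qed.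
Lemma powserDE f g n : (f + g) n = f n + g n. Proof. by []. Qed.
Lemma powserNE f n : (- f) n = - f n. Proof. by []. Qed.
Lemma powserBE f g n : (f - g) n = f n - g n. Proof. by []. Qed.
Lemma powserZE a f n : (a *: f) n = a * f n. Proof. by []. Qed.
Lemma powserME f g n : (f * g) n = \sum_(i < n.+1) f i * g (n - i)%N.
Proof. by []. Qed.
Definition powserE :=
  (powser0E, powser1E, powserDE, powserNE, powserBE, powserZE).

Lemma powser_sumE (I : Type) (s : seq I) (P : pred I) (F : I -> powser K) n :
  (\sum_(i <- s | P i) F i) n = \sum_(i <- s | P i) F i n.
Proof. by apply: (big_morph (fun f : powser K => f n)). Qed.

Definition psX : powser K := fun n => (n == 1)%:R.

Lemma psXME f n : (psX * f) n = if n is n'.+1 then f n' else 0.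
Proof.
rewrite powserME; case: n => [|n]; first by rewrite big_ord1 /psX mul0r.
rewrite !big_ord_recl /= /psX /= mul0r add0r mul1r subSS subn0.
by rewrite big1 ?addr0 // => i _; rewrite mul0r.
Qed.

Lemma psXnME m f n : (psX ^+ m * f) n = if (n < m)%N then 0 else f (n - m)%N.
Proof.
elim: m n => [|m IHm] n; first by rewrite expr0 mul1r subn0.
by rewrite exprS -mulrA psXME; case: n => [|n] //; rewrite IHm.
Qed.

Lemma psXnE m n : (psX ^+ m) n = (n == m)%:R.
Proof.
rewrite -[psX ^+ m]mulr1 psXnME powser1E subn_eq0.
by case: ltngtP.
Qed.

(** The quotient by the power X^m, when f is divisible by it. *)
Definition ps_shift m f : powser K := fun n => f (n + m)%N.

Definition ordge n f := forall i, (i < n)%N -> f i = 0.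

Lemma ordge_shift n f : ordge n f -> f = psX ^+ n * ps_shift n f.
Proof.
move=> fn; apply/powserP => i; rewrite psXnME /ps_shift.
by case: ltnP => [/fn//|/subnK->].
Qed.

Lemma ordge_XnM n f : ordge n (psX ^+ n * f).
Proof. by move=> i lin; rewrite psXnME lin. Qed.

Lemma ordge0 n : ordge n 0. Proof. by []. Qed.
Lemma ordgeD n f g : ordge n f -> ordge n g -> ordge n (f + g).
Proof. by move=> nf ng i lin; rewrite powserDE nf ?ng ?addr0. Qed.
Lemma ordgeM m n f g : ordge m f -> ordge n g -> ordge (m + n) (f * g).
Proof.
move=> /ordge_shift -> /ordge_shift ->; rewrite mulrACA -exprD.
exact: ordge_XnM.
Qed.
Lemma ordgeMl n f g : ordge n g -> ordge n (f * g).
Proof. exact: (@ordgeM 0). Qed.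

Lemma ordge_exp n f : ordge 1 f -> ordge n (f ^+ n).
Proof.
move=> f1; elim: n => [|n IHn]; first by move=> i; rewrite ltn0.
by rewrite exprS -add1n; apply: ordgeM.
Qed.

(** The inverse is a geometric series, whose coefficients are read off from the
    partial sums. *)
Lemma powser_unit f c : f 0 * c = 1 -> exists g, f * g = 1.
Proof.
move=> f0c; pose b := 1 - c *: f.
have b1 : ordge 1 b by case=> // _; rewrite /b !powserE mulrC f0c subrr.
pose h : powser K := fun n => (\sum_(i < n.+1) b ^+ i) n.
have hP N : exists2 e, ordge N e & h = \sum_(i < N) b ^+ i + e.
  exists (h - \sum_(i < N) b ^+ i); last by rewrite addrC subrK.
  move=> n nN; rewrite powserBE /h -(subnK nN) addnC.
  rewrite big_split_ord /= powserDE opprD addrA subrr sub0r powser_sumE big1 ?oppr0 //.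
  move=> i _; apply: (ordge_exp (n := n.+1 + i)) => //.
  by rewrite addSn ltnS leq_addr.
exists (c *: h); apply/powserP => n.
have -> : f * (c *: h) = (1 - b) * h.
  by rewrite /b opprB addrCA subrr addr0 -scalerAl scalerAr.
have [e en ->] := hP n.+1.
rewrite mulrDr powserDE (ordgeMl _ en (ltnSn n)) addr0.
rewrite -opprB mulNr -subrX1 opprB powserBE.
by rewrite (ordge_exp (n := n.+1) b1 (ltnSn n)) subr0.
Qed.

Lemma powser_pchar p : p \in [pchar K] -> p \in [pchar (powser K)].
Proof.
rewrite !inE => /andP[-> /eqP p0]; apply/eqP/powserP => n.
by rewrite -(scaler_nat p (1 : powser K)) p0 scale0r.
Qed.

End PowerSeriesTheory.

Lemma powser_associate (K : fieldType) (f : powser K) : f != 0 ->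
  exists n g, f * g = psX K ^+ n.
Proof.
move=> f0; have [n fn] : exists n, f n != 0.
  apply: contrapT => nf; case/eqP: f0; apply/powserP => n.
  by apply: contrapT => /eqP fn; apply: nf; exists n.
pose m := ex_minn (ex_intro (fun n => f n != 0) n fn).
have [fm mmin] : f m != 0 /\ forall i, f i != 0 -> (m <= i)%N.
  by rewrite /m; case: ex_minnP.
have fX : f = psX K ^+ m * ps_shift m f.
  apply: ordge_shift => i im; apply: contraTeq im => /mmin.
  by rewrite -leqNgt.
have [|g fg] := @powser_unit _ (ps_shift m f) (f m)^-1.
  by rewrite /ps_shift add0n mulfV.
by exists m, g; rewrite {1}fX -mulrA fg mulr1.
Qed.

(** * Frobenius *)

Lemma exprD_prime (L : comPzRingType) (p : nat) (x y : L) : prime p ->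
  p%:R = 0 :> L -> (x + y) ^+ p = x ^+ p + y ^+ p.
Proof.
case: p => // p pr pL; rewrite exprDn big_ord_recr big_ord_recl /=.
rewrite subnn subn0 bin0 binn !mulr1 mul1r !mulr1n big1 ?addr0 // => i _.
have /dvdnP[c ->] : (p.+1 %| 'C(p.+1, bump 0 i))%N.
  by apply: prime_dvd_bin; rewrite //= /bump add1n ltnS ltn_ord.
by rewrite mulrnA -[_ *+ p.+1]mulr_natr pL mulr0.
Qed.

Section Frobenius.
Variables (K : comNzRingType) (p e : nat) (hp : p \in [pchar K]).
Implicit Types f g h : powser K.
Let q := (p ^ e)%N.

Lemma pexp_gt0 : (0 < q)%N.
Proof. by rewrite expn_gt0 prime_gt0 // (pcharf_prime hp). Qed.

Lemma exprD_pexp (L : comPzRingType) (x y : L) : p%:R = 0 :> L ->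
  (x + y) ^+ q = x ^+ q + y ^+ q.
Proof.
move=> pL; rewrite /q; elim: e => [|d IHd]; first by rewrite expn0 !expr1.
by rewrite expnSr !exprM IHd exprD_prime // (pcharf_prime hp).
Qed.

Lemma exprB_pexp (L : comPzRingType) (x y : L) : p%:R = 0 :> L ->
  (x - y) ^+ q = x ^+ q - y ^+ q.
Proof. by move=> pL; apply/eqP; rewrite eq_sym subr_eq -exprD_pexp // subrK. Qed.

(** Frobenius is additive, so the q-th power of f(0) + X g is f(0)^q + X^q g^q;
    the formula follows by induction on the degree. *)
Lemma powser_pexpE f n :
  (f ^+ q) n = if (q %| n)%N then f (n %/ q)%N ^+ q else 0.
Proof.
have [m] := ubnP n; elim: m => // m IHm in f n *; rewrite ltnS => nm.
have f1 : f = f 0%N *: 1 + psX K * ps_shift 1 f.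
  apply/powserP => -[|i]; rewrite !powserE psXME ?mulr1 ?addr0 //.
  by rewrite mulr0 add0r /ps_shift addn1.
have q0 := pexp_gt0; rewrite {1}f1 exprD_pexp; last exact/pcharf0/powser_pchar.
rewrite exprZn expr1n exprMn !powserE psXnME.
case: ltnP => [nq|qn].
  rewrite addr0; case: n nq {nm} => [_|n nq]; first by rewrite mulr1 dvdn0 div0n.
  by rewrite mulr0 (gtnNdvd _ nq).
have n0 := leq_trans q0 qn.
rewrite (gtn_eqF n0) mulr0 add0r IHm; last first.
  by apply: leq_trans nm; rewrite ltn_subrL q0.
rewrite -[in RHS](subnK qn) dvdn_addl // divnDr // divnn q0.
by rewrite /ps_shift.
Qed.

End Frobenius.

(** The coefficients have q-th roots because the field is algebraically closed. *)
Lemma powser_pexp_root (K : closedFieldType) (p e : nat) (f : powser K) :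
  p \in [pchar K] -> (forall n, ~~ (p ^ e %| n)%N -> f n = 0) ->
  exists g, f = g ^+ (p ^ e).
Proof.
move=> hp fq; have q0 := pexp_gt0 e hp.
have root (a : K) : exists b, b ^+ (p ^ e) = a.
  have [b bP] := solve_monicpoly (fun i => if i == 0%N then a else 0) q0.
  exists b; rewrite bP -(prednK q0) big_ord_recl big1 ?mulr1 ?addr0 // => i _.
  by rewrite mul0r.
exists (fun n => projT1 (cid (root (f (n * p ^ e)%N)))).
apply/powserP => n; rewrite (powser_pexpE _ hp).
case: ifP => [qn|/negbT/fq//].
by rewrite (projT2 (cid (root _))) divnK.
Qed.

(** * Complete local algebras with power series generators *)

Section Generators.
Variables (k : fieldType) (R : comAlgType k) (s : nat) (x : 'I_s -> R).
Hypothesis x_gen : power_series_generators x.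
Local Notation m := (max_ideal R).

(** The residue field is k. *)
Lemma max_ideal_const (a : R) : exists c : k, m (a - c%:A).
Proof.
have [c cP] := x_gen.2 a; exists (c (fun=> 0%N)).
have := cP 1%N; rewrite (big_pred1 [ffun=> ord0]) => [|alpha]; last first.
  by apply/esym/eqP/ffunP => i; rewrite ffunE [alpha i]ord1.
rewrite big1 => [|i _]; last by rewrite ffunE expr0.
rewrite (_ : (fun i => _) = (fun=> 0%N)); last by apply/funext => i; rewrite ffunE.
by apply: (ideal_powS_min (J := m)) => a' b ma' _; apply: ideal_mulr.
Qed.

Hypothesis m1 : ~ m 1.

(** The monomials other than 1 are divisible by some generator, and the constant
    term vanishes since it belongs to a proper ideal. *)
Lemma max_ideal_gen (a : R) : m a ->
  exists y : 'I_s -> R, ideal_pow m 2 (a - \sum_(i < s) x i * y i).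
Proof.
move=> ma; have [c cP] := x_gen.2 a.
have [y [d e]] : exists (y : 'I_s -> R) (d : k),
    \sum_(alpha : {ffun 'I_s -> 'I_2}) c (fun i => alpha i) *: \prod_(i < s) x i ^+ alpha i
      = \sum_(i < s) x i * y i + d%:A.
  elim/big_rec: _ => [|alpha u _ [y [d ->]]].
    exists (fun=> 0), 0; rewrite scale0r addr0 big1 // => i _; exact: mulr0.
  set ca := c _.
  have [[j aj]|a0] := pselect (exists j, alpha j != ord0); last first.
    exists y, (ca + d); rewrite scalerDl addrCA; congr (_ + (_ *: _ + _)).
    rewrite big1 // => i _; suff -> : alpha i = ord0 by rewrite expr0.
    by apply: contrapT => /eqP ai; apply: a0; exists i.
  exists (fun i => y i + (i == j)%:R * (ca *: (x j ^+ (alpha j).-1 *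
    \prod_(l < s | l != j) x l ^+ alpha l))), d.
  rewrite addrA; congr (_ + _).
  under [RHS]eq_bigr => i _ do rewrite mulrDr.
  rewrite big_split addrC; congr (_ + _) => /=.
  rewrite (bigD1 j) //= [RHS](bigD1 j) //= [X in _ + X]big1 ?addr0; last first.
    by move=> i /negPf ->; rewrite mul0r mulr0.
  by rewrite eqxx mul1r -scalerAr mulrA -exprS prednK ?lt0n.
have d0 : d = 0.
  apply: contrapT => /eqP d0; apply: m1.
  have mx : m (\sum_(i < s) x i * y i).
    by apply: submod_sum => i _; apply/ideal_mulr/x_gen.1.
  have : m (d%:A).
    have m2 : m (a - (\sum_(i < s) x i * y i + d%:A)).
      move: (cP 2); rewrite e; apply: (ideal_powS_min (J := m)) => a' b ma' _.
      exact: ideal_mulr.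
    rewrite -[d%:A](addKr (\sum_(i < s) x i * y i)) addrC.
    rewrite -[X in X - _](subKr a).
    by apply: submodB => //; apply: submodB.
  by move/(ideal_mull (d^-1%:A)); rewrite -scalerAl mul1r scalerA mulVf // scale1r.
by exists y; move: (cP 2); rewrite e d0 scale0r addr0.
Qed.

End Generators.

(** * The tensor square near the diagonal *)

Section TensorPowers.
Variables (k : fieldType) (R : comAlgType k) (s : nat) (x : 'I_s -> R).
Hypothesis x_gen : power_series_generators x.
Local Notation m := (max_ideal R).
Local Notation T := (tens_alg R R).
Implicit Types (a b : R) (t u : T).

Definition tens_l a : T := tens_pure a 1.
Definition tens_r a : T := tens_pure 1 a.

Lemma tens_pureM a a' b b' :
  tens_pure a b * tens_pure a' b' = tens_pure (a * a') (b * b') :> T.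
Proof. exact: tens_mul_pure. Qed.
Lemma tens_lD : {morph tens_l : a b / a + b}.
Proof. exact: pureDl. Qed.
Lemma tens_rD : {morph tens_r : a b / a + b}.
Proof. exact: pureDr. Qed.
Lemma tens_l0 : tens_l 0 = 0.
Proof. by apply: (addrI (tens_l 0)); rewrite -tens_lD !addr0. Qed.
Lemma tens_r0 : tens_r 0 = 0.
Proof. by apply: (addrI (tens_r 0)); rewrite -tens_rD !addr0. Qed.
Lemma tens_lM : {morph tens_l : a b / a * b}.
Proof. by move=> a b; rewrite tens_pureM mulr1. Qed.
Lemma tens_rM : {morph tens_r : a b / a * b}.
Proof. by move=> a b; rewrite tens_pureM mulr1. Qed.
Lemma tens_lX a n : tens_l (a ^+ n) = tens_l a ^+ n.
Proof. by elim: n => // n IHn; rewrite !exprS tens_lM IHn. Qed.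
Lemma tens_rX a n : tens_r (a ^+ n) = tens_r a ^+ n.
Proof. by elim: n => // n IHn; rewrite !exprS tens_rM IHn. Qed.
Lemma tens_lr a b : tens_l a * tens_r b = tens_pure a b.
Proof. by rewrite tens_pureM mulr1 mul1r. Qed.
Lemma tens_r_const (c : k) : tens_r c%:A = tens_l c%:A.
Proof. exact/esym/pure_bal. Qed.
Lemma tens_l_sum (I : Type) (r : seq I) (P : pred I) (F : I -> R) :
  tens_l (\sum_(i <- r | P i) F i) = \sum_(i <- r | P i) tens_l (F i).
Proof. by apply: big_morph; [apply: tens_lD | apply: tens_l0]. Qed.
Lemma tens_r_sum (I : Type) (r : seq I) (P : pred I) (F : I -> R) :
  tens_r (\sum_(i <- r | P i) F i) = \sum_(i <- r | P i) tens_r (F i).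
Proof. by apply: big_morph; [apply: tens_rD | apply: tens_r0]. Qed.
Lemma tens_lN a : tens_l (- a) = - tens_l a.
Proof. by apply: (addrI (tens_l a)); rewrite -tens_lD !subrr tens_l0. Qed.

(** The ideal m (x) R + R (x) m.  Its powers define the same topology as the
    ideals of the completion, and are easier to expand along the diagonal. *)
Definition tens_max : ideal T :=
  span [set t : T^o | exists2 a, m a & t = tens_l a \/ t = tens_r a].

Lemma tens_max_l a : m a -> tens_max (tens_l a).
Proof. by move=> ma; apply: span_gen; exists a => //; left. Qed.
Lemma tens_max_r a : m a -> tens_max (tens_r a).
Proof. by move=> ma; apply: span_gen; exists a => //; right. Qed.

Lemma tens_max_pow n a : ideal_pow m n a ->
  ideal_pow tens_max n (tens_l a) /\ ideal_pow tens_max n (tens_r a).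
Proof.
elim: n a => [|n IHn] a; first by split; apply: ideal_pow0.
pose P (a : R^o) := ideal_pow tens_max n.+1 (tens_l a) /\
                    ideal_pow tens_max n.+1 (tens_r a).
have S0 : P 0 by rewrite /P tens_l0 tens_r0; split; apply: submod0.
have SD (b c : R^o) : P b -> P c -> P (b + c).
  by move=> [bl br] [cl cr]; rewrite /P tens_lD tens_rD; split; apply: submodD.
have SZ (c : R) (b : R^o) : P b -> P (c *: b).
  by move=> [bl br]; rewrite /P tens_lM tens_rM; split; apply: ideal_mull.
apply: (span_ind (P := P)) => // _ [b [c [mb /IHn[cl cr] ->]]].
split; rewrite ?tens_lM ?tens_rM; apply: ideal_powSM => //.
  exact: tens_max_l.
exact: tens_max_r.
Qed.

Lemma ctens_ideal_sub n t : ctens_ideal R n t -> ideal_pow tens_max n t.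
Proof.
by apply: span_min => _ [a ma [->|->]]; have [al ar] := tens_max_pow ma.
Qed.

Lemma ctens_ideal_l n a : ideal_pow m n a -> ctens_ideal R n (tens_l a).
Proof. by move=> ma; apply: span_gen; exists a => //; left. Qed.
Lemma ctens_ideal_r n a : ideal_pow m n a -> ctens_ideal R n (tens_r a).
Proof. by move=> ma; apply: span_gen; exists a => //; right. Qed.

Lemma ctens_ideal_le n n' t : (n <= n')%N -> ctens_ideal R n' t -> ctens_ideal R n t.
Proof.
move=> nn'; apply: span_min => _ [a /(ideal_pow_le nn') ma [->|->]].
  exact: ctens_ideal_l.
exact: ctens_ideal_r.
Qed.

(** The power of exponent N is spanned by the products m^i (x) m^j with i + j = N;
    when N = 2n, one of i, j is at least n. *)
Lemma tens_max_pow_sub n t : ideal_pow tens_max (2 * n) t -> ctens_ideal R n t.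
Proof.
pose L N : ideal T := span [set t : T^o | exists (i j : nat) (a b : R),
  [/\ (i + j = N)%N, ideal_pow m i a, ideal_pow m j b & t = tens_l a * tens_r b]].
have KL N u : ideal_pow tens_max N u -> L N u.
  elim: N u => [|N IHN] u.
    move=> _; rewrite -[u]mulr1; apply: ideal_mull; apply: span_gen.
    exists 0%N, 0%N, 1, 1; split=> //; try exact: ideal_pow0.
    by rewrite tens_lr.
  apply: ideal_powS_min => t1 t2 Kt1 /IHN Lt2.
  move: t1 Kt1 => t0 Kt0.
  have S0 : L N.+1 (0 * t2) by rewrite mul0r; apply: submod0.
  have SD (v w : T^o) : L N.+1 (v * t2) -> L N.+1 (w * t2) ->
      L N.+1 ((v + w : T) * t2).
    by move=> *; rewrite mulrDl; apply: submodD.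
  have SZ (c : T) (v : T^o) : L N.+1 (v * t2) -> L N.+1 ((c *: v : T) * t2).
    by move=> *; rewrite -[c *: v]/(c * v) -mulrA; apply: ideal_mull.
  apply: (span_ind (P := fun u : T^o => L N.+1 ((u : T) * t2))) Kt0 => // t1 Kt1.
  have S0' : L N.+1 (t1 * 0) by rewrite mulr0; apply: submod0.
  have SD' (v w : T^o) : L N.+1 (t1 * v) -> L N.+1 (t1 * w) ->
      L N.+1 (t1 * (v + w : T)).
    by move=> *; rewrite mulrDr; apply: submodD.
  have SZ' (c : T) (v : T^o) : L N.+1 (t1 * v) -> L N.+1 (t1 * (c *: v : T)).
    by move=> *; rewrite -[c *: v]/(c * v) mulrCA; apply: ideal_mull.
  apply: (span_ind (P := fun u : T^o => L N.+1 (t1 * (u : T)))) Lt2 => //.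
  move=> _ [i [j [a [b [ij ma mb ->]]]]].
  case: Kt1 => c mc [->|->]; apply: span_gen.
    exists i.+1, j, (c * a), b; rewrite tens_lM mulrA; split=> //.
      by rewrite addSn ij.
    exact: ideal_powSM.
  exists i, j.+1, a, (c * b); rewrite tens_rM mulrCA; split=> //.
    by rewrite addnS ij.
  exact: ideal_powSM.
move=> /KL; apply: span_min => _ [i [j [a [b [ij ma mb ->]]]]].
have [ni|nj] := leqP n i.
  by apply/ideal_mulr/ctens_ideal_l/(ideal_pow_le ni).
apply/ideal_mull/ctens_ideal_r; apply: ideal_pow_le mb.
by rewrite -(leq_add2l i) ij mul2n -addnn leq_add2r ltnW.
Qed.

Hypothesis m1 : ~ m 1.

Definition diag_elt i : T := tens_l (x i) - tens_r (x i).

(** Modulo its square, the ideal m (x) R + R (x) m is generated by the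
    x_i (x) 1 and 1 (x) x_i, so also by the x_i (x) 1 and their differences. *)
Lemma tens_max_gen n t : ideal_pow tens_max n.+1 t ->
  exists u z : 'I_s -> T,
    [/\ forall i, ideal_pow tens_max n (u i), forall i, ideal_pow tens_max n (z i) &
        ideal_pow tens_max n.+2
          (t - (\sum_(i < s) tens_l (x i) * u i + \sum_(i < s) diag_elt i * z i))].
Proof.
pose P (t : T^o) := exists u z : 'I_s -> T,
    [/\ forall i, ideal_pow tens_max n (u i), forall i, ideal_pow tens_max n (z i) &
        ideal_pow tens_max n.+2
          (t - (\sum_(i < s) tens_l (x i) * u i + \sum_(i < s) diag_elt i * z i))].
have sumD (F G H : 'I_s -> T) : \sum_(i < s) F i * (G i + H i) =
    \sum_(i < s) F i * G i + \sum_(i < s) F i * H i.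
  by rewrite -big_split; apply: eq_bigr => i _; apply: mulrDr.
have S0 : P 0.
  exists (fun=> 0), (fun=> 0); split=> [i|i|]; try exact: submod0.
  by rewrite !big1 ?addr0 ?subr0 => [|i _|i _]; rewrite ?mulr0 //; apply: submod0.
have SD (v w : T^o) : P v -> P w -> P (v + w).
  move=> [u [z [uK zK e]]] [u' [z' [uK' zK' e']]].
  exists (fun i => u i + u' i), (fun i => z i + z' i).
  split=> [i|i|]; try exact: submodD.
  rewrite !sumD [X in _ - X]addrACA opprD addrACA.
  exact: submodD e e'.
have SZ (c : T) (v : T^o) : P v -> P (c *: v).
  move=> [u [z [uK zK e]]]; exists (fun i => c * u i), (fun i => c * z i).
  split=> [i|i|]; try exact: ideal_mull.
  have sumC (F G : 'I_s -> T) :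
      \sum_(i < s) F i * (c * G i) = c * \sum_(i < s) F i * G i.
    by rewrite mulr_sumr; apply: eq_bigr => i _; apply: mulrCA.
  rewrite !sumC -mulrDr -[c *: v]/(c * v) -mulrBr.
  exact: ideal_mull.
apply: (span_ind (P := P)) => // _ [c [d [Kc Kd ->]]].
have S0' : P (0 * d) by rewrite mul0r.
have SD' (v w : T^o) : P (v * d) -> P (w * d) -> P ((v + w : T) * d).
  by move=> *; rewrite mulrDl; apply: SD.
have SZ' (b : T) (v : T^o) : P (v * d) -> P ((b *: v : T) * d).
  by move=> *; rewrite -[b *: v]/(b * v) -mulrA; apply: SZ.
apply: (span_ind (P := fun u : T^o => P ((u : T) * d))) Kc => // b [a ma ta].
have [y ay] := max_ideal_gen x_gen m1 ma.
have [al ar] := tens_max_pow ay.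
case: ta => -> {b}.
  exists (fun i => tens_l (y i) * d), (fun=> 0).
  split=> [i|i|]; [exact: ideal_mull|exact: submod0|].
  rewrite [X in _ - (_ + X)]big1 ?addr0 => [|i _]; last exact: mulr0.
  under eq_bigr => i _ do rewrite mulrA -tens_lM.
  rewrite -mulr_suml -mulrBl -tens_l_sum -tens_lN -tens_lD.
  exact: (@ideal_powD _ _ 2).
exists (fun i => tens_r (y i) * d), (fun i => - (tens_r (y i) * d)).
split=> [i|i|]; [exact: ideal_mull|exact/submodN/ideal_mull|].
rewrite -big_split /=.
have -> : tens_r a * d - \sum_(i < s) (tens_l (x i) * (tens_r (y i) * d)
    + diag_elt i * - (tens_r (y i) * d)) = tens_r (a - \sum_(i < s) x i * y i) * d.
  rewrite tens_rD mulrDl; congr (_ + _).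
  rewrite -!sumrN tens_r_sum mulr_suml; apply: eq_bigr => i _.
  have -> : - (x i * y i) = x i * (- y i) by rewrite mulrN.
  have tN : tens_r (- y i) = - tens_r (y i).
    by apply: (addrI (tens_r (y i))); rewrite -tens_rD !subrr tens_r0.
  by rewrite tens_rM tN /diag_elt; ring.
exact: (@ideal_powD _ _ 2).
Qed.

(** One step of the expansion along the diagonal: a tensor of order n is r (x) 1
    plus a combination of the diagonal elements, up to order n + 1.  For n > 0,
    one applies the induction hypothesis to the coefficients of the
    x_i (x) 1. *)
Lemma tens_step n t : ideal_pow tens_max n t ->
  exists (r : R) (z : 'I_s -> T),
    [/\ ideal_pow m n r, forall i, ideal_pow tens_max n.-1 (z i) &
        ideal_pow tens_max n.+1 (t - (tens_l r + \sum_(i < s) diag_elt i * z i))].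
Proof.
elim: n t => [|n IHn] t Kt.
  suff [r rP] : exists r, tens_max (t - tens_l r).
    exists r, (fun=> 0); split=> [|i|]; try exact: ideal_pow0.
    by rewrite [X in _ - (_ + X)]big1 ?addr0 => [|i _]; [apply: ideal_pow1|apply: mulr0].
  elim/tens_ind: t {Kt} => [|t u [a ta] [b ub]|a b].
  - by exists 0; rewrite tens_l0 subrr; apply: submod0.
  - by exists (a + b); rewrite tens_lD opprD addrACA; apply: submodD.
  have [c ac] := max_ideal_const x_gen a; have [d bd] := max_ideal_const x_gen b.
  exists (c%:A * d%:A); rewrite -[pure a b]tens_lr.
  have -> : tens_l a * tens_r b - tens_l (c%:A * d%:A)
    = tens_l a * tens_r (b - d%:A) + tens_l (a - c%:A) * tens_l d%:A.
    rewrite tens_lM tens_rD tens_lD tens_lN.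
    have -> : tens_r (- d%:A) = - tens_l d%:A.
      by rewrite -scaleNr tens_r_const scaleNr tens_lN.
    ring.
  apply: submodD; first exact/ideal_mull/tens_max_r.
  exact/ideal_mulr/tens_max_l.
have [u [z [uK zK e]]] := tens_max_gen Kt.
have ih i := IHn (u i) (uK i).
pose r i := projT1 (cid (ih i)).
pose w i := projT1 (cid (projT2 (cid (ih i)))).
have rwP i : [/\ ideal_pow m n (r i), forall j, ideal_pow tens_max n.-1 (w i j) &
    ideal_pow tens_max n.+1 (u i - (tens_l (r i) + \sum_(j < s) diag_elt j * w i j))].
  exact: projT2 (cid (projT2 (cid (ih i)))).
exists (\sum_(i < s) x i * r i),
  (fun j => z j + \sum_(i < s) tens_l (x i) * w i j); split.
- apply: submod_sum => i _; apply: ideal_powSM; first exact: x_gen.1.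
  by have [] := rwP i.
- move=> j; apply: submodD; first exact: zK.
  apply: submod_sum => i _; apply: (@ideal_pow_le _ _ _ n.-1.+1).
    exact: leqSpred.
  by apply: ideal_powSM; [apply/tens_max_l/x_gen.1|have [] := rwP i].
rewrite -[t](subrK (\sum_(i < s) tens_l (x i) * u i + \sum_(i < s) diag_elt i * z i)).
rewrite -addrA; apply: submodD => //.
have -> : \sum_(i < s) tens_l (x i) * u i + \sum_(i < s) diag_elt i * z i -
   (tens_l (\sum_(i < s) x i * r i)
      + \sum_(j < s) diag_elt j * (z j + \sum_(i < s) tens_l (x i) * w i j))
   = \sum_(i < s) tens_l (x i)
       * (u i - (tens_l (r i) + \sum_(j < s) diag_elt j * w i j)).
  under [X in _ - (_ + X)]eq_bigr => j _ do rewrite mulrDr mulr_sumr.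
  rewrite big_split /= exchange_big /= tens_l_sum.
  under [RHS]eq_bigr => i _ do rewrite mulrBr mulrDr mulr_sumr.
  rewrite sumrB big_split /=.
  under [X in _ - (X + _) = _]eq_bigr => i _ do rewrite tens_lM.
  under [X in _ = _ - (_ + X)]eq_bigr => i _ do
    under eq_bigr => j _ do rewrite mulrCA.
  ring.
apply: submod_sum => i _; apply: ideal_powSM; first exact/tens_max_l/x_gen.1.
by have [] := rwP i.
Qed.

End TensorPowers.

(** * The completed tensor square *)

Section CompletedTensor.
Variables (k : fieldType) (R : comAlgType k) (s : nat) (x : 'I_s -> R).
Local Notation m := (max_ideal R).
Local Notation T := (tens_alg R R).
Local Notation J := (ctens_ideal R).
Implicit Types (X Y : ctens R) (f g : nat -> T).

Definition ctens_seq X : compatible_seq J := repr X.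

(** Elements of the completion are computed with through arbitrary sequences of
    tensors that represent them, because the representatives chosen in the
    quotient are not compatible with the operations. *)
Definition approx X f := forall n, J n (ctens_seq X n - f n).

Lemma approx_repr X : approx X (ctens_seq X).
Proof. by move=> n; rewrite subrr; apply: submod0. Qed.

Lemma approx_class (u : compatible_seq J) : approx (compl_class u) u.
Proof. by move=> n; apply: compl_repr. Qed.

Lemma approx_inj X Y f : approx X f -> approx Y f -> X = Y.
Proof.
move=> Xf Yf; rewrite -(compl_class_repr X) -(compl_class_repr Y).
apply/compl_classP => n; rewrite -[_ - _](subrKA (f n)).
by rewrite -[X in _ + X]opprB; apply: submodB; [apply: Xf|apply: Yf].
Qed.

Lemma approx_trans X f g : approx X f -> (forall n, J n (f n - g n)) -> approx X g.
Proof. by move=> Xf fg n; rewrite -(subrKA (f n)); apply: submodD. Qed.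

Lemma approxD X Y f g : approx X f -> approx Y g ->
  approx (X + Y) (fun n => f n + g n).
Proof.
move=> Xf Yg; have := approx_class (cseq_add (ctens_seq X) (ctens_seq Y)).
move=> /approx_trans; apply=> n /=; rewrite opprD addrACA.
exact: submodD.
Qed.

Lemma approxN X f : approx X f -> approx (- X) (fun n => - f n).
Proof.
move=> Xf; have := approx_class (cseq_opp (ctens_seq X)).
by move=> /approx_trans; apply=> n /=; rewrite -opprD; apply/submodN/Xf.
Qed.

Lemma approxM X Y f g : approx X f -> approx Y g ->
  approx (X * Y) (fun n => f n * g n).
Proof.
move=> Xf Yg; have := approx_class (cseq_mul (ctens_seq X) (ctens_seq Y)).
by move=> /approx_trans; apply=> n /=; apply: ideal_mulB.
Qed.

Definition ctens_const (t : T) : ctens R := compl_const J t.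

Lemma approx_const t : approx (ctens_const t) (fun=> t).
Proof. exact: approx_class. Qed.

Lemma ctens_constD : {morph ctens_const : t u / t + u}.
Proof. exact: compl_constD. Qed.
Lemma ctens_constM : {morph ctens_const : t u / t * u}.
Proof. exact: compl_constM. Qed.
Lemma ctens_const0 : ctens_const 0 = 0.
Proof. by []. Qed.
Lemma ctens_constB : {morph ctens_const : t u / t - u}.
Proof.
move=> t u; apply: (approx_inj (approx_const _)).
exact: approxD (approx_const t) (approxN (approx_const u)).
Qed.
Lemma ctens_constX t n : ctens_const (t ^+ n) = ctens_const t ^+ n.
Proof. by elim: n => // n IHn; rewrite !exprS ctens_constM IHn. Qed.

Lemma approx_sum (I : Type) (r : seq I) (X : I -> ctens R) (f : I -> nat -> T) :
  (forall i, approx (X i) (f i)) ->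
  approx (\sum_(i <- r) X i) (fun n => \sum_(i <- r) f i n).
Proof.
move=> Xf; elim: r => [|i r IHr].
  rewrite big_nil (_ : (fun n => _) = fun=> 0); first exact: (approx_const 0).
  by apply/funext => n; rewrite big_nil.
rewrite big_cons (_ : (fun n => _) = fun n => f i n + \sum_(j <- r) f j n).
  exact: approxD.
by apply/funext => n; rewrite big_cons.
Qed.

Hypotheses (R_complete : adically_complete m) (x_gen : power_series_generators x).
Hypothesis m1 : ~ m 1.
Local Notation K := (tens_max R).

Lemma ctens_seq_tail X n d : J n (ctens_seq X (d + n)%N - ctens_seq X n).
Proof.
elim: d => [|d IHd]; first by rewrite subrr; apply: submod0.
rewrite -(subrKA (ctens_seq X (d + n)%N)); apply: submodD => //.
apply: (ctens_ideal_le (leq_addl d n)); exact: cseqP.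
Qed.

(** The partial sums up to 2n are those that stabilize modulo the n-th ideal of
    the completion, by [tens_max_pow_sub]. *)
Lemma tens_max_series (z : nat -> T) : (forall n, ideal_pow K n.-1 (z n)) ->
  exists Z : ctens R, approx Z (fun n => \sum_(l < (2 * n).+1) z l).
Proof.
move=> zK.
have zP n : J n (\sum_(l < (2 * n.+1).+1) z l - \sum_(l < (2 * n).+1) z l).
  have -> : \sum_(l < (2 * n.+1).+1) z l - \sum_(l < (2 * n).+1) z l
      = z (2 * n).+1 + z (2 * n).+2.
    by rewrite mulnS !add2n !big_ord_recr /=; ring.
  apply: tens_max_pow_sub; apply: submodD; first exact: (zK (2 * n).+1).
  by apply: ideal_pow_le (zK (2 * n).+2); rewrite /= leqnSn.
by exists (compl_class (CompatibleSeq zP)); apply: approx_class.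
Qed.

(** The steps [tens_step] are iterated on an approximating sequence F of X.  The
    terms r sum up in R by completeness, and the coefficients of the diagonal
    elements sum up in the completed tensor product. *)
Lemma ctens_step X : exists (r : R) (Z : 'I_s -> ctens R),
  X = ctens_const (tens_l r) + \sum_(i < s) ctens_const (diag_elt x i) * Z i.
Proof.
have step n t : exists rz : R * ('I_s -> T), ideal_pow K n t ->
    [/\ ideal_pow m n rz.1, forall i, ideal_pow K n.-1 (rz.2 i) &
        ideal_pow K n.+1 (t - (tens_l rz.1 + \sum_(i < s) diag_elt x i * rz.2 i))].
  have [Kt|nKt] := pselect (ideal_pow K n t); last by exists (0, fun=> 0).
  by have [r [z rz]] := tens_step x_gen m1 Kt; exists (r, z).
pose rr n t := (projT1 (cid (step n t))).1.
pose zz n t := (projT1 (cid (step n t))).2.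
have rzP n t : ideal_pow K n t ->
    [/\ ideal_pow m n (rr n t), forall i, ideal_pow K n.-1 (zz n t i) &
        ideal_pow K n.+1 (t - (tens_l (rr n t) + \sum_(i < s) diag_elt x i * zz n t i))].
  exact: projT2 (cid (step n t)).
pose F n := ctens_seq X n.
(* The remainder after n steps; the index of F is shifted so that the error
   F n.+2 - F n.+1 has order n.+1. *)
pose fix e n : T := if n is n'.+1 then
   e n' - (tens_l (rr n' (e n')) + \sum_(i < s) diag_elt x i * zz n' (e n') i)
     + (F n'.+2 - F n'.+1) else F 1%N.
have eK n : ideal_pow K n (e n).
  elim: n => [|n IHn]; first exact: ideal_pow0.
  apply: submodD; first by have [] := rzP _ _ IHn.
  exact/ctens_ideal_sub/cseqP.
pose r n := rr n (e n); pose z n := zz n (e n).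
have rP n : ideal_pow m n (r n) by have [] := rzP _ _ (eK n).
have zP n i : ideal_pow K n.-1 (z n i) by have [_ zK _] := rzP _ _ (eK n); apply: zK.
have eE n : F n.+1 = tens_l (\sum_(l < n) r l)
    + \sum_(i < s) diag_elt x i * (\sum_(l < n) z l i) + e n.
  elim: n => [|n IHn].
    rewrite big_ord0 tens_l0 big1 ?add0r // => i _.
    by rewrite big_ord0 mulr0.
  have -> : e n.+1 = e n - (tens_l (r n) + \sum_(i < s) diag_elt x i * z n i)
    + (F n.+2 - F n.+1) by [].
  have -> : \sum_(i < s) diag_elt x i * (\sum_(l < n.+1) z l i) =
      \sum_(i < s) diag_elt x i * (\sum_(l < n) z l i)
      + \sum_(i < s) diag_elt x i * z n i.
    rewrite -big_split; apply: eq_bigr => i _ /=.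
    by rewrite big_ord_recr mulrDr.
  rewrite big_ord_recr tens_lD IHn /=; ring.
have [rl rlP] : exists l, forall n, ideal_pow m n (l - \sum_(i < n) r i).
  apply: (R_complete.2 (fun n => \sum_(i < n) r i)) => n.
  rewrite big_ord_recr addrAC subrr add0r.
  exact: rP.
have Zex i := tens_max_series (fun n => zP n i).
exists rl, (fun i => projT1 (cid (Zex i))).
apply: (@approx_inj _ _ F); first exact: approx_repr.
have app := approxD (approx_const (tens_l rl)) (approx_sum (index_enum 'I_s)
   (fun i => approxM (approx_const (diag_elt x i)) (projT2 (cid (Zex i))))).
apply: (approx_trans app) => n.
rewrite -(subrKA (F (2 * n).+2)).
apply: submodD; last first.
  by rewrite mul2n -addnn -!addSn; apply: ctens_seq_tail.
rewrite (eE (2 * n).+1).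
set S := \sum_(i < s) _.
have -> : tens_l rl + S - (tens_l (\sum_(l < (2 * n).+1) r l) + S + e (2 * n).+1)
  = tens_l (rl - \sum_(l < (2 * n).+1) r l) - e (2 * n).+1.
  by rewrite tens_lD tens_lN; ring.
have n2 : (n <= (2 * n).+1)%N by rewrite leqW // leq_pmull.
apply: submodB; first by apply/ctens_ideal_l/(ideal_pow_le n2)/rlP.
by apply: tens_max_pow_sub; apply: ideal_pow_le (eK _); rewrite leqnSn.
Qed.

Local Notation I := (diag_ideal x).

Lemma diag_ideal_gen i : I (ctens_const (diag_elt x i)).
Proof. by apply: span_gen; exists i; rewrite ctens_constB. Qed.

(** By induction on n, the coefficients in [ctens_step] are themselves finite
    sums of pure tensors modulo a power of the diagonal ideal. *)
Lemma ctens_gen n X : exists t : T, ideal_pow I n (X - ctens_const t).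
Proof.
elim: n X => [|n IHn] X; first by exists 0; apply: ideal_pow0.
have [r [Z ->]] := ctens_step X.
pose t i := projT1 (cid (IHn (Z i))).
exists (tens_l r + \sum_(i < s) diag_elt x i * t i).
have -> : ctens_const (tens_l r + \sum_(i < s) diag_elt x i * t i) =
    ctens_const (tens_l r) + \sum_(i < s) ctens_const (diag_elt x i) * ctens_const (t i).
  rewrite ctens_constD (big_morph _ ctens_constD ctens_const0).
  by congr (_ + _); apply: eq_bigr => i _; rewrite ctens_constM.
rewrite opprD addrACA subrr add0r -sumrB.
apply: submod_sum => i _; rewrite -mulrBr.
apply: ideal_powSM; first exact: diag_ideal_gen.
exact: projT2 (cid (IHn (Z i))).
Qed.

End CompletedTensor.

(** * Branches: conductor and Frobenius basis *)

Section Branch.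
Variables (k : closedFieldType) (R : comAlgType k).
Variables (iota : {lrmorphism R -> powser k}) (iota_inj : injective iota).
Hypothesis R_complete : adically_complete (max_ideal R).
Local Notation m := (max_ideal R).

Let iotaZ (c : k) (a : R) : iota (c *: a) = c *: iota a.
Proof. exact: linearZ. Qed.

(** Completeness makes the geometric series in b converge. *)
Lemma geometric_inverse (b : R) : m b -> exists c, (1 - b) * c = 1.
Proof.
move=> mb; have [|c cP] := R_complete.2 (fun n => \sum_(i < n) b ^+ i).
  by move=> n; rewrite big_ord_recr addrAC subrr add0r; apply: ideal_pow_exp.
exists c; apply/eqP; rewrite -subr_eq0; apply/eqP/R_complete.1 => n.
have -> : (1 - b) * c - 1 =
    (1 - b) * (c - \sum_(i < n) b ^+ i) - b ^+ n.
  have := subrX1 b n => e.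
  have -> : b ^+ n = 1 + (b - 1) * (\sum_(i < n) b ^+ i) by rewrite -e addrC subrK.
  ring.
by apply: submodB; [apply: ideal_mull|apply: ideal_pow_exp].
Qed.

(** Up to a constant, a is 1 - b where b is not a unit in S, let alone in R. *)
Lemma branch_unit (a : R) : iota a 0 != 0 -> exists b, a * b = 1.
Proof.
move=> a0; pose c : k := (iota a 0)^-1.
have [|d dP] := @geometric_inverse (1 - c *: a).
  apply: span_gen => -[b /(congr1 (fun u => iota u 0))].
  rewrite rmorphM rmorph1 rmorphB rmorph1 /= iotaZ powserME big_ord1 /=.
  by rewrite !powserE /c mulVf // subrr mul0r => /esym/eqP; rewrite oner_eq0.
exists (c *: d); rewrite -dP; by rewrite opprB addrCA subrr addr0 -scalerAl scalerAr.
Qed.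

Lemma max_ideal_ordge n (a : R) : ideal_pow m n a -> ordge n (iota a).
Proof.
have m_ord b : m b -> ordge 1 (iota b).
  apply: (span_ind (P := fun b : R^o => ordge 1 (iota b))) => [|u v|c u|u].
  - by rewrite rmorph0; apply: ordge0.
  - by rewrite rmorphD; apply: ordgeD.
  - by rewrite rmorphM; apply: ordgeMl.
  - by move=> nu [|//] _; apply: contrapT => /eqP/branch_unit.
elim: n a => [|n IHn] a; first by move=> _ i; rewrite ltn0.
apply: (span_ind (P := fun b : R^o => ordge n.+1 (iota b)))
  => [|u v|c u|_ [u [v [mu mv ->]]]].
- by rewrite rmorph0; apply: ordge0.
- by rewrite rmorphD; apply: ordgeD.
- by rewrite rmorphM; apply: ordgeMl.
- by rewrite rmorphM -add1n; apply: ordgeM; [apply: m_ord|apply: IHn].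
Qed.

Lemma max_ideal_proper : ~ m 1.
Proof.
move=> /ideal_pow1/max_ideal_ordge/(_ 0%N isT)/eqP.
by rewrite rmorph1 powser1E oner_eq0.
Qed.

(** Finitely many fractions over R generate S; the product d of their
    denominators satisfies d S <= R, and d is a power of t up to a unit of S. *)
Lemma conductor : module_finite iota -> is_normalization iota ->
  exists c, forall f, ordge c f -> exists a, iota a = f.
Proof.
move=> [n [gen genP]] [K [g [_ g_inj frac _]]].
have bP i : exists ab : R * R, ab.2 != 0 /\ gen i * iota ab.2 = iota ab.1.
  have [a [b [b0 e]]] := frac (g (gen i)); exists (a, b); split=> //=.
  apply/g_inj; rewrite rmorphM e divfK //.
  apply: contra b0 => /eqP gb; apply/eqP/iota_inj/g_inj.
  by rewrite gb !rmorph0.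
pose a i := (projT1 (cid (bP i))).1; pose b i := (projT1 (cid (bP i))).2.
have b0 i : b i != 0 := (projT2 (cid (bP i))).1.
have genb i : gen i * iota (b i) = iota (a i) := (projT2 (cid (bP i))).2.
have d0 : iota (\prod_i b i) != 0.
  apply/eqP => d0; have : g (iota (\prod_i b i)) == 0 by rewrite d0 rmorph0.
  rewrite !rmorph_prod prodf_seq_eq0 => /hasP[i _ /=] /eqP gb.
  by case/eqP: (b0 i); apply/iota_inj/g_inj; rewrite gb !rmorph0.
have [c [h dh]] := powser_associate d0.
exists c => f /ordge_shift ->; rewrite -dh -mulrA.
have [u ->] := genP (h * ps_shift c f).
exists (\sum_i u i * (a i * \prod_(j | j != i) b j)).
rewrite rmorph_sum mulr_sumr; apply: eq_bigr => i _.
rewrite [\prod_i b i](bigD1 i) //= !rmorphM /= -genb.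
ring.
Qed.

Variables (p e : nat) (hp : p \in [pchar k]).
Local Notation q := (p ^ e)%N.
Hypothesis cond : forall f, ordge q f -> exists a, iota a = f.

Definition jet (f : powser k) : 'rV[k]_q := \row_i f i.

Definition jet_poly (u : 'rV[k]_q) : powser k := \sum_i u 0 i *: psX k ^+ i.

Lemma jet_polyE u (n : nat) (nq : (n < q)%N) : jet_poly u n = u 0 (Ordinal nq).
Proof.
rewrite /jet_poly powser_sumE (bigD1 (Ordinal nq)) //= powserZE psXnE eqxx mulr1.
rewrite big1 ?addr0 // => i /negPf ni; rewrite powserZE psXnE.
by rewrite [n == i]eq_sym [_ == n]ni mulr0.
Qed.

Lemma jet_poly_branch (a : R) : exists b, iota b = jet_poly (jet (iota a)).
Proof.
have [|b eb] := cond (f := jet_poly (jet (iota a)) - iota a).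
  by move=> n nq; rewrite powserBE jet_polyE mxE subrr.
by exists (b + a); rewrite rmorphD /= eb subrK.
Qed.

(** A matrix of maximal rank among those whose rows are jets of elements of R. *)
Lemma branch_jets : exists A : 'M[k]_q,
  forall u : 'rV_q, (u <= A)%MS <-> exists a, u = jet (iota a).
Proof.
pose P r := `[< exists A : 'M[k]_q, \rank A = r /\
   forall i, exists a, row i A = jet (iota a) >].
have jetD a c b : jet (iota (a + c *: b)) = jet (iota a) + c *: jet (iota b).
  by apply/rowP => i; rewrite !mxE rmorphD /= iotaZ.
have jet0 : jet (iota 0) = 0 by apply/rowP => i; rewrite !mxE rmorph0.
have P0 : exists r, P r.
  exists 0%N; apply/asboolP; exists 0; split; first exact: mxrank0.
  by move=> i; exists 0; rewrite row0 jet0.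
have Pq r : P r -> (r <= q)%N by move=> /asboolP[A [<- _]]; apply: rank_leq_row.
case: (ex_maxnP P0 Pq) => r /asboolP[A [rA AR]] rmax.
have sub : forall u : 'rV_q, (u <= A)%MS -> exists b, u = jet (iota b).
  move=> u /submxP[D ->]; exists (\sum_i D 0 i *: projT1 (cid (AR i))).
  rewrite mulmx_sum_row.
  transitivity (\sum_i D 0 i *: jet (iota (projT1 (cid (AR i))))).
    by apply: eq_bigr => i _; congr (_ *: _); apply: projT2 (cid (AR i)).
  apply/rowP => j; rewrite summxE mxE linear_sum /= powser_sumE.
  by apply: eq_bigr => i _; rewrite !mxE iotaZ.
exists A => u; split=> [/sub//|[a ->]]; apply: contrapT => naA.
pose B := (A + jet (iota a))%MS.
have : (\rank B <= r)%N.
  apply: rmax; apply/asboolP; exists B; split=> // i.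
  have : (row i B <= A + jet (iota a))%MS by apply: row_sub.
  case/sub_addsmxP => -[w v] /= ->.
  have [b ->] := sub (w *m A) (submxMl _ _).
  exists (b + v 0 0 *: a); rewrite jetD; congr (_ + _).
  by rewrite [v]mx11_scalar mul_scalar_mx !mxE.
rewrite -rA leqNgt => /negP; apply; apply: rank_ltmx.
rewrite /ltmx addsmxSl; apply/negP => BA; apply: naA.
exact: submx_trans (addsmxSr _ _) BA.
Qed.

(** The rows of B form a basis of the space of jets; the first ones, as many as
    the rank of A, span the jets of elements of R.  The corresponding polynomials
    form a basis of S over S^q.  The factor eps_j is 1 for these first rows and t
    for the others.  An element of R has, along the other rows,
    coordinates whose constant terms vanish, so they are divisible by t^q. *)
Lemma branch_frobenius_basis :
  exists (B : 'M[k]_q) (eps : 'I_q -> powser k),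
    [/\ B \in unitmx, forall j, eps j != 0,
        forall j, exists a, iota a = eps j ^+ q * jet_poly (row j B) &
        forall a, exists g : 'I_q -> powser k,
          iota a = \sum_j g j ^+ q * (eps j ^+ q * jet_poly (row j B))].
Proof.
have [A AR] := branch_jets.
pose r := \rank A; pose B := row_ebase A.
pose eps (j : 'I_q) : powser k := if (j < r)%N then 1 else psX k.
have q0 : (0 < q)%N by exact: pexp_gt0 hp.
have X0 : psX k != 0.
  apply/eqP => /(congr1 (fun f => f 1%N)) /eqP; rewrite powser0E.
  by rewrite -[psX k]expr1 psXnE oner_eq0.
have Bu : B \in unitmx by exact: row_ebase_unit.
have cokerE (u : 'rV_q) j : (u *m cokermx A) 0 j =
    if (j < r)%N then 0 else (u *m invmx B) 0 j.
  rewrite /cokermx mulmxA -/B [LHS]mxE (bigD1 j) //= big1 => [|i ij].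
    rewrite addr0 [copid_mx _ _ _]mxE [(1%:M : 'M_q) _ _]mxE.
    rewrite [(- _ : 'M_q) _ _]mxE [pid_mx _ _ _]mxE !eqxx -/r andTb.
    by case: ifP; rewrite ?subrr ?subr0 ?mulr0 ?mulr1.
  rewrite [copid_mx _ _ _]mxE [(1%:M : 'M_q) _ _]mxE [(- _ : 'M_q) _ _]mxE.
  by rewrite [pid_mx _ _ _]mxE -[(i == j :> nat)]/(i == j) (negPf ij) subrr mulr0.
exists B, eps; split=> // [j|j|a].
- by rewrite /eps; case: ifP => _; rewrite ?oner_eq0.
- rewrite /eps; case: ltnP => [jr|_]; last by apply: cond; apply: ordge_XnM.
  have /AR[a ->] : (row j B <= A)%MS.
    rewrite submxE; apply/eqP/rowP => l; rewrite cokerE [RHS]mxE; case: ltnP => // rl.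
    rewrite -row_mul mulmxV // !mxE; case: eqP => // jl.
    by rewrite jl ltnNge rl in jr.
  by rewrite expr1n mul1r; apply: jet_poly_branch.
pose f := iota a.
(* The coordinates of f in the basis of S over S^q given by the rows of B: those
   in the basis 1, t, .., t^(q-1), multiplied by the inverse of B. *)
pose c j : powser k := fun n =>
  if (q %| n)%N then \sum_(i < q) f (n + i)%N * invmx B i j else 0.
have cq j n : ~~ (q %| n)%N -> c j n = 0 by rewrite /c => /negPf ->.
pose gam j := projT1 (cid (powser_pexp_root hp (cq j))).
have gamP j : c j = gam j ^+ q := projT2 (cid (powser_pexp_root hp (cq j))).
have fc : f = \sum_j c j * jet_poly (row j B).
  apply/powserP => n; pose i0 := Ordinal (ltn_pmod n q0).
  have coefc j u : (c j * jet_poly u) n = c j (n - n %% q)%N * u 0 i0.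
    rewrite /jet_poly mulr_sumr powser_sumE (bigD1 i0) //= big1 ?addr0 => [|i ni].
      rewrite -scalerAr powserZE mulrC mulrC [c j * _]mulrC psXnME.
      by rewrite ltnNge leq_mod mulrC.
    rewrite -scalerAr powserZE [c j * _]mulrC psXnME; case: ltnP => [_|le_in].
      by rewrite mulr0.
    rewrite cq ?mulr0 //; apply: contra ni => qni; apply/eqP/val_inj => /=.
    rewrite -(subnK le_in) -modnDml (eqP qni) add0n modn_small //.
  rewrite powser_sumE; under eq_bigr => j _ do rewrite coefc.
  have qn : (q %| n - n %% q)%N by rewrite {1}(divn_eq n q) addnK dvdn_mull.
  under eq_bigr => j _ do rewrite /c qn mulr_suml.
  rewrite exchange_big /= (bigD1 i0) //= [X in _ + X]big1 ?addr0 => [|i ni].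
    under eq_bigr => j _ do rewrite -mulrA mxE.
    rewrite -mulr_sumr subnK ?leq_mod //.
    have := congr1 (fun M : 'M_q => M i0 i0) (mulVmx Bu).
    by rewrite !mxE eqxx => ->; rewrite mulr1.
  under eq_bigr => j _ do rewrite -mulrA mxE.
  rewrite -mulr_sumr.
  have := congr1 (fun M : 'M_q => M i i0) (mulVmx Bu).
  by rewrite !mxE (negPf ni) => ->; rewrite mulr0.
have gamX (j : 'I_q) : (r <= j)%N -> gam j = psX k * ps_shift 1 (gam j).
  move=> rj; rewrite -[psX k]expr1; apply: ordge_shift => -[|//] _.
  have : (gam j ^+ q) 0%N = 0.
    rewrite -gamP /c dvdn0.
    have : (jet f <= A)%MS by apply/AR; exists a.
    rewrite submxE => /eqP/rowP/(_ j).
    rewrite cokerE ltnNge rj [RHS]mxE mxE => e0; rewrite -[RHS]e0.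
    by apply: eq_bigr => i _; rewrite mxE.
  rewrite (powser_pexpE _ hp) dvdn0 div0n => /eqP.
  by rewrite expf_eq0 => /andP[_ /eqP].
exists (fun j : 'I_q => if (j < r)%N then gam j else ps_shift 1 (gam j)).
rewrite -/f {1}fc; apply: eq_bigr => j _; rewrite mulrA -exprMn gamP.
congr (_ ^+ _ * _); rewrite /eps; case: ltnP => [_|/gamX {1}->].
  by rewrite mulr1.
exact: mulrC.
Qed.

End Branch.

(** * Power series in two variables modulo the diagonal *)

Section TwoVariables.
Variable k : fieldType.
Local Notation S := (powser k).
Local Notation S2 := (powser S).

(** The series f(u), in k[[t]][[u]] where the inner variable is t. *)
Definition in_u (f : S) : S2 := fun n => (f n)%:A.

Lemma in_uD : {morph in_u : f g / f + g}.
Proof. by move=> f g; apply/powserP => n; rewrite /in_u !powserDE scalerDl. Qed.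

Lemma in_uZ c f : in_u (c *: f) = c%:A *: in_u f.
Proof.
apply/powserP => n; rewrite /in_u powserZE [RHS]powserZE.
by rewrite -[RHS]scalerAl mul1r scalerA.
Qed.

Lemma in_uM : {morph in_u : f g / f * g}.
Proof.
move=> f g; apply/powserP => n; rewrite /in_u [RHS]powserME powserME scaler_suml.
by apply: eq_bigr => i _; rewrite -scalerAl mul1r scalerA.
Qed.

Lemma in_u1 : in_u 1 = 1.
Proof.
by apply/powserP => n; rewrite /in_u !powser1E; case: eqP => _; rewrite ?scale1r ?scale0r.
Qed.

Lemma in_uX f n : in_u (f ^+ n) = in_u f ^+ n.
Proof. by elim: n => [|n IHn]; rewrite ?in_u1 // !exprS in_uM IHn. Qed.

(** u - t, the equation of the diagonal. *)
Definition diag_eq : S2 := psX S - (psX k)%:A.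

(** The quotient of f(u) - f(t) by u - t is the sum of the f_(i+j+1) u^i t^j. *)
Lemma in_u_sub (f : S) : exists H, in_u f - f%:A = diag_eq * H.
Proof.
pose H : S2 := fun i => ps_shift i.+1 f.
exists H; apply/powserP => i; apply/powserP => n.
rewrite /diag_eq mulrBl -scalerAl mul1r !powserBE.
rewrite (powserZE (psX k) H i) (psXME H i) (psXME (H i) n) /in_u.
rewrite !powserZE powser1E /H /ps_shift.
case: i => [|i]; case: n => [|n] //=; rewrite ?mulr1 ?mulr0 ?powser0E ?powser1E ?subrr //=.
all: rewrite ?mulr1 ?mulr0 ?mulr1n ?mulr0n ?subr0 ?sub0r ?add0r ?addn0 ?addn1 //.
by rewrite addSnnS subrr.
Qed.

(** The ideal (u^n, t^n). *)
Definition small n (F : S2) := forall i l, (i < n)%N -> (l < n)%N -> F i l = 0.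

Lemma small0 n : small n 0. Proof. by []. Qed.
Lemma smallD n F G : small n F -> small n G -> small n (F + G).
Proof. by move=> Fn Gn i l lin lln; rewrite !powserDE Fn ?Gn ?addr0. Qed.
Lemma smallN n F : small n F -> small n (- F).
Proof. by move=> Fn i l lin lln; rewrite !powserNE Fn ?oppr0. Qed.
Lemma smallM n F G : small n F -> small n (F * G).
Proof.
move=> Fn i l lin lln; rewrite powserME powser_sumE big1 // => a _.
rewrite powserME big1 // => b _; rewrite Fn ?mul0r //.
  exact: leq_ltn_trans (leq_ord a) lin.
exact: leq_ltn_trans (leq_ord b) lln.
Qed.

(** If F is a polynomial in u of degree < q that is a multiple of u^q - t^q up to
    an arbitrarily small error, then comparing coefficients pushes those of the
    quotient H from the degree (j, l) in (u, t) to (j + q, l - q), which cannot be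
    repeated forever: the low coefficients of H vanish, and so does F. *)
Lemma small_diag_pow q (F : S2) : (0 < q)%N ->
  (forall i, (q <= i)%N -> F i = 0) ->
  (forall n, exists H, small n (F - (psX S ^+ q - (psX k ^+ q)%:A) * H)) ->
  F = 0.
Proof.
move=> q0 Fq FH; apply/powserP => i; have [qi|iq] := leqP q i; first exact: Fq.
apply/powserP => l.
have [H FHn] := FH (i + l + q).+1.
have coef j l' : (j + l' < (i + l + q).+1)%N ->
  F j l' = (if (j < q)%N then 0 else H (j - q)%N l')
           - (if (l' < q)%N then 0 else H j (l' - q)%N).
  move=> jl; have := FHn j l'.
  rewrite mulrBl -scalerAl mul1r !powserBE (psXnME q H j).
  rewrite (powserZE (psX k ^+ q) H j) (psXnME q (H j) l') => e.
  have {e} := e (leq_ltn_trans (leq_addr _ _) jl) (leq_ltn_trans (leq_addl _ _) jl).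
  by move/eqP; rewrite subr_eq0 => /eqP ->; case: ltnP.
have H0 l' : forall j, (j + l' <= i + l)%N -> H j l' = 0.
  have [N] := ubnP l'; elim: N l' => // N IHN l' lN j jl.
  have := coef (j + q)%N l'; rewrite addnAC ltnS leq_add2r jl => /(_ isT).
  rewrite Fq ?leq_addl // powser0E ltnNge leq_addl /= addnK.
  case: ltnP => [_|ql]; first by rewrite subr0.
  have -> : H (j + q)%N (l' - q)%N = 0.
    apply: IHN; last by rewrite -addnA subnKC.
    by rewrite ltnS in lN; apply: leq_trans lN; rewrite ltn_subrL q0 (leq_trans q0).
  by rewrite subr0.
rewrite coef ?ltnS ?leq_addr // iq sub0r.
case: ltnP => [|ql]; first by rewrite oppr0.
by rewrite H0 ?oppr0 // leq_add2l leq_subr.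
Qed.

End TwoVariables.

Section TwoVariableRealization.
Variables (k : closedFieldType) (R : comAlgType k).
Variables (iota : {lrmorphism R -> powser k}) (iota_inj : injective iota).
Hypothesis R_complete : adically_complete (max_ideal R).
Local Notation S := (powser k).
Local Notation S2 := (powser S).
Local Notation T := (tens_alg R R).
Local Notation J := (ctens_ideal R).

Let phi (a b : R) : S2 := iota a *: in_u (iota b).

Fact phi_bal : balanced phi.
Proof.
split=> [b a a'|a b b'|c a b]; rewrite /phi.
- by rewrite rmorphD scalerDl.
- by rewrite rmorphD in_uD scalerDr.
- by rewrite !linearZ /= in_uZ scalerA -scalerAr mulr1.
Qed.

(** The ring morphism that sends a (x) b to a(t) b(u). *)
Definition realize : T -> S2 := tens_lift phi.

Lemma realizeD : {morph realize : t u / t + u}.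
Proof. exact/tens_liftD/phi_bal. Qed.
Lemma realize0 : realize 0 = 0.
Proof. exact/tens_lift0/phi_bal. Qed.
Lemma realize_pure a b : realize (tens_pure a b) = iota a *: in_u (iota b).
Proof. exact: (tens_lift_pure phi_bal). Qed.
Lemma realizeN t : realize (- t) = - realize t.
Proof. by apply: (addrI (realize t)); rewrite -realizeD !subrr realize0. Qed.

Lemma realizeM : {morph realize : t u / t * u}.
Proof.
move=> t u; elim/tens_ind: t => [|t t' et et'|a b].
- by rewrite mul0r realize0 mul0r.
- by rewrite (mulrDl (t : T)) !realizeD mulrDl et et'.
elim/tens_ind: u => [|u u' eu eu'|a' b'].
- by rewrite mulr0 realize0 mulr0.
- by rewrite (mulrDr _ (u : T)) !realizeD mulrDr eu eu'.
rewrite [X in realize X]tens_pureM !realize_pure !rmorphM in_uM.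
by rewrite -scalerAl -scalerAr scalerA.
Qed.

Lemma realize_small n t : J n t -> small n (realize t).
Proof.
apply: (span_ind (P := fun t : T^o => small n (realize t)))
  => [|u v|c u|_ [a ma [->|->]]].
- by rewrite realize0; apply: small0.
- by move=> su sv; rewrite realizeD; apply: smallD.
- by move=> su; rewrite realizeM mulrC; apply: smallM.
- move=> i l lin lln; rewrite realize_pure rmorph1 in_u1 powserZE powserME big1 // => j _.
  rewrite (max_ideal_ordge iota R_complete ma) ?mul0r //.
  exact: leq_ltn_trans (leq_ord j) lln.
- move=> i l lin lln; rewrite realize_pure rmorph1 scale1r /in_u.
  by rewrite (max_ideal_ordge iota R_complete ma) // scale0r.
Qed.

Variables (s : nat) (x : 'I_s -> R).

(** Membership in the closure of the ideal generated by (u - t)^N, tested on an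
    approximating sequence: the map realize is not extended to the
    completion. *)
Definition diag_cong (N : nat) (X : ctens R) :=
  forall n, exists H, small n (realize (ctens_seq X n) - diag_eq k ^+ N * H).

Lemma approx_small X f n : approx X f ->
  small n (realize (ctens_seq X n) - realize (f n)).
Proof. by move=> Xf; rewrite -realizeN -realizeD; apply/realize_small/Xf. Qed.

Lemma approx_diag_cong N X f : approx X f ->
  (forall n, exists H, small n (realize (f n) - diag_eq k ^+ N * H)) <-> diag_cong N X.
Proof.
move=> Xf; split=> c n; have [H Hn] := c n; exists H.
  by rewrite -(subrKA (realize (f n))); apply: smallD => //; apply: approx_small.
rewrite -(subrKA (realize (ctens_seq X n))); apply: smallD => //.
by rewrite -opprB; apply/smallN/approx_small.
Qed.

Lemma diag_cong_ideal N : exists I : ideal (ctens R), forall X, I X <-> diag_cong N X.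
Proof.
have S0 : diag_cong N 0.
  apply/(approx_diag_cong N (approx_const 0)) => n.
  by exists 0; rewrite realize0 mulr0 subrr; apply: small0.
have SD (X Y : (ctens R)^o) : diag_cong N X -> diag_cong N Y -> diag_cong N (X + Y).
  move=> cX cY; apply/(approx_diag_cong N
    (approxD (@approx_repr _ _ X) (@approx_repr _ _ Y))) => n.
  have [H Hn] := cX n; have [H' Hn'] := cY n; exists (H + H').
  by rewrite realizeD mulrDr opprD addrACA; apply: smallD.
have SZ (X : ctens R) (Y : (ctens R)^o) : diag_cong N Y -> diag_cong N (X *: Y).
  move=> cY; apply/(approx_diag_cong N
    (approxM (@approx_repr _ _ X) (@approx_repr _ _ Y))) => n.
  have [H Hn] := cY n; exists (realize (ctens_seq X n) * H).
  by rewrite realizeM mulrCA -mulrBr mulrC; apply: smallM.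
by exists (Submodule (V := (ctens R)^o) S0 SD SZ).
Qed.

Lemma diag_congM N M X Y : diag_cong N X -> diag_cong M Y -> diag_cong (N + M) (X * Y).
Proof.
move=> cX cY; apply/(approx_diag_cong _
    (approxM (@approx_repr _ _ X) (@approx_repr _ _ Y))) => n.
have [H Hn] := cX n; have [H' Hn'] := cY n; exists (H * H').
rewrite realizeM exprD mulrACA.
set A := realize _ in Hn *; set B := realize _ in Hn' *.
set C := _ ^+ N * H in Hn *; set D := _ ^+ M * H' in Hn' *.
have -> : A * B - C * D = (A - C) * B + (B - D) * C by ring.
by apply: smallD; apply: smallM.
Qed.

Lemma diag_pow_cong N X : ideal_pow (diag_ideal x) N X -> diag_cong N X.
Proof.
have diag1 Y : diag_ideal x Y -> diag_cong 1 Y.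
  have [I IP] := diag_cong_ideal 1; move=> IY; apply/IP; move: Y IY.
  apply: span_min => _ [i ->]; rewrite -[_ - _]ctens_constB.
  apply/IP/(approx_diag_cong 1 (approx_const _)) => n.
  have [H e] := in_u_sub (iota (x i)); exists (- H).
  rewrite realizeD realizeN !realize_pure rmorph1 in_u1 scale1r.
  by rewrite -[X in X - _]opprB e expr1 mulrN subrr; apply: small0.
elim: N X => [|N IHN] X.
  move=> _ n; exists (realize (ctens_seq X n)).
  by rewrite expr0 mul1r subrr; apply: small0.
have [I IP] := diag_cong_ideal N.+1; move=> IX; apply/IP; move: X IX.
apply: ideal_powS_min => Y Z IY IZ; apply/IP; rewrite -add1n.
by apply: diag_congM; [apply: diag1|apply: IHN].
Qed.

Variables (p e : nat) (hp : p \in [pchar k]).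
Local Notation q := (p ^ e)%N.

(** In the image in k[[t]][[u]], the factors eps_j(u)^q may be replaced by
    eps_j(t)^q, since their difference is the q-th power of a multiple of u - t.
    The result is a polynomial in u of degree < q, to which [small_diag_pow]
    applies; its coefficients are combinations of the a_j(t) eps_j(t)^q with
    coefficient matrix B, which is invertible. *)
Lemma diag_pow_indep (B : 'M[k]_q) (eps : 'I_q -> S) (w : 'I_q -> R)
    (a : 'I_q -> R) :
  B \in unitmx ->
  (forall j, iota (w j) = eps j ^+ q * jet_poly (row j B)) ->
  ideal_pow (diag_ideal x) q
    (ctens_const (\sum_j tens_pure (a j) (w j))) ->
  forall j, iota (a j) * eps j ^+ q = 0.
Proof.
move=> Bu wE /diag_pow_cong/(approx_diag_cong _ (approx_const _)) cong.
have q0 := pexp_gt0 e hp.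
have pS2 : p%:R = 0 :> S2 by apply: pcharf0; do 2!apply: powser_pchar.
pose F : S2 := \sum_j (iota (a j) * eps j ^+ q) *: in_u (jet_poly (row j B)).
have FE i : F i = \sum_j ((jet_poly (row j B)) i *: (iota (a j) * eps j ^+ q)).
  rewrite /F powser_sumE; apply: eq_bigr => j _.
  by rewrite powserZE /in_u -scalerAr mulr1.
have F0 : F = 0.
  apply: (small_diag_pow q0) => [i qi|n].
    rewrite FE big1 // => j _; rewrite /jet_poly powser_sumE big1 ?scale0r // => l _.
    rewrite powserZE psXnE gtn_eqF ?mulr0 //.
    exact: leq_trans (ltn_ord l) qi.
  have [H Hn] := cong n.
  have epsE j := in_u_sub (eps j).
  pose G j := projT1 (cid (epsE j)).
  have GP j : in_u (eps j) = (eps j)%:A + diag_eq k * G j.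
    by rewrite -(projT2 (cid (epsE j))) addrC subrK.
  exists (H - \sum_j iota (a j) *: (G j ^+ q * in_u (jet_poly (row j B)))).
  have diagq : diag_eq k ^+ q = psX S ^+ q - (psX k ^+ q)%:A.
    by rewrite (exprB_pexp e hp) // exprZn expr1n.
  rewrite -diagq mulrBr.
  suff -> : F = realize (\sum_j tens_pure (a j) (w j))
      - diag_eq k ^+ q * \sum_j iota (a j) *: (G j ^+ q * in_u (jet_poly (row j B))).
    by rewrite opprB addrA subrK.
  rewrite (big_morph _ realizeD realize0) mulr_sumr -sumrB; apply: eq_bigr => j _.
  rewrite realize_pure wE in_uM in_uX GP (exprD_pexp e hp) // exprMn exprZn expr1n.
  rewrite mulrDl scalerDr -scalerAl mul1r scalerA.
  by rewrite -mulrA scalerAr addrK.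
have coefB i : \sum_j B j i *: (iota (a j) * eps j ^+ q) = 0.
  transitivity (F i); last by rewrite F0.
  rewrite FE; apply: eq_bigr => j _; rewrite (jet_polyE _ (ltn_ord i)) mxE.
  by congr (B _ _ *: _); apply/val_inj.
move=> j.
transitivity (\sum_l (B *m invmx B) l j *: (iota (a l) * eps l ^+ q)).
  rewrite mulmxV // (bigD1 j) //= mxE eqxx scale1r big1 ?addr0 // => l /negPf lj.
  by rewrite mxE lj scale0r.
under eq_bigr => l _ do rewrite mxE scaler_suml.
rewrite exchange_big big1 // => i _ /=.
under eq_bigr => l _ do rewrite mulrC -scalerA.
by rewrite -scaler_sumr coefB scaler0.
Qed.

End TwoVariableRealization.

(** * Principal parts of a branch *)

Section PrincipalPartsOfBranch.
Variables (k : closedFieldType) (p : nat) (hp : p \in [pchar k]).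
Variables (R : comAlgType k) (iota : {lrmorphism R -> powser k}).
Hypotheses (iota_inj : injective iota)
  (R_complete : adically_complete (max_ideal R)).
Variables (s : nat) (x : 'I_s -> R) (x_gen : power_series_generators x).
Local Notation T := (tens_alg R R).
Local Notation S := (powser k).
Let m1 := max_ideal_proper iota R_complete.

(** By [ctens_step], 1 (x) h is congruent to some r (x) 1 modulo the diagonal
    ideal; setting u = t shows that r = h. *)
Lemma diag_ideal_const (h : R) :
  diag_ideal x (ctens_const (tens_l h - tens_r h)).
Proof.
have [r [Z e]] := ctens_step R_complete x_gen m1 (ctens_const (tens_r h)).
have Ir : diag_ideal x (ctens_const (tens_r h - tens_l r)).
  rewrite ctens_constB e addrC addKr; apply: submod_sum => i _.
  exact/ideal_mulr/diag_ideal_gen.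
suff hr : h = r.
  by rewrite -opprB -[X in ctens_const X]sub0r ctens_constB sub0r {2}hr; apply: submodN.
have /ideal_pow1/(diag_pow_cong iota R_complete) := Ir.
move=> /(approx_diag_cong iota R_complete _ (approx_const _)) cong.
have [H0 e0] := in_u_sub (iota h).
have F0 : (iota (h - r))%:A = 0 :> powser S.
  apply: (@small_diag_pow _ 1) => // [i i1|n].
    by rewrite powserZE powser1E gtn_eqF ?mulr0.
  have [H Hn] := cong n; exists (H - H0).
  suff -> : (iota (h - r))%:A - (psX S ^+ 1 - (psX k ^+ 1)%:A) * (H - H0) =
    realize iota (tens_r h - tens_l r) - diag_eq k ^+ 1 * H by [].
  rewrite realizeD realizeN !realize_pure !rmorph1 in_u1 scale1r rmorphB scalerBl.
  by rewrite !expr1 -/(diag_eq k) mulrBr -e0; ring.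
apply/eqP; rewrite -subr_eq0; apply/eqP/iota_inj; rewrite rmorph0.
have := congr1 (fun F : powser S => F 0%N) F0.
by rewrite powserZE powser1E eqxx mulr1.
Qed.

Variable e : nat.
Local Notation q := (p ^ e)%N.
Hypothesis cond : forall f, ordge q f -> exists a, iota a = f.

(** In characteristic p, this is the q-th power of an element of the diagonal
    ideal. *)
Lemma diag_pow_frobenius (h : R) :
  ideal_pow (diag_ideal x) q (ctens_const (tens_l (h ^+ q) - tens_r (h ^+ q))).
Proof.
have pT : p%:R = 0 :> T.
  have : p%:R = 0 :> R by rewrite -scaler_nat (pcharf0 hp) scale0r.
  move=> pR; rewrite -[RHS]tens_l0 -pR.
  by elim: (p) => [|n IHn]; rewrite ?tens_l0 // !mulrS tens_lD IHn.
rewrite tens_lX tens_rX -(exprB_pexp e hp) // ctens_constX.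
exact/ideal_pow_exp/diag_ideal_const.
Qed.

Variables (n : nat) (nq : n.+1 = q).
Local Notation P := (principal_parts x n).

Definition ppart (t : T) : P := qpi (diag_pow_submodule x n.+1) (ctens_const t).

Lemma ppartD : {morph ppart : t u / t + u}.
Proof. by move=> t u; rewrite /ppart ctens_constD linearD. Qed.
Lemma ppart0 : ppart 0 = 0.
Proof. by apply: (addrI (ppart 0)); rewrite -ppartD !addr0. Qed.
Lemma ppartZ a t : a *: ppart t = ppart (tens_l a * t).
Proof. by rewrite /ppart ctens_constM -linearZ. Qed.
Lemma ppart_sum (I : Type) (r : seq I) (F : I -> T) :
  ppart (\sum_(i <- r) F i) = \sum_(i <- r) ppart (F i).
Proof. by apply: big_morph; [apply: ppartD | apply: ppart0]. Qed.
Lemma ppart_eq t u :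
  ppart t = ppart u <-> ideal_pow (diag_ideal x) q (ctens_const (t - u)).
Proof. by rewrite -nq ctens_constB; apply: qpi_eq. Qed.

Lemma ppart_surj (m : P) : exists t, m = ppart t.
Proof.
have [t mt] := ctens_gen R_complete x_gen m1 n.+1 (repr m).
by exists t; rewrite -[LHS](qpi_surj m); apply/qpi_eq.
Qed.

Variables (f : R) (f_X : iota f = psX k ^+ q).

Lemma f_exp_neq0 N : f ^+ N != 0.
Proof.
apply/eqP => /(congr1 iota); rewrite rmorphXn /= f_X rmorph0 -exprM.
move=> /(congr1 (fun g : S => g (q * N)%N)) /eqP.
by rewrite psXnE eqxx powser0E oner_eq0.
Qed.

Definition f_torsion : submodule P.
Proof.
exists (fun m => exists N, f ^+ N *: m = 0) => [|u v [N Nu] [M Mv]|a u [N Nu]].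
- by exists 0%N; rewrite scaler0.
- exists (N + M)%N; rewrite scalerDr [in X in X + _]addnC !exprD -!scalerA Nu Mv.
  by rewrite !scaler0 addr0.
- by exists N; rewrite scalerA mulrC -scalerA Nu scaler0.
Defined.

Variables (B : 'M[k]_q) (eps : 'I_q -> S) (w : 'I_q -> R).
Hypotheses (B_unit : B \in unitmx) (eps0 : forall j, eps j != 0)
  (wE : forall j, iota (w j) = eps j ^+ q * jet_poly (row j B))
  (w_gen : forall a, exists g : 'I_q -> S,
     iota a = \sum_j g j ^+ q * (eps j ^+ q * jet_poly (row j B))).

Definition ppart_basis (j : 'I_q) : P := ppart (tens_r (w j)).

(** Write b as the sum of the g_j^q w_j.  Both g_j^q and t^q g_j belong to R, and
    f^q g_j^q is the q-th power of t^q g_j, so it moves across the tensor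
    sign. *)
Lemma ppart_gen_r (b : R) : exists a : 'I_q -> R,
  f_torsion (ppart (tens_r b) - \sum_j a j *: ppart_basis j).
Proof.
have [g bE] := w_gen b.
have q0 := pexp_gt0 e hp.
have hE j : exists h, iota h = psX k ^+ q * g j by apply/cond/ordge_XnM.
have rE j : exists r, iota r = g j ^+ q.
  have [|a aE] := cond (f := g j ^+ q - ((g j ^+ q) 0%N)%:A).
    move=> i iq; rewrite powserBE powserZE powser1E.
    case: i iq => [_|i iq]; first by rewrite mulr1 subrr.
    by rewrite mulr0 subr0 (powser_pexpE _ hp) (gtnNdvd _ iq).
  exists (a + ((g j ^+ q) 0%N)%:A).
  by rewrite rmorphD /= linearZ /= rmorph1 aE subrK.
pose h j := projT1 (cid (hE j)); pose r j := projT1 (cid (rE j)).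
have hP j : iota (h j) = psX k ^+ q * g j := projT2 (cid (hE j)).
have rP j : iota (r j) = g j ^+ q := projT2 (cid (rE j)).
have frh j : f ^+ q * r j = h j ^+ q.
  by apply: iota_inj; rewrite rmorphM !rmorphXn /= f_X hP rP -exprMn.
have fb : f ^+ q * b = \sum_j h j ^+ q * w j.
  apply: iota_inj; rewrite rmorphM rmorph_sum /= bE mulr_sumr; apply: eq_bigr => j _.
  rewrite -frh !rmorphM /= rP wE; exact: mulrA.
exists r, q; apply/eqP; rewrite scalerBr subr_eq0; apply/eqP.
have frob a c : ppart (tens_l (a ^+ q) * tens_r c) = ppart (tens_r (a ^+ q * c)).
  apply/ppart_eq; rewrite tens_rM -mulrBl ctens_constM.
  exact/ideal_mulr/diag_pow_frobenius.
rewrite ppartZ frob fb tens_r_sum ppart_sum scaler_sumr; apply: eq_bigr => j _.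
by rewrite -frob scalerA frh ppartZ.
Qed.

Lemma ppart_gen (m : P) : exists a : 'I_q -> R,
  f_torsion (m - \sum_j a j *: ppart_basis j).
Proof.
have [t ->] := ppart_surj m.
elim/tens_ind: t => [|t u [a ta] [b ub]|a b].
- exists (fun=> 0); rewrite big1 => [|j _]; last by rewrite scale0r.
  by rewrite ppart0 subr0; apply: submod0.
- exists (fun j => a j + b j).
  rewrite (_ : \sum_j (a j + b j) *: _ =
     \sum_j a j *: ppart_basis j + \sum_j b j *: ppart_basis j).
    by rewrite (ppartD (t : T)) opprD addrACA; apply: submodD.
  by rewrite -big_split; apply: eq_bigr => j _; rewrite scalerDl.
have [c bc] := ppart_gen_r b.
exists (fun j => a * c j); rewrite -[pure a b]tens_lr -ppartZ.
under eq_bigr => j _ do rewrite -scalerA.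
by rewrite -scaler_sumr -scalerBr; apply: submodZ.
Qed.

Variables (K : fieldType) (g : {rmorphism S -> K}) (g_inj : injective g).

Lemma ppart_free (a : 'I_q -> R) :
  f_torsion (\sum_j a j *: ppart_basis j) -> forall j, a j = 0.
Proof.
move=> [N aN] j.
have : iota (f ^+ N * a j) * eps j ^+ q = 0.
  move: j; apply: (diag_pow_indep R_complete hp B_unit wE (x := x)
    (a := fun j => f ^+ N * a j)).
  rewrite -[\sum_j _]subr0; apply/ppart_eq; rewrite ppart0 -[RHS]aN scaler_sumr ppart_sum.
  by apply: eq_bigr => j _; rewrite scalerA ppartZ tens_lr.
move=> E0; have : g (iota (f ^+ N)) * g (iota (a j)) * g (eps j) ^+ q == 0.
  by rewrite -rmorphXn -!rmorphM E0 rmorph0.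
rewrite !mulf_eq0 expf_eq0.
have g0 (u : S) : g u = 0 -> u = 0 by move=> gu; apply: g_inj; rewrite gu rmorph0.
case/orP => [/orP[/eqP/g0 fN|/eqP/g0 aj]|/andP[_ /eqP/g0 ej]].
- by case/eqP: (f_exp_neq0 N); apply: iota_inj; rewrite fN rmorph0.
- by apply: iota_inj; rewrite rmorph0.
- by case/eqP: (eps0 j).
Qed.

(** P has the basis 1 (x) w_j once f is inverted, as this kills the torsion. *)
Lemma Nash_open_exists : exists U : set (spectrum R), Nash_open P q U.
Proof.
exists [set Q : spectrum R | ~ Q f]; split.
- by move=> Q Qf; exists f.
- move=> V Vopen [Q VQ]; have [h [Qh hV]] := Vopen Q VQ.
  pose gi := (g \o iota : {rmorphism R -> K}).
  have gi_inj : injective gi by exact: inj_comp.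
  have gi0 (a : R) : gi a = 0 <-> a = 0.
    by split=> [ga|->]; rewrite ?rmorph0 //; apply: gi_inj; rewrite ga rmorph0.
  have S0 : gi (0 : R^o) = 0 by exact: rmorph0.
  have SD (u v : R^o) : gi u = 0 -> gi v = 0 -> gi (u + v) = 0.
    by rewrite rmorphD => -> ->; rewrite addr0.
  have SZ (c : R) (u : R^o) : gi u = 0 -> gi (c *: u) = 0.
    by rewrite rmorphM => ->; rewrite mulr0.
  have Z1 : ~ (Submodule S0 SD SZ) (1 : R).
    by apply/eqP; rewrite -[gi _]/(gi 1) rmorph1 oner_eq0.
  have ZM (a b : R) : (Submodule S0 SD SZ) (a * b) ->
      (Submodule S0 SD SZ) a \/ (Submodule S0 SD SZ) b.
    move=> /eqP; rewrite -[gi _]/(gi (a * b)) rmorphM mulf_eq0.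
    by case/orP => /eqP; [left|right].
  exists (PrimeIdeal Z1 ZM); split.
    apply: hV => /gi0 h0; apply: Qh; rewrite h0; exact: submod0.
  by move=> /gi0 f0; have := f_exp_neq0 1; rewrite expr1 f0 eqxx.
move=> Q Qf; exists f; split=> //; exists ppart_basis; split=> [m|a a0].
  have [a [N aN]] := ppart_gen m.
  exists N, (fun j => f ^+ N * a j).
  under eq_bigr => j _ do rewrite -scalerA.
  by apply/eqP; rewrite -scaler_sumr -subr_eq0 -scalerBr aN.
exists 0%N => i; rewrite mul1r; apply: ppart_free; rewrite a0; exact: submod0.
Qed.

Lemma Nash_principal_parts_iso (U : set (spectrum R)) : Nash_open P q U ->
  Rfunctor_iso (Nash P q U) (Spec R).
Proof.
apply: (@Nash_iso_Spec R P q K (g \o iota : {rmorphism R -> K})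
  (inj_comp g_inj iota_inj) f_torsion ppart_basis _ ppart_gen ppart_free).
by move=> m [N mN]; exists (f ^+ N) => //; apply: f_exp_neq0.
Qed.

End PrincipalPartsOfBranch.

Theorem proposition3p8 (k : closedFieldType) (p : nat) (hp : p \in [pchar k])
    (R : comAlgType k) (iota : {lrmorphism R -> powser k})
    (iota_inj : injective iota)
    (R_complete : adically_complete (max_ideal R))
    (iota_finite : module_finite iota)
    (iota_normalization : is_normalization iota) :
  exists e0 : nat, forall e : nat, (e0 <= e)%N ->
    forall (s : nat) (x : 'I_s -> R), power_series_generators x ->
      (exists U : set (spectrum R), higher_Nash_open 1 x (p ^ e - 1)%N U) /\
      (forall U : set (spectrum R), higher_Nash_open 1 x (p ^ e - 1)%N U ->
         Rfunctor_iso (higher_Nash 1 x (p ^ e - 1)%N U) (Spec R)).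
Proof.
have [c cond] := conductor iota_inj iota_finite iota_normalization.
have [K [g [_ g_inj _ _]]] := iota_normalization.
exists c => e ce s x x_gen.
have cq : (c <= p ^ e)%N.
  by apply: leq_trans ce (ltnW (ltn_expl _ (prime_gt1 (pcharf_prime hp)))).
have {}cond f : ordge (p ^ e) f -> exists a, iota a = f.
  by move=> fq; apply: cond => i ic; apply/fq/(leq_trans ic).
have nq : (p ^ e - 1).+1 = (p ^ e)%N by rewrite subn1 prednK // (pexp_gt0 e hp).
have binq : 'C((p ^ e - 1) + 1, 1) = (p ^ e)%N by rewrite bin1 addn1.
have [B [eps [B_unit eps0 wex w_gen]]] := branch_frobenius_basis hp cond.
pose w j := projT1 (cid (wex j)).
have wE j : iota (w j) = eps j ^+ (p ^ e) * jet_poly (row j B) := projT2 (cid (wex j)).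
have [f f_X] : exists f, iota f = psX k ^+ (p ^ e).
  by apply: cond; rewrite -[psX k ^+ _]mulr1; apply: ordge_XnM.
rewrite /higher_Nash_open /higher_Nash binq; split.
  exact: (Nash_open_exists hp iota_inj R_complete x_gen cond nq f_X B_unit eps0 wE
    w_gen g_inj).
move=> U.
exact: (Nash_principal_parts_iso hp iota_inj R_complete x_gen cond nq f_X B_unit eps0 wE
  w_gen g_inj).
Qed.
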